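(* Let $p$ be a positive even integer. Let $z_1,\ldots,z_N$ be distinct points in $\mathbb{D}$, and consider the zero set consisting of each of these points with (positive integer) multiplicities $d_1,\ldots,d_N$, respectively. The canonical divisor in $A^p$ for this zero set is the unique function $G\in A^p$ with $\|G\|_{A^p}=1$ such that: (i) $G(0)>0$ (or $G^{(m)}(0)>0$ if $G$ is required to have a zero of order $m$ at the origin); (ii) $G^{p/2}$ has zeros of order $pd_n/2$ at each $z_n$; (iii) for some complex constants $c_0$ and $c_{nj}$ ($1\le n\le N$, $0\le j\le(p/2)d_n-1$), $$G(z)^{p/2}=c_0+\sum_{n=1}^N\sum_{j=0}^{(p/2)d_n-1}\frac{c_{nj}}{(1-\overline{z_n}z)^{j+2}}\qquad\text{if } z_n\ne0\text{ for all }n,$$ or $$G(z)^{p/2}=c_0z^{(p/2)d_1}+\sum_{j=0}^{(p/2)d_1-1}c_{1j}z^j+\sum_{n=2}^N\sum_{j=0}^{(p/2)d_n-1}\frac{c_{nj}}{(1-\overline{z_n}z)^{j+2}}\qquad\text{if } z_1=0 .$$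
   Context: $\mathbb{D}$ is the open unit disc in $\mathbb{C}$ and $\sigma$ is area measure normalized so that $\sigma(\mathbb{D})=1$. For $1<p<\infty$, $A^p$ is the Bergman space of analytic functions $f$ on $\mathbb{D}$ with $\|f\|_{A^p}=\left(\int_{\mathbb{D}}|f|^p\,d\sigma\right)^{1/p}<\infty$. Given a zero set (points of $\mathbb{D}$ with multiplicities), $N^p$ is the space of $f\in A^p$ vanishing at every point of the zero set to at least the prescribed multiplicity. Let $m\ge0$ be the multiplicity of $0$ in the zero set ($m=0$ if $0$ is not in it). The canonical divisor is the unique $G\in N^p$ with $\|G\|_{A^p}=1$ such that $G^{(m)}(0)$ is positive and as large as possible. *)

(* Defs.v *)
From HB Require Import structures.
From mathcomp Require Import all_boot all_order all_algebra.
From mathcomp Require Import complex.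
From mathcomp Require Import all_classical all_reals all_analysis.

Set Implicit Arguments.
Unset Strict Implicit.
Unset Printing Implicit Defensive.

Import Order.TTheory GRing.Theory Num.Theory.
Import numFieldNormedType.Exports.

Local Open Scope classical_set_scope.
Local Open Scope ring_scope.
Local Open Scope complex_scope.

(* The type R[i] does not canonically carry the topology that the analysis library
   puts on every numFieldType; the packaged field does. *)
Definition cplx (R : realType) : numClosedFieldType := R[i].

(* A function on the disc is represented by a total function on cplx R; its
   values off the disc are irrelevant, so functions are compared by [eq_disc].
   The norm and the order of cplx R are complex-valued; in particular [0 < w]
   means that w is real and positive. *)
Definition unit_disc (R : realType) : set (cplx R) := [set w | `|w| < 1].

Definition eq_disc (R : realType) (f g : cplx R -> cplx R) : Prop :=
  forall w : cplx R, unit_disc w -> f w = g w.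

Definition analytic_at (R : realType) (f : cplx R -> cplx R)
    (a : cplx R) : Prop :=
  exists (r : cplx R) (c : nat -> cplx R), 0 < r /\
    forall w : cplx R, `|w - a| < r ->
      series (fun k : nat => c k * (w - a) ^+ k) @ \oo --> f w.

Definition analytic_on_disc (R : realType) (f : cplx R -> cplx R) : Prop :=
  forall a, unit_disc a -> analytic_at f a.

Definition complex_of_pair (R : realType) (u : R * R) : cplx R := u.1 +i* u.2.

Definition plane_disc (R : realType) : set (R * R) :=
  @complex_of_pair R @^-1` @unit_disc R.

Lemma invr_pi_ge0 (R : realType) : 0 <= (pi : R)^-1.
Proof. by rewrite invr_ge0 pi_ge0. Qed.

(* Area measure divided by pi, so that the disc has measure 1. *)
Definition sigma (R : realType) :
    {measure set (measurableTypeR R * measurableTypeR R) -> \bar R} :=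
  mscale (NngNum (invr_pi_ge0 R))
    (@lebesgue_measure R \x @lebesgue_measure R)%E.

(* [Normc.normc] is the modulus with values in R rather than in cplx R. *)
Definition bergman_norm (R : realType) (p : R) (f : cplx R -> cplx R) : \bar R :=
  ((\int[@sigma R]_(u in @plane_disc R)
      (Normc.normc (f (complex_of_pair u)) `^ p)%:E) `^ p^-1)%E.

Definition bergman_space (R : realType) (p : R) (f : cplx R -> cplx R) : Prop :=
  analytic_on_disc f /\ (bergman_norm p f < +oo)%E.

Definition vanishes_to_order (R : realType) (f : cplx R -> cplx R) (a : cplx R)
    (k : nat) : Prop :=
  forall j, (j < k)%N -> derive1n j f a = 0.

Definition has_zero_of_order (R : realType) (f : cplx R -> cplx R) (a : cplx R)
    (k : nat) : Prop :=
  vanishes_to_order f a k /\ derive1n k f a <> 0.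

(* A zero set is given by its multiplicity function [mu] ([mu a = 0] when a is
   not in the zero set). *)
Definition Nspace (R : realType) (p : R) (mu : cplx R -> nat)
    (f : cplx R -> cplx R) : Prop :=
  bergman_space p f /\
  forall a, unit_disc a -> vanishes_to_order f a (mu a).

Definition extremal (R : realType) (p : R) (mu : cplx R -> nat)
    (G : cplx R -> cplx R) : Prop :=
  [/\ Nspace p mu G, bergman_norm p G = 1%E, 0 < derive1n (mu 0) G 0 &
      forall f, Nspace p mu f -> bergman_norm p f = 1%E ->
        0 < derive1n (mu 0) f 0 -> derive1n (mu 0) f 0 <= derive1n (mu 0) G 0].

Definition canonical_divisor (R : realType) (p : R) (mu : cplx R -> nat)
    (G : cplx R -> cplx R) : Prop :=
  extremal p mu G /\ forall H, extremal p mu H -> eq_disc H G.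

Definition finite_zero_set (R : realType) (N : nat) (z : 'I_N -> cplx R)
    (d : 'I_N -> nat) (a : cplx R) : nat :=
  (\sum_(n < N | z n == a) d n)%N.

(* In the two forms below, q stands for p/2 and F for G^(p/2). *)
Definition form_off_origin (R : realType) (q N : nat) (z : 'I_N -> cplx R)
    (d : 'I_N -> nat) (F : cplx R -> cplx R) : Prop :=
  exists (c0 : cplx R) (c : 'I_N -> nat -> cplx R),
    forall w : cplx R, unit_disc w ->
      F w = c0 + \sum_(n < N) \sum_(0 <= j < (q * d n)%N)
                   c n j / (1 - (z n)^* * w) ^+ j.+2.

(* Used when [z k = 0]: the index k of the point at the origin, conventionally
   the first one, is left arbitrary. *)
Definition form_at_origin (R : realType) (q N : nat) (z : 'I_N -> cplx R)
    (d : 'I_N -> nat) (k : 'I_N) (F : cplx R -> cplx R) : Prop :=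
  exists (c0 : cplx R) (c : 'I_N -> nat -> cplx R),
    forall w : cplx R, unit_disc w ->
      F w = c0 * w ^+ (q * d k)%N
            + \sum_(0 <= j < (q * d k)%N) c k j * w ^+ j
            + \sum_(n < N | n != k) \sum_(0 <= j < (q * d n)%N)
                c n j / (1 - (z n)^* * w) ^+ j.+2.

Definition divisor_conditions (R : realType) (p N : nat) (z : 'I_N -> cplx R)
    (d : 'I_N -> nat) (G : cplx R -> cplx R) : Prop :=
  let F := fun w : cplx R => G w ^+ p./2 in
  [/\ 0 < derive1n (finite_zero_set z d 0) G 0,
      forall n, has_zero_of_order F (z n) ((p * d n)./2)%N,
      (forall n, z n <> 0) -> form_off_origin p./2 z d F &
      forall k, z k = 0 -> form_at_origin p./2 z d k F].

(* Main.v *)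
Require Import Defs.
From HB Require Import structures.
From mathcomp Require Import all_boot all_order all_algebra.
From mathcomp Require Import complex.
From mathcomp Require Import all_classical all_reals all_analysis.
From mathcomp Require Import measurable_realfun.
From mathcomp Require Import ring lra zify.

(** Put [q = p / 2].  Since [|G|^p = |G^q|^2], the Bergman norm of [G] depends only on
    the mean square of [G^q], and the theorem reduces to the Hilbert space of square
    integrable analytic functions with the multiplicities [e n = q * d n].

    In terms of Taylor coefficients this is a weighted l2 space: the mean square of [f]
    over the disc is proportional to the sum of [|a k|^2 / (k + 1)] ([parseval]).  This
    rests on the orthogonality of distinct powers over discs about 0 ([moment_neq]) and
    on the fact that the Taylor series of an analytic function converges in the whole
    disc ([analytic_taylor]), which Cauchy's estimate for mean squares and compactness
    yield.

    Let [m] be the multiplicity of 0 in the zero set.  Call a function a kernel if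
    pairing with it is a multiple of the [m]-th Taylor coefficient on the functions
    with the prescribed zeros.  The functions of the form (iii) are kernels
    ([principal_form_kernel]): pairing with a pole of order [j + 2] at [1 / (z n)^*]
    is a combination of the derivatives at [z n] up to the order [j], and pairing with a
    monomial picks out a Taylor coefficient.  A kernel which has the prescribed zeros
    itself is determined up to a factor ([kernel_nonzero]), and by orthogonality it has
    the largest [m]-th coefficient among the functions of its norm.

    Such a kernel is found in the form of a rational function: among the numerators
    [zero_poly * Q] with [Q] of suitable degree, linear algebra provides one for which
    the simple poles disappear ([simple_poles_removable]).  It has no zeros in the disc
    besides the prescribed ones.  Indeed, multiplication by the divisor of a single point
    does not decrease the norm, by an explicit sum of squares ([expansive]); so a further
    zero could be divided out, which would contradict extremality ([no_extra_zero]).  All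
    the factors of the kernel are therefore [q]-th powers of analytic functions: the
    zeros because their multiplicities are divisible by [q], the other factors because
    the binomial series converges in the disc ([exists_linear_root]).  The [q]-th root,
    normalized, is [G] ([divisor_exists]).

    If [f] competes with [G] in the extremal problem, then [f^q] competes with [G^q], and
    expanding the squared norm of [f^q - G^q] shows that [G] is extremal, with equality
    only if [f^q = G^q] ([divisor_extremal]).  If [H] satisfies (i)-(iii), then [H^q] is a
    kernel with the prescribed zeros, hence a multiple of [G^q] ([principal_unique]).  In
    both cases the two [q]-th roots are proportional ([pow_eq_proportional]), and the
    positivity of their leading coefficients makes them equal
    ([divisor_root_unique]). *)

Set Implicit Arguments.
Unset Strict Implicit.
Unset Printing Implicit Defensive.

Import Order.TTheory GRing.Theory Num.Theory.
Import numFieldNormedType.Exports.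

Local Open Scope classical_set_scope.
Local Open Scope ring_scope.

(** * Modulus, real and imaginary parts *)

Section Modulus.
Variable R : realType.
Local Notation C := (cplx R).

Definition modulus (w : C) : R := Normc.normc w.

Definition ofreal (x : R) : C := real_complex R x.

Lemma ofreal_is_additive : additive ofreal.
Proof. exact: raddfB. Qed.
Lemma ofreal_is_multiplicative : multiplicative ofreal.
Proof. by split; [exact: rmorphM|exact: rmorph1]. Qed.
HB.instance Definition _ := GRing.isAdditive.Build R C ofreal ofreal_is_additive.
HB.instance Definition _ :=
  GRing.isMultiplicative.Build R C ofreal ofreal_is_multiplicative.

Lemma norm_modulus (w : C) : `|w| = ofreal (modulus w).
Proof. by []. Qed.

Lemma ofreal_le (x y : R) : (ofreal x <= ofreal y) = (x <= y).
Proof. exact: lecR. Qed.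
Lemma ofreal_lt (x y : R) : (ofreal x < ofreal y) = (x < y).
Proof. exact: ltcR. Qed.
Lemma ofreal_inj : injective ofreal.
Proof. exact: complexI. Qed.
Lemma ofreal_eq0 (x : R) : (ofreal x == 0) = (x == 0).
Proof. by rewrite -(inj_eq ofreal_inj x) rmorph0. Qed.
Lemma ofreal_gt0 (x : R) : (0 < ofreal x) = (0 < x).
Proof. by rewrite -(rmorph0 ofreal) ofreal_lt. Qed.
Lemma ofreal_gt0P (e : C) : 0 < e -> exists2 r : R, 0 < r & e = ofreal r.
Proof.
case: e => a b; rewrite [(_ < _)](ltcE (0 : R[i])) /= => /andP[/eqP-> a0].
by exists a.
Qed.

Lemma modulus_ge0 (w : C) : 0 <= modulus w.
Proof. by rewrite -ofreal_le -norm_modulus normr_ge0. Qed.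
Lemma modulus0 : modulus 0 = 0.
Proof. by apply: ofreal_inj; rewrite -norm_modulus normr0 rmorph0. Qed.
Lemma modulus1 : modulus 1 = 1.
Proof. by apply: ofreal_inj; rewrite -norm_modulus normr1 rmorph1. Qed.
Lemma modulusM (w z : C) : modulus (w * z) = modulus w * modulus z.
Proof. by apply: ofreal_inj; rewrite rmorphM -!norm_modulus normrM. Qed.
Lemma modulusX (w : C) n : modulus (w ^+ n) = modulus w ^+ n.
Proof. by apply: ofreal_inj; rewrite rmorphXn -!norm_modulus normrX. Qed.
Lemma modulusV (w : C) : modulus w^-1 = (modulus w)^-1.
Proof. by apply: ofreal_inj; rewrite fmorphV -!norm_modulus normfV. Qed.
Lemma modulusN (w : C) : modulus (- w) = modulus w.
Proof. by apply: ofreal_inj; rewrite -!norm_modulus normrN. Qed.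
Lemma modulusB (w z : C) : modulus (w - z) = modulus (z - w).
Proof. by rewrite -modulusN opprB. Qed.
Lemma ler_modulusD (w z : C) : modulus (w + z) <= modulus w + modulus z.
Proof. by rewrite -ofreal_le rmorphD -!norm_modulus ler_normD. Qed.
Lemma modulus_eq0 (w : C) : (modulus w == 0) = (w == 0).
Proof.
by rewrite -(normr_eq0 w) norm_modulus -(inj_eq ofreal_inj (modulus w)) rmorph0.
Qed.
Lemma modulus_gt0 (w : C) : (0 < modulus w) = (w != 0).
Proof. by rewrite lt_def modulus_ge0 andbT modulus_eq0. Qed.
Lemma modulus_nat n : modulus n%:R = n%:R.
Proof. by apply: ofreal_inj; rewrite -norm_modulus normr_nat rmorph_nat. Qed.
Lemma modulus_ofreal (x : R) : 0 <= x -> modulus (ofreal x) = x.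
Proof.
move=> x0; apply: ofreal_inj; rewrite -norm_modulus ger0_norm //.
by rewrite -(rmorph0 ofreal) ofreal_le.
Qed.
Lemma modulus_conj (w : C) : modulus w^* = modulus w.
Proof. by apply: ofreal_inj; rewrite -!norm_modulus norm_conjC. Qed.
Lemma modulus_sqr (w : C) : ofreal (modulus w ^+ 2) = w * w^*.
Proof. by rewrite -normCK norm_modulus rmorphXn. Qed.
Lemma modulus_sum (I : Type) (s : seq I) (P : pred I) (F : I -> C) :
  modulus (\sum_(i <- s | P i) F i) <= \sum_(i <- s | P i) modulus (F i).
Proof.
apply: (big_rec2 (fun x y => modulus x <= y)); first by rewrite modulus0.
move=> i y x _ xy; apply: le_trans (ler_modulusD _ _) _.
by rewrite lerD2l.
Qed.
Lemma unit_discE (w : C) : unit_disc w <-> modulus w < 1.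
Proof. by rewrite /unit_disc /= norm_modulus -(rmorph1 ofreal) ofreal_lt. Qed.

Definition re (w : C) : R := complex.Re w.
Definition im (w : C) : R := complex.Im w.

Lemma reD : {morph re : x y / x + y}. Proof. by case=> [a b] [c d]. Qed.
Lemma imD : {morph im : x y / x + y}. Proof. by case=> [a b] [c d]. Qed.
Lemma re_sum (I : Type) (s : seq I) (P : pred I) (F : I -> C) :
  re (\sum_(i <- s | P i) F i) = \sum_(i <- s | P i) re (F i).
Proof. exact: (big_morph re reD). Qed.
Lemma im_sum (I : Type) (s : seq I) (P : pred I) (F : I -> C) :
  im (\sum_(i <- s | P i) F i) = \sum_(i <- s | P i) im (F i).
Proof. exact: (big_morph im imD). Qed.
Lemma reM (x y : C) : re (x * y) = re x * re y - im x * im y.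
Proof. by case: x y => [a b] [c d]. Qed.
Lemma imM (x y : C) : im (x * y) = re x * im y + im x * re y.
Proof. by case: x y => [a b] [c d]. Qed.
Lemma reN (x : C) : re (- x) = - re x. Proof. by case: x. Qed.
Lemma imN (x : C) : im (- x) = - im x. Proof. by case: x. Qed.
Lemma re_ofreal x : re (ofreal x) = x. Proof. by []. Qed.
Lemma im_ofreal x : im (ofreal x) = 0. Proof. by []. Qed.
Lemma re_conj (x : C) : re x^* = re x.
Proof. by case: x => a b; rewrite -[_^*]/(conjc _). Qed.
Lemma im_conj (x : C) : im x^* = - im x.
Proof. by case: x => a b; rewrite -[_^*]/(conjc _). Qed.
Lemma reim_eq (x y : C) : re x = re y -> im x = im y -> x = y.
Proof. by case: x y => [a b] [c d]; rewrite /re /im /= => -> ->. Qed.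
Lemma modulus_reim (w : C) : modulus w = Num.sqrt (re w ^+ 2 + im w ^+ 2).
Proof. by case: w. Qed.
Lemma modulus2_reim (w : C) : modulus w ^+ 2 = re w ^+ 2 + im w ^+ 2.
Proof. by rewrite modulus_reim sqr_sqrtr // addr_ge0 ?sqr_ge0. Qed.
Lemma re_le_modulus (w : C) : `|re w| <= modulus w.
Proof.
rewrite -(ler_pXn2r (_ : 0 < 2)%N) ?nnegrE ?modulus_ge0 //.
by rewrite modulus2_reim real_normK ?num_real // lerDl sqr_ge0.
Qed.
Lemma im_le_modulus (w : C) : `|im w| <= modulus w.
Proof.
rewrite -(ler_pXn2r (_ : 0 < 2)%N) ?nnegrE ?modulus_ge0 //.
by rewrite modulus2_reim real_normK ?num_real // lerDr sqr_ge0.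
Qed.
Lemma modulus_le_reim (w : C) : modulus w <= `|re w| + `|im w|.
Proof.
rewrite -(ler_pXn2r (_ : 0 < 2)%N) ?nnegrE ?modulus_ge0 ?addr_ge0 //.
rewrite modulus2_reim sqrrD !real_normK ?num_real //.
by rewrite lerD2r lerDl mulrn_wge0 // mulr_ge0.
Qed.
Lemma ofreal_re_im (w : C) : w = ofreal (re w) + 'i * ofreal (im w).
Proof.
have /= := complexE (w : R[i]); rewrite complexiE => <- //.
Qed.

Lemma cvg_modulusP {T : Type} (F : set_system T) {FF : Filter F} (u : T -> C) (l : C) :
  u @ F --> l <-> (fun t => modulus (u t - l)) @ F --> (0 : R).
Proof.
split.
  move=> /cvgrPdist_lt ul; apply/cvgrPdist_lt => e e0.
  have := ul (ofreal e); rewrite ofreal_gt0 => /(_ e0).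
  apply: filterS => t; rewrite norm_modulus ofreal_lt sub0r normrN.
  by rewrite (ger0_norm (modulus_ge0 _)) modulusB.
move=> /cvgrPdist_lt ul; apply/cvgrPdist_lt => e /ofreal_gt0P[r r0 ->].
have := ul r r0; apply: filterS => t; rewrite norm_modulus ofreal_lt sub0r normrN.
by rewrite (ger0_norm (modulus_ge0 _)) modulusB.
Qed.

Lemma cvg_re (u : nat -> C) (l : C) : u @ \oo --> l -> re \o u @ \oo --> re l.
Proof.
move=> /cvg_modulusP/cvgrPdist_lt ul; apply/cvgrPdist_lt => e /ul.
apply: filterS => t; rewrite sub0r normrN (ger0_norm (modulus_ge0 _)).
apply: le_lt_trans; rewrite /= distrC -reN -reD; exact: re_le_modulus.
Qed.
Lemma cvg_reim (u : nat -> C) (a b : R) :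
  re \o u @ \oo --> a -> im \o u @ \oo --> b ->
  u @ \oo --> (ofreal a + 'i * ofreal b : C).
Proof.
move=> ua ub; apply/cvg_modulusP.
have h : (fun n => `|re (u n) - a| + `|im (u n) - b|) @ \oo --> (0 : R).
  rewrite -[X in _ --> X](addr0 0); apply: cvgD.
    rewrite -(normr0 R) -[X in `|X|](subrr a); apply: cvg_norm.
    by apply: cvgB => //; exact: cvg_cst.
  by rewrite -(normr0 R) -[X in `|X|](subrr b); apply: cvg_norm; apply: cvgB => //; exact: cvg_cst.
apply: squeeze_cvgr h; last exact: cvg_cst.
near=> n; rewrite modulus_ge0 /=; apply: le_trans (modulus_le_reim _) _.
rewrite !(reD, imD, reN, imN, reM, imM, re_ofreal, im_ofreal).
have -> : re ('i : C) = 0 by rewrite -[('i : C)]complexiE.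
have -> : im ('i : C) = 1 by rewrite -[('i : C)]complexiE.
by rewrite !(mul0r, mulr0, subr0, add0r, addr0, mul1r, mulr1) lexx.
Unshelve. all: by end_near.
Qed.

Lemma cvg_modulus (u : nat -> C) (l : C) :
  u @ \oo --> l -> (fun n => modulus (u n)) @ \oo --> modulus l.
Proof.
move=> /cvg_modulusP/cvgrPdist_lt ul; apply/cvgrPdist_lt => e /ul.
apply: filterS => t; rewrite sub0r normrN (ger0_norm (modulus_ge0 _)).
apply: le_lt_trans; rewrite ler_norml lerBlDr lerNl opprB lerBlDr /=.
apply/andP; split; last first.
  by rewrite modulusB; apply: le_trans (ler_modulusD _ _); rewrite subrK.
by rewrite addrC; apply: le_trans (ler_modulusD _ _); rewrite addrC subrK.
Qed.

End Modulus.

(** * Geometric majorants *)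

Section GeometricSeries.
Variable R : realType.
Local Notation C := (cplx R).

Lemma sum_geo_tail (th : R) K N : 0 <= th -> th < 1 ->
  \sum_(0 <= n < N) (if (n < K)%N then 0 else th ^+ n) <= th ^+ K / (1 - th).
Proof.
move=> t0 t1; have d0 : 0 < 1 - th by rewrite subr_gt0.
have [NK|KN] := leqP N K.
  rewrite big_nat_cond big1; first by apply: divr_ge0; [exact: exprn_ge0 | exact: ltW].
  by move=> n /andP[/andP[_ nN] _]; rewrite (leq_trans nN NK).
rewrite ler_pdivlMr //.
suff -> : (\sum_(0 <= n < N) (if (n < K)%N then 0 else th ^+ n)) * (1 - th) =
  th ^+ K - th ^+ N by rewrite gerBl exprn_ge0.
rewrite -(subnKC (ltnW KN)); elim: (N - K)%N => [|m IH].
  rewrite addn0 subrr big_nat_cond big1 ?mul0r //.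
  by move=> n /andP[/andP[_ nN] _]; rewrite nN.
rewrite addnS big_nat_recr //= mulrDl IH ltnNge leq_addr /= mulrBr mulr1.
by rewrite -exprSr addrA subrK.
Qed.

(** A factor growing linearly, such as the number of terms of degree [n] in a Cauchy
    product, is absorbed by a larger ratio. *)
Lemma lin_geo_bound (th : R) : 0 <= th -> th < 1 ->
  exists K eta : R, [/\ 0 <= K, 0 <= eta, eta < 1 &
    forall n, n.+1%:R * th ^+ n <= K * eta ^+ n].
Proof.
move=> t0 t1; pose eta := (1 + th) / 2; pose rho := th / eta.
have eta0 : 0 < eta by rewrite /eta; lra.
have eta1 : eta < 1 by rewrite /eta; lra.
have rho0 : 0 <= rho by rewrite divr_ge0 // ltW.
have rho1 : rho < 1 by rewrite ltr_pdivrMr // /eta; lra.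
exists (1 - rho)^-1, eta; split => //; try exact: ltW.
  by rewrite invr_ge0 subr_ge0 ltW.
move=> n; have -> : th = rho * eta by rewrite divfK // gt_eqF.
rewrite exprMn mulrA ler_wpM2r ?exprn_ge0 ?(ltW eta0) //.
rewrite -(div1r (1 - rho)) -(expr0 rho).
apply: le_trans (sum_geo_tail 0 n.+1 rho0 rho1).
have -> : n.+1%:R * rho ^+ n = \sum_(0 <= k < n.+1) rho ^+ n.
  by rewrite big_const_nat subn0 iter_addr_0 mulr_natl.
rewrite big_nat_cond [leRHS]big_nat_cond.
by apply: ler_sum => k /andP[/andP[_ kn] _]; rewrite ler_wiXn2l // ltW.
Qed.

Lemma cvg_geo (K th : R) : 0 <= th -> th < 1 ->
  (fun n => K * th ^+ n) @ \oo --> (0 : R).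
Proof. by move=> t0 t1; apply: cvg_geometric; rewrite ger0_norm. Qed.

Lemma squeeze_modulus (u : nat -> C) (l : C) (v : nat -> R) :
  (forall n, modulus (u n - l) <= v n) -> v @ \oo --> (0 : R) -> u @ \oo --> l.
Proof.
move=> uv v0; apply/cvg_modulusP; apply: squeeze_cvgr v0; last exact: cvg_cst.
by apply: nearW => n; rewrite modulus_ge0 uv.
Qed.

Lemma limit_unique (u : nat -> C) (l l' : C) :
  u @ \oo --> l -> u @ \oo --> l' -> l = l'.
Proof. by move=> h h'; apply: (cvg_unique _ h h'). Qed.

Lemma cvg_finite_sum K (v : nat -> nat -> C) (l : nat -> C) :
  (forall k, v k @ \oo --> l k) ->
  (fun N => \sum_(0 <= k < K) v k N) @ \oo --> \sum_(0 <= k < K) l k.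
Proof.
move=> vl; elim: K => [|K IH].
  rewrite big_geq; last by [].
  rewrite (_ : (fun N => _) = cst 0); last by apply/funext => N; rewrite big_geq.
  exact: cvg_cst.
rewrite big_nat_recr; last by [].
rewrite (_ : (fun N => _) = (fun N => \sum_(0 <= k < K) v k N) \+ v K); last first.
  by apply/funext => N; rewrite big_nat_recr.
apply: cvgD; first exact: IH.
exact: vl.
Qed.

Section Geo.
Variables (u : nat -> C) (M th : R).
Hypotheses (t0 : 0 <= th) (t1 : th < 1).
Hypothesis uM : forall n, modulus (u n) <= M * th ^+ n.

Let M0 : 0 <= M.
Proof. by have := le_trans (modulus_ge0 _) (uM 0); rewrite expr0 mulr1. Qed.

Lemma geo_series_cvg : exists l : C, series u @ \oo --> l.
Proof.
have real_case (v : nat -> R) : (forall n, `|v n| <= M * th ^+ n) -> cvgn (series v).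
  move=> vM; apply: normed_cvg; apply: (@series_le_cvg _ _ (geometric M th)).
  - by move=> n; exact: normr_ge0.
  - by move=> n; rewrite mulr_ge0 // exprn_ge0.
  - exact: vM.
  - by apply: is_cvg_geometric_series; rewrite ger0_norm.
have /cvg_ex[/= a ua] : cvgn (series (fun n => re (u n))).
  by apply: real_case => n; exact: le_trans (re_le_modulus _) (uM n).
have /cvg_ex[/= b ub] : cvgn (series (fun n => im (u n))).
  by apply: real_case => n; exact: le_trans (im_le_modulus _) (uM n).
exists (ofreal a + 'i * ofreal b); apply: cvg_reim.
  rewrite (_ : _ \o _ = series (fun n => re (u n))) //.
  by apply/funext => n; rewrite /series /= re_sum.
rewrite (_ : _ \o _ = series (fun n => im (u n))) //.
by apply/funext => n; rewrite /series /= im_sum.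
Qed.

Lemma geo_series_tail (l : C) n : series u @ \oo --> l ->
  modulus (l - series u n) <= M * th ^+ n / (1 - th).
Proof.
move=> ul.
have h : (fun N => modulus (series u N - series u n)) @ \oo -->
    modulus (l - series u n).
  apply: cvg_modulus.
  apply: cvgB.
  exact: ul.
  exact: cvg_cst.
apply: (ler_cvg_to h (cvg_cst _)); near=> N.
have nN : (n <= N)%N by near: N; exact: nbhs_infty_ge.
rewrite /series /= (big_cat_nat _ nN) //= addrAC subrr add0r.
apply: le_trans (modulus_sum _ _ _) _.
rewrite -mulrA; apply: le_trans _ (ler_wpM2l M0 (sum_geo_tail n N t0 t1)).
rewrite [X in _ <= _ * X](big_cat_nat _ nN) //=.
rewrite [X in _ <= _ * (X + _)]big_nat_cond [X in _ <= _ * (X + _)]big1 ?add0r; last first.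
  by move=> i /andP[/andP[_ ->] _].
rewrite mulr_sumr big_nat_cond [leRHS]big_nat_cond.
by apply: ler_sum => i /andP[/andP[ni _] _]; rewrite ltnNge ni /=; exact: uM.
Unshelve. all: by end_near.
Qed.

End Geo.
End GeometricSeries.

(** * Power series, change of centre, Cauchy products *)

Section PowerSeries.
Variable R : realType.
Local Notation C := (cplx R).
Implicit Types (a b : nat -> C) (c u w S : C) (r s t M : R) (f g : C -> C).

Definition coef_bound a r M := forall n, modulus (a n) * r ^+ n <= M.

Definition psum a w S := series (fun k => a k * w ^+ k) @ \oo --> S.

Lemma psum_unique a w S S' : psum a w S -> psum a w S' -> S = S'.
Proof. exact: limit_unique. Qed.

Lemma coef_bound_ge0 a r M : coef_bound a r M -> 0 <= M.
Proof.
by move=> /(_ 0); rewrite expr0 mulr1; apply: le_trans; exact: modulus_ge0.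
Qed.

Lemma coef_bound_term a r M s n : 0 < r -> 0 <= s -> coef_bound a r M ->
  modulus (a n) * s ^+ n <= M * (s / r) ^+ n.
Proof.
move=> r0 s0 aM; rewrite expr_div_n mulrA ler_pdivlMr ?exprn_gt0 //.
by rewrite mulrAC ler_wpM2r ?exprn_ge0.
Qed.

Lemma coef_bound_le a r s M : 0 <= s <= r -> coef_bound a r M -> coef_bound a s M.
Proof.
move=> /andP[s0 sr] aM n; apply: le_trans (aM n).
by rewrite ler_wpM2l ?modulus_ge0 // lerXn2r ?nnegrE // (le_trans s0).
Qed.

Lemma ratio_lt1 r s : 0 <= s -> s < r -> 0 <= s / r /\ s / r < 1.
Proof.
move=> s0 sr; have r0 : 0 < r by exact: le_lt_trans sr.
by split; [rewrite divr_ge0 // ltW | rewrite ltr_pdivrMr // mul1r].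
Qed.

Lemma radius_between w s : modulus w < s -> exists r, [/\ 0 <= r, modulus w < r & r < s].
Proof.
by have w0 := modulus_ge0 w => ws; exists ((modulus w + s) / 2); split; lra.
Qed.

Lemma psum_exists a r M w : coef_bound a r M -> modulus w < r ->
  exists S, psum a w S.
Proof.
move=> aM wr; have [t0 t1] := ratio_lt1 (modulus_ge0 w) wr.
apply: (geo_series_cvg (M := M) t0 t1) => n.
rewrite modulusM modulusX coef_bound_term ?modulus_ge0 //.
exact: le_lt_trans (modulus_ge0 _) wr.
Qed.

Lemma psum_tail a r M w S n : coef_bound a r M -> modulus w < r -> psum a w S ->
  modulus (S - series (fun k => a k * w ^+ k) n) <=
    M * (modulus w / r) ^+ n / (1 - modulus w / r).
Proof.
move=> aM wr; have [t0 t1] := ratio_lt1 (modulus_ge0 w) wr.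
apply: (geo_series_tail (M := M) t0 t1) => k.
rewrite modulusM modulusX coef_bound_term ?modulus_ge0 //.
exact: le_lt_trans (modulus_ge0 _) wr.
Qed.

(** The terms of a convergent series are bounded. *)
Lemma psum_coef_bound a r S : 0 <= r -> psum a (ofreal r) S ->
  exists M, coef_bound a r M.
Proof.
move=> r0 aS.
have h0 : (fun k => modulus (a k * ofreal r ^+ k)) @ \oo --> (0 : R).
  have : (fun k => a k * ofreal r ^+ k) @ \oo --> (0 : C).
    by apply: cvg_series_cvg_0; apply/cvg_ex; exists S.
  by move=> /cvg_modulus; rewrite modulus0.
have /cvg_seq_bounded[M [_ /(_ (M + 1))]] :
    cvgn (fun k => modulus (a k * ofreal r ^+ k)) by apply/cvg_ex; exists 0.
rewrite ltrDl ltr01 => /(_ isT) MM; exists (M + 1) => n.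
have /= := MM n I; rewrite modulusM modulusX modulus_ofreal //.
by rewrite ger0_norm // mulr_ge0 ?modulus_ge0 ?exprn_ge0.
Qed.

Lemma binom_term_le s t n k : 0 <= s -> 0 <= t ->
  'C(n, k)%:R * s ^+ (n - k) * t ^+ k <= (s + t) ^+ n.
Proof.
move=> s0 t0; have [kn|nk] := leqP k n; last first.
  by rewrite bin_small // !mul0r exprn_ge0 // addr_ge0.
rewrite exprDn (bigD1 (Ordinal (kn : (k < n.+1)%N))) //=.
rewrite -mulrA mulr_natl lerDl; apply: sumr_ge0 => i _.
by rewrite mulrn_wge0 // mulr_ge0 ?exprn_ge0.
Qed.

(** The coefficients of the expansion about [b] of the power series [a]. *)
Definition recenter a (b : C) k : C :=
  limn (series (fun n => a n * 'C(n, k)%:R * b ^+ (n - k))).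

Lemma recenter_term_le a r M (b : C) t k n : 0 < t -> coef_bound a r M ->
  modulus b + t < r ->
  modulus (a n * 'C(n, k)%:R * b ^+ (n - k)) <=
    M / t ^+ k * ((modulus b + t) / r) ^+ n.
Proof.
move=> t0 aM btr; have b0 := modulus_ge0 b.
rewrite !modulusM modulusX modulus_nat.
rewrite (mulrAC M) ler_pdivlMr ?exprn_gt0 // -!mulrA.
have r0 : 0 < r by apply: le_lt_trans btr; rewrite addr_ge0 // ltW.
apply: le_trans _ (coef_bound_term n r0 (addr_ge0 b0 (ltW t0)) aM).
by rewrite ler_wpM2l ?modulus_ge0 // mulrA binom_term_le // ltW.
Qed.

Lemma recenter_cvg a r M (b : C) k : coef_bound a r M -> modulus b < r ->
  series (fun n => a n * 'C(n, k)%:R * b ^+ (n - k)) @ \oo --> recenter a b k.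
Proof.
move=> aM br; pose t := (r - modulus b) / 2.
have t0 : 0 < t by rewrite /t; lra.
have btr : modulus b + t < r by rewrite /t; lra.
have [h0 h1] := ratio_lt1 (addr_ge0 (modulus_ge0 b) (ltW t0)) btr.
have [l ul] := geo_series_cvg h0 h1 (fun n => recenter_term_le k n t0 aM btr).
by apply/cvg_ex; exists l.
Qed.

Lemma recenter_bound a r M (b : C) t : coef_bound a r M -> 0 < t ->
  modulus b + t < r ->
  coef_bound (recenter a b) t (M / (1 - (modulus b + t) / r)).
Proof.
move=> aM t0 btr k.
have [h0 h1] := ratio_lt1 (addr_ge0 (modulus_ge0 b) (ltW t0)) btr.
have br : modulus b < r by apply: le_lt_trans btr; rewrite lerDl ltW.
have := geo_series_tail h0 h1 (fun n => recenter_term_le k n t0 aM btr) 0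
  (recenter_cvg (k:=k) aM br).
rewrite /series /= big_nil subr0 expr0 mulr1 => h.
by rewrite -ler_pdivlMr ?exprn_gt0 // mulrAC.
Qed.

Lemma binomial_truncation_le (b u : C) n K :
  modulus ((b + u) ^+ n - \sum_(0 <= k < K) 'C(n, k)%:R * b ^+ (n - k) * u ^+ k) <=
  if (n < K)%N then 0 else (modulus b + modulus u) ^+ n.
Proof.
have E : (b + u) ^+ n = \sum_(0 <= k < n.+1) 'C(n, k)%:R * b ^+ (n - k) * u ^+ k.
  rewrite exprDn big_mkord; apply: eq_bigr => i _.
  by rewrite -mulr_natl mulrA.
case: ifPn => [nK|]; last first.
  rewrite -leqNgt => Kn; rewrite E (big_cat_nat _ (leqW Kn)) //= addrAC subrr add0r.
  apply: le_trans (modulus_sum _ _ _) _.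
  rewrite exprDn -(big_mkord predT (fun i => modulus b ^+ (n - i) * modulus u ^+ i *+ 'C(n, i))).
  rewrite [leRHS](big_cat_nat _ (leqW Kn)) //= addrC.
  apply: ler_wpDr.
    by apply: sumr_ge0 => i _; rewrite mulrn_wge0 // mulr_ge0 // exprn_ge0 // modulus_ge0.
  by apply: ler_sum => i _; rewrite !modulusM !modulusX modulus_nat -mulrA mulr_natl.
rewrite E (big_cat_nat _ nK) //= opprD addrA subrr sub0r big_nat_cond big1.
  by rewrite oppr0 modulus0.
by move=> i /andP[/andP[ni _] _]; rewrite bin_small // !mul0r.
Qed.

(** Cutting every binomial expansion at the exponent [K] costs at most a geometric
    tail, uniformly in the number of terms of the series. *)
Lemma recenter_sum a r M (b u : C) S : coef_bound a r M ->
  modulus b + modulus u < r -> psum a (b + u) S -> psum (recenter a b) u S.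
Proof.
move=> aM bur aS.
have b0 := modulus_ge0 b; have u0 := modulus_ge0 u.
have br : modulus b < r by apply: le_lt_trans bur; rewrite lerDl.
have r0 : 0 < r by apply: le_lt_trans br.
have [h0 h1] := ratio_lt1 (addr_ge0 b0 u0) bur.
set th := (modulus b + modulus u) / r in h0 h1.
apply: (@squeeze_modulus _ _ _ (fun K => M / (1 - th) * th ^+ K)); last exact: cvg_geo.
move=> K; rewrite modulusB.
pose D N := series (fun k => a k * (b + u) ^+ k) N -
   \sum_(0 <= k < K) series (fun n => a n * 'C(n, k)%:R * b ^+ (n - k)) N * u ^+ k.
have DK : D @ \oo --> (S - series (fun k => recenter a b k * u ^+ k) K).
  apply: cvgB; first exact: aS.
  apply: (@cvg_finite_sum _ K
    (fun k N => series (fun n => a n * 'C(n, k)%:R * b ^+ (n - k)) N * u ^+ k)) => k.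
  apply: cvgM; last exact: cvg_cst.
  exact: recenter_cvg aM br.
apply: (ler_cvg_to (cvg_modulus DK) (cvg_cst _)); apply: nearW => N /=.
have -> : D N = \sum_(0 <= n < N) a n *
    ((b + u) ^+ n - \sum_(0 <= k < K) 'C(n, k)%:R * b ^+ (n - k) * u ^+ k).
  rewrite /D /series /=; under [X in _ - X]eq_bigr do rewrite mulr_suml.
  rewrite exchange_big /= -sumrB; apply: eq_bigr => n _.
  rewrite mulrBr mulr_sumr; congr (_ - _); apply: eq_bigr => k _.
  by rewrite !mulrA.
apply: le_trans (modulus_sum _ _ _) _.
apply: (@le_trans _ _ (\sum_(0 <= n < N) M * (if (n < K)%N then 0 else th ^+ n))).
  apply: ler_sum => n _; rewrite modulusM.
  have := ler_wpM2l (modulus_ge0 (a n)) (binomial_truncation_le b u n K).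
  case: ifP => _; first by rewrite !mulr0.
  move=> h; apply: le_trans h _.
  exact: coef_bound_term (addr_ge0 b0 u0) aM.
rewrite -mulr_sumr -mulrA (mulrC _^-1).
by rewrite ler_wpM2l ?(coef_bound_ge0 aM) // sum_geo_tail.
Qed.

Definition conv a b n : C := \sum_(0 <= i < n.+1) a i * b (n - i)%N.

Lemma conv_sum (al be : nat -> C) N :
  series (conv al be) N = \sum_(0 <= i < N) al i * series be (N - i)%N.
Proof.
rewrite /series /=; elim: N => [|N IH]; first by rewrite !big_nil.
rewrite !big_nat_recr //= IH subSnn big_nat1 /conv big_nat_recr //= subnn addrA.
congr (_ + _); rewrite -big_split /=; apply: eq_big_nat => i /andP[_ iN].
by rewrite subSn ?(ltnW iN) // big_nat_recr //= mulrDr.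
Qed.

Lemma psum_conv a b r M M' w A B : coef_bound a r M -> coef_bound b r M' ->
  modulus w < r -> psum a w A -> psum b w B -> psum (conv a b) w (A * B).
Proof.
move=> aM bM wr aA bB; have w0 := modulus_ge0 w.
have r0 : 0 < r by exact: le_lt_trans wr.
have [h0 h1] := ratio_lt1 w0 wr; set th := modulus w / r in h0 h1.
pose al k := a k * w ^+ k; pose be k := b k * w ^+ k.
have E : (fun k => conv a b k * w ^+ k) = conv al be.
  apply/funext => k; rewrite /conv mulr_suml; apply: eq_big_nat => i /andP[_ ik].
  by rewrite /al /be mulrACA -exprD subnKC.
have alM k : modulus (al k) <= M * th ^+ k.
  by rewrite modulusM modulusX coef_bound_term.
rewrite /psum E.
have [K [eta [K0 e0 e1 Keta]]] := lin_geo_bound h0 h1.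
have -> : A * B = 0 + A * B by rewrite add0r.
have -> : series (conv al be) =
    (fun N => series (conv al be) N - series al N * B) \+ (fun N => series al N * B).
  by apply/funext => N /=; rewrite subrK.
apply: cvgD; last by apply: cvgM; [exact: aA | exact: cvg_cst].
apply: (@squeeze_modulus _ _ _ (fun N => (M * M' / (1 - th) * K) * eta ^+ N)); last exact: cvg_geo.
move=> N; rewrite subr0 conv_sum /series /= mulr_suml -sumrB.
apply: le_trans (modulus_sum _ _ _) _.
apply: (@le_trans _ _ (\sum_(0 <= i < N) M * M' / (1 - th) * th ^+ N)).
  rewrite big_nat_cond [leRHS]big_nat_cond; apply: ler_sum => i /andP[/andP[_ iN] _].
  rewrite -mulrBr modulusM modulusB.
  apply: le_trans (ler_wpM2l (modulus_ge0 _) (psum_tail (N - i) bM wr bB)) _.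
  rewrite -/th; apply: le_trans (ler_wpM2r _ (alM i)) _.
    by rewrite !mulr_ge0 ?(coef_bound_ge0 bM) ?exprn_ge0 ?invr_ge0 ?subr_ge0 ?(ltW h1).
  rewrite le_eqVlt; apply/orP; left; apply/eqP.
  have -> : th ^+ N = th ^+ i * th ^+ (N - i) by rewrite -exprD subnKC // ltnW.
  by ring.
rewrite big_const_nat subn0 iter_addr_0 -mulr_natl mulrCA -!mulrA.
have P0 : 0 <= M * (M' / (1 - th)).
  by rewrite !mulr_ge0 ?(coef_bound_ge0 aM) ?(coef_bound_ge0 bM) ?invr_ge0 ?subr_ge0 ?(ltW h1).
rewrite [leLHS](_ : _ = (M * (M' / (1 - th))) * (N%:R * th ^+ N)); last by ring.
rewrite [leRHS](_ : _ = (M * (M' / (1 - th))) * (K * eta ^+ N)); last by ring.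
apply: ler_wpM2l => //; apply: le_trans (Keta N).
by rewrite ler_wpM2r ?exprn_ge0 // ler_nat.
Qed.

Lemma coef_bound_conv a b r s M M' : 0 <= s -> s < r ->
  coef_bound a r M -> coef_bound b r M' -> exists K, coef_bound (conv a b) s K.
Proof.
move=> s0 sr aM bM; have [h0 h1] := ratio_lt1 s0 sr.
have r0 : 0 < r by exact: le_lt_trans sr.
have [K [eta [K0 e0 e1 Keta]]] := lin_geo_bound h0 h1.
exists (M * M' * K) => n; rewrite /conv.
apply: le_trans (ler_wpM2r _ (modulus_sum _ _ _)) _; first exact: exprn_ge0.
rewrite mulr_suml.
apply: (@le_trans _ _ (\sum_(0 <= i < n.+1) M * M' * (s / r) ^+ n)).
  rewrite big_nat_cond [leRHS]big_nat_cond; apply: ler_sum => i /andP[/andP[_ iN] _].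
  have -> : (s / r) ^+ n = (s / r) ^+ i * (s / r) ^+ (n - i) by rewrite -exprD subnKC.
  have -> : s ^+ n = s ^+ i * s ^+ (n - i) by rewrite -exprD subnKC.
  rewrite modulusM mulrACA [leRHS]mulrACA ler_pM ?mulr_ge0 ?modulus_ge0 ?exprn_ge0 //;
    by rewrite coef_bound_term.
rewrite big_const_nat subn0 iter_addr_0 -mulr_natl mulrCA.
apply: ler_wpM2l; first by rewrite mulr_ge0 ?(coef_bound_ge0 aM) ?(coef_bound_ge0 bM).
by apply: le_trans (Keta n) _; rewrite ler_piMr // exprn_ile1 // ltW.
Qed.

End PowerSeries.

(** * Local expansions of analytic functions *)

Section LocalExpansion.
Variable R : realType.
Local Notation C := (cplx R).
Implicit Types (a b : nat -> C) (c u w S : C) (r s t M : R) (f g : C -> C).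

(** Unlike [analytic_at], this names the coefficients, and it carries a bound for them
    from which the error of partial sums is estimated. *)
Definition expansion f c a :=
  exists r M, [/\ 0 < r, coef_bound a r M &
    forall u, modulus u < r -> psum a u (f (c + u))].

Lemma expansion_of_psum f c a r : 0 < r ->
  (forall u, modulus u < r -> psum a u (f (c + u))) -> expansion f c a.
Proof.
move=> r0 h; have r20 : 0 < r / 2 by rewrite divr_gt0.
have r2r : r / 2 < r by rewrite ltr_pdivrMr // ltr_pMr // ltr1n.
have [|M aM] := psum_coef_bound (ltW r20) (h (ofreal (r / 2)) _).
  by rewrite modulus_ofreal // ltW.
by exists (r / 2), M; split=> // u ur; apply: h; exact: lt_trans r2r.
Qed.

Lemma analytic_expansion f c : analytic_at f c <-> exists a, expansion f c a.
Proof.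
split=> [[e [a [/ofreal_gt0P[r r0 ->] h]]]|[a [r [M [r0 aM h]]]]].
  exists a; apply: (expansion_of_psum r0) => u ur.
  by have := h (c + u); rewrite (addrC c) addrK norm_modulus ofreal_lt => /(_ ur).
exists (ofreal r), a; split; first by rewrite ofreal_gt0.
move=> w; rewrite norm_modulus ofreal_lt => wr.
by have := h _ wr; rewrite (addrC c (w - c)) subrK.
Qed.

Lemma modulus_small_near (r : R) : 0 < r ->
  \forall u \near (0 : C), modulus u < r.
Proof.
move=> r0; have : (0 : C) < ofreal r by rewrite ofreal_gt0.
move=> /(@nbhs0_lt C C); apply: filterS => u.
by rewrite norm_modulus ofreal_lt.
Qed.

Lemma expansion_eq_near f g c a r : 0 < r ->
  (forall u, modulus u < r -> f (c + u) = g (c + u)) -> expansion f c a -> expansion g c a.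
Proof.
move=> r0 fg [s [M [s0 aM h]]]; apply: (@expansion_of_psum _ _ _ (Num.min r s)).
  by rewrite lt_min r0 s0.
by move=> u; rewrite lt_min => /andP[ur us]; rewrite -fg //; exact: h.
Qed.

Lemma psum0 a : psum a 0 (a 0%N).
Proof.
rewrite /psum -cvg_shiftS (_ : [sequence _]_n = fun => a 0%N); first exact: cvg_cst.
apply/funext => n; rewrite /series /= big_nat_recl //= expr0 mulr1.
by rewrite big1 ?addr0 // => i _; rewrite expr0n mulr0.
Qed.

Lemma expansion0 f c a : expansion f c a -> f c = a 0%N.
Proof.
move=> [r [M [r0 aM /(_ 0)]]]; rewrite modulus0 addr0 => /(_ r0) h.
exact: psum_unique h (@psum0 a).
Qed.

Lemma expansion_derive1 f c a : expansion f c a -> derive1 f c = a 1%N.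
Proof.
move=> fa; have fc := expansion0 fa; case: fa => r [M [r0 aM h]].
rewrite /derive1; apply: cvg_lim; first exact: norm_hausdorff.
have M0 := coef_bound_ge0 aM.
apply/cvg_modulusP.
apply: (@squeeze_cvgr _ _ _ _ (fun=> 0) (fun u : C => (M / r ^+ 2 * 2) * modulus u)); last 2 first.
- exact: cvg_cst.
- rewrite -[X in _ --> X](mulr0 (M / r ^+ 2 * 2)).
  apply: cvgM; first exact: cvg_cst.
  have : (fun u : C => modulus (u - 0)) @ (0 : C)^' --> (0 : R).
    by apply/cvg_modulusP; exact: nbhs_dnbhs.
  by under eq_fun do rewrite subr0.
near=> u; rewrite modulus_ge0 /=.
have u0 : u != 0 by near: u; exact: nbhs_dnbhs_neq.
have ur2 : modulus u < r / 2.
  near: u; apply: nbhs_dnbhs; apply: modulus_small_near; exact: divr_gt0.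
have ur : modulus u < r by apply: lt_trans ur2 _; rewrite ltr_pdivrMr // ltr_pMr // ltr1n.
have u1 : 0 < modulus u by rewrite modulus_gt0.
have := psum_tail 2 aM ur (h u ur).
rewrite /series /= !big_nat_recl // big_geq // addr0 expr0 expr1 mulr1 opprD addrA.
have -> : u^-1 *: (f (u + c) - f c) - a 1%N = u^-1 * (f (c + u) - a 0%N - a 1%N * u).
  by rewrite fc (addrC u) -[_ *: _]/(_ * _) [RHS]mulrBr (mulrC u^-1 (a 1%N * u)) mulfK.
move=> H; rewrite modulusM modulusV.
rewrite ler_pdivrMl //; apply: le_trans H _.
rewrite ler_pdivrMr; last by rewrite subr_gt0 ltr_pdivrMr // mul1r.
have q2 : modulus u / r <= 1 / 2 by rewrite ler_pdivrMr // mulrC mulrA mulr1 ltW.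
rewrite exprMn exprVn.
have -> : modulus u * (M / r ^+ 2 * 2 * modulus u) * (1 - modulus u / r) =
   M * (modulus u ^+ 2 / r ^+ 2) * (2 * (1 - modulus u / r)) by ring.
rewrite ler_peMr //; last by lra.
by rewrite mulr_ge0 // divr_ge0 // sqr_ge0.
Unshelve. all: by end_near.
Qed.

(** The sum of a power series is analytic throughout its disc of convergence. *)
Lemma expansion_recenter f c a r M u : coef_bound a r M ->
  (forall u, modulus u < r -> psum a u (f (c + u))) -> modulus u < r ->
  expansion f (c + u) (recenter a u).
Proof.
move=> aM h ur; apply: (@expansion_of_psum _ _ _ (r - modulus u)); first by rewrite subr_gt0.
move=> v; rewrite ltrBrDl => uv; apply: (recenter_sum aM uv).
by rewrite -addrA; apply: h; apply: le_lt_trans uv; exact: ler_modulusD.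
Qed.

Definition deriv_seq a n : C := n.+1%:R * a n.+1.

Lemma psum_deriv_seq a r M u : coef_bound a r M -> modulus u < r ->
  psum (deriv_seq a) u (recenter a u 1).
Proof.
move=> aM ur; have := recenter_cvg (k:=1%N) aM ur.
rewrite -cvg_shiftS /psum; apply: cvg_trans; apply: near_eq_cvg; apply: nearW => n.
rewrite /series /= big_nat_recl //= bin0n mulr0 mul0r add0r.
by apply: eq_bigr => i _; rewrite bin1 subn1 /= /deriv_seq (mulrC (a _)).
Qed.

Lemma expansion_deriv_seq f c a : expansion f c a -> expansion (derive1 f) c (deriv_seq a).
Proof.
move=> [r [M [r0 aM h]]]; apply: (expansion_of_psum r0) => u ur.
rewrite (expansion_derive1 (expansion_recenter aM h ur)); exact: (psum_deriv_seq aM ur).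
Qed.

Lemma expansion_derive1n f c a n : expansion f c a -> derive1n n f c = n`!%:R * a n.
Proof.
move=> fa.
suff H : expansion (derive1n n f) c (fun k => ((k + n) ^_ n)%:R * a (k + n)%N).
  by rewrite (expansion0 H) add0n ffactnn.
elim: n => [|n IH].
  rewrite derive1n0 (_ : (fun _ => _) = a) //.
  by apply/funext => k; rewrite addn0 ffactn0 mul1r.
rewrite derive1nS; have := expansion_deriv_seq IH; congr expansion; apply/funext => k.
by rewrite /deriv_seq addSnnS mulrA -natrM ffactnSr -addSnnS addnK mulnC.
Qed.

Lemma expansion_coef f c a n : expansion f c a -> a n = (n`!%:R)^-1 * derive1n n f c.
Proof.
by move=> /(expansion_derive1n n) ->; rewrite mulrA mulVf ?mul1r // pnatr_eq0 -lt0n fact_gt0.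
Qed.

Lemma expansion_unique f c a b : expansion f c a -> expansion f c b -> a = b.
Proof.
by move=> fa fb; apply/funext => n; rewrite (expansion_coef n fa) (expansion_coef n fb).
Qed.

Lemma expansion_vanishes f c a k : expansion f c a ->
  vanishes_to_order f c k <-> forall j, (j < k)%N -> a j = 0.
Proof.
move=> fa; split=> h j jk; first by rewrite (expansion_coef j fa) h // mulr0.
by rewrite (expansion_derive1n j fa) h // mulr0.
Qed.

Lemma psumD a b u A B : psum a u A -> psum b u B -> psum (fun n => a n + b n) u (A + B).
Proof.
move=> aA bB; rewrite /psum.
rewrite (_ : series _ = series (fun k => a k * u ^+ k) \+ series (fun k => b k * u ^+ k)).
  by apply: cvgD; [exact: aA | exact: bB].
apply/funext => n; rewrite /series /= -big_split /=.
by apply: eq_bigr => i _; rewrite mulrDl.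
Qed.

Lemma expansionD f g c a b : expansion f c a -> expansion g c b ->
  expansion (fun w => f w + g w) c (fun n => a n + b n).
Proof.
move=> [r [M [r0 aM h]]] [s [M' [s0 bM h']]].
apply: (@expansion_of_psum _ _ _ (Num.min r s)); first by rewrite lt_min r0 s0.
by move=> u; rewrite lt_min => /andP[ur us]; exact: psumD (h u ur) (h' u us).
Qed.

Lemma psumZ (k : C) a u S : psum a u S -> psum (fun n => k * a n) u (k * S).
Proof.
move=> h; rewrite /psum (_ : series _ = (fun n => k * series (fun k => a k * u ^+ k) n)).
  by apply: cvgM; [exact: cvg_cst | exact: h].
apply/funext => n; rewrite /series /= mulr_sumr.
by apply: eq_bigr => i _; rewrite mulrA.
Qed.

Lemma expansionM f g c a b : expansion f c a -> expansion g c b ->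
  expansion (fun w => f w * g w) c (conv a b).
Proof.
move=> [r [M [r0 aM h]]] [s [M' [s0 bM h']]].
have m0 : 0 < Num.min r s by rewrite lt_min r0 s0.
have [mr ms] : Num.min r s <= r /\ Num.min r s <= s.
  by split; rewrite ge_min lexx ?orbT.
apply: (expansion_of_psum m0) => u um.
have aM' : coef_bound a (Num.min r s) M by apply: coef_bound_le aM; rewrite mr ltW.
have bM' : coef_bound b (Num.min r s) M' by apply: coef_bound_le bM; rewrite ms ltW.
apply: (psum_conv aM' bM' um); first by apply: h; exact: lt_le_trans mr.
by apply: h'; exact: lt_le_trans ms.
Qed.

Lemma psum_cst (k u : C) : psum (fun n => if n is 0%N then k else 0) u k.
Proof.
rewrite /psum -cvg_shiftS (_ : [sequence _]_n = fun => k); first exact: cvg_cst.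
apply/funext => n; rewrite /series /= big_nat_recl //= expr0 mulr1.
by rewrite big1 ?addr0 // => i _; rewrite mul0r.
Qed.

Lemma expansion_cst (k c : C) : expansion (fun=> k) c (fun n => if n is 0%N then k else 0).
Proof. by apply: (expansion_of_psum ltr01) => u _; exact: psum_cst. Qed.

Lemma psum_shift a u S : psum a u S ->
  psum (fun n => if n is n'.+1 then a n' else 0) u (u * S).
Proof.
move=> h; rewrite /psum -cvg_shiftS.
rewrite (_ : [sequence _]_n = (fun n => u * series (fun k => a k * u ^+ k) n)).
  by apply: cvgM; [exact: cvg_cst | exact: h].
apply/funext => n; rewrite /series /= big_nat_recl //= mul0r add0r mulr_sumr.
by apply: eq_bigr => i _; rewrite exprS mulrCA.
Qed.


Definition shift_seq e a n : C := if (n < e)%N then 0 else a (n - e)%N.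

Lemma expansion_XsubC f c a e : expansion f c a ->
  expansion (fun w => (w - c) ^+ e * f w) c (shift_seq e a).
Proof.
move=> [r [M [r0 aM h]]]; apply: (expansion_of_psum r0) => u ur.
rewrite (addrC c) addrK addrC; elim: e => [|e IH].
  rewrite expr0 mul1r (_ : shift_seq 0 a = a); first exact: h.
  by apply/funext => n; rewrite /shift_seq ltn0 subn0.
rewrite exprS -mulrA; have := psum_shift IH; congr psum.
by apply/funext => -[|n].
Qed.

Lemma eq_analytic f g c : f =1 g -> analytic_at f c -> analytic_at g c.
Proof. by move=> /funext ->. Qed.

Lemma eq_expansion f g c a : f =1 g -> expansion f c a -> expansion g c a.
Proof. by move=> /funext ->. Qed.

Lemma analyticD f g c : analytic_at f c -> analytic_at g c ->
  analytic_at (fun w => f w + g w) c.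
Proof.
move=> /analytic_expansion[a fa] /analytic_expansion[b gb]; apply/analytic_expansion.
by eexists; exact: expansionD fa gb.
Qed.

Lemma analyticM f g c : analytic_at f c -> analytic_at g c ->
  analytic_at (fun w => f w * g w) c.
Proof.
move=> /analytic_expansion[a fa] /analytic_expansion[b gb]; apply/analytic_expansion.
by eexists; exact: expansionM fa gb.
Qed.

Lemma analytic_cst k c : analytic_at (fun=> k) c.
Proof. by apply/analytic_expansion; eexists; exact: expansion_cst. Qed.

Lemma analytic_id c : analytic_at id c.
Proof.
have h : analytic_at (fun w : C => (w - c) ^+ 1 * 1 + c) c.
  apply: analyticD; last exact: analytic_cst.
  by apply/analytic_expansion; eexists; apply: expansion_XsubC; exact: expansion_cst.
apply: eq_analytic h => w; by rewrite mulr1 expr1 subrK.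
Qed.

Lemma analyticX f n c : analytic_at f c -> analytic_at (fun w => f w ^+ n) c.
Proof.
move=> fa; elim: n => [|n IH]; first exact: analytic_cst.
apply: eq_analytic (analyticM fa IH) => w; by rewrite exprS.
Qed.

Lemma analytic_prod (I : Type) (s : seq I) (P : pred I) (F : I -> C -> C) c :
  (forall i, P i -> analytic_at (F i) c) ->
  analytic_at (fun w => \prod_(i <- s | P i) F i w) c.
Proof.
move=> FA; elim: s => [|i s IH].
  by apply: eq_analytic (analytic_cst 1 c) => w; rewrite big_nil.
case Pi : (P i); last first.
  by apply: eq_analytic IH => w; rewrite big_cons Pi.
by apply: eq_analytic (analyticM (FA i Pi) IH) => w; rewrite big_cons Pi.
Qed.

(** Orders of vanishing add up under products, and leading coefficients multiply. *)
Lemma conv_low a b k l : (forall j, (j < k)%N -> a j = 0) ->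
  (forall j, (j < l)%N -> b j = 0) ->
  (forall j, (j < k + l)%N -> conv a b j = 0) /\ conv a b (k + l) = a k * b l.
Proof.
move=> ha hb; split=> [j jkl|].
  rewrite /conv big_nat_cond big1 // => i /andP[/andP[_ ij] _].
  have [ik|ki] := ltnP i k; first by rewrite ha // mul0r.
  by rewrite hb ?mulr0 // ltn_subLR // (leq_trans jkl) // leq_add2r.
rewrite /conv (big_cat_nat _ (_ : k <= (k + l).+1)%N) //=; last by rewrite leqW ?leq_addr.
rewrite big_nat_cond big1 ?add0r; last by move=> i /andP[/andP[_ ik] _]; rewrite ha // mul0r.
rewrite big_nat_recl ?ltnS ?leq_addr // addKn big_nat_cond big1 ?addr0 //.
move=> i /andP[/andP[ki il] _]; rewrite hb ?mulr0 //.
by rewrite ltn_subLR; lia.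
Qed.

Lemma expansionX_low f c a k n : expansion f c a -> (forall j, (j < k)%N -> a j = 0) ->
  exists b, [/\ expansion (fun w => f w ^+ n) c b,
    forall j, (j < n * k)%N -> b j = 0 & b (n * k)%N = a k ^+ n].
Proof.
move=> fa ha; elim: n => [|n [b [fb hb bk]]].
  by exists (fun n => if n is 0%N then 1 else 0); split; [exact: expansion_cst | | ].
have [h1 h2] := conv_low ha hb; exists (conv a b); split.
- by apply: eq_expansion (expansionM fa fb) => w; rewrite exprS.
- by move=> j; rewrite mulSn => /h1.
- by rewrite mulSn h2 bk exprS.
Qed.

End LocalExpansion.

(** * Integration over plane discs along chords *)

Section PlaneDisc.
Variable R : realType.
Local Notation C := (cplx R).
Local Notation T := (measurableTypeR R).
Local Notation mu := (@lebesgue_measure R).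
Local Notation area := (mu \x mu)%E.

Definition chord (c : R) : set T := [set x : T | (x : R) ^+ 2 < c].

Definition disc (rho : R) : set (T * T) := [set v | v.1 ^+ 2 + v.2 ^+ 2 < rho ^+ 2].

Lemma measurable_coord1 : measurable_fun [set: T * T] (fun v : T * T => v.1 : R).
Proof. exact: measurable_fst. Qed.
Lemma measurable_coord2 : measurable_fun [set: T * T] (fun v : T * T => v.2 : R).
Proof. exact: measurable_snd. Qed.

Lemma measurable_disc rho : measurable (disc rho).
Proof.
have h : measurable_fun [set: T * T] (fun v : T * T => v.1 ^+ 2 + v.2 ^+ 2 : R).
  apply: measurable_funD; apply: measurable_funX.
    exact: measurable_coord1.
  exact: measurable_coord2.
have := h measurableT `]-oo, (rho ^+ 2)[%classic (measurable_itv _).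
rewrite setTI; congr measurable; apply/seteqP; split => v /=; by rewrite /disc /= in_itv.
Qed.

Lemma disc_coord_lt rho (v : T * T) : 0 <= rho -> disc rho v ->
  `|v.1 : R| < rho /\ `|v.2 : R| < rho.
Proof.
move=> r0 dv; have a := sqr_ge0 (v.1 : R); have b := sqr_ge0 (v.2 : R).
split; rewrite -(@ltr_pXn2r _ 2) ?nnegrE ?normr_ge0 // real_normK ?num_real //.
  by apply: le_lt_trans dv; rewrite lerDl.
by apply: le_lt_trans dv; rewrite lerDr.
Qed.

Lemma area_disc_fin rho : 0 <= rho -> (area (disc rho) < +oo)%E.
Proof.
move=> r0; pose I : set T := `]-rho, rho[%classic.
have mI : measurable I by exact: measurable_itv.
have : (area (I `*` I) < +oo)%E.
  rewrite product_measure1E //= /I lebesgue_measure_itv /=.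
  by case: ifP => _; rewrite ?mule0 ?ltry // -EFinB -EFinM ltry.
apply: le_lt_trans; apply: le_measure; rewrite ?inE.
- exact: measurable_disc.
- exact: measurableX.
- move=> v /(disc_coord_lt r0); rewrite !ltr_norml => -[h1 h2].
  by split; rewrite /I /= in_itv /=.
Qed.

Lemma area_disc_gt0 rho : 0 < rho -> (0 < area (disc rho))%E.
Proof.
move=> r0; pose s := rho / 2; have s0 : 0 < s by exact: divr_gt0.
pose I : set T := `]-s, s[%classic.
have mI : measurable I by exact: measurable_itv.
have : (0 < area (I `*` I))%E.
  rewrite product_measure1E //= /I lebesgue_measure_itv /= lte_fin.
  by rewrite gtrN // -EFinB -EFinM lte_fin opprK mulr_gt0 // addr_gt0.
move=> h; apply: lt_le_trans h _; apply: le_measure; rewrite ?inE.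
- exact: measurableX.
- exact: measurable_disc.
- move=> v [] /=; rewrite /I /= !in_itv /= -!ltr_norml => h1 h2; rewrite /disc /=.
  have q (x : R) : `|x| < s -> x ^+ 2 < s ^+ 2.
    by move=> xs; rewrite -real_normK ?num_real // ltrXn2r.
  have := q _ h1; have := q _ h2; rewrite /s expr_div_n.
  have := sqr_ge0 rho; set X := rho ^+ 2; lra.
Qed.

Lemma integrable_disc rho (f : T * T -> R) M : 0 <= rho ->
  measurable_fun (disc rho) f -> (forall v, disc rho v -> `|f v| <= M) ->
  area.-integrable (disc rho) (EFin \o f).
Proof.
move=> r0 mf fM; apply: measurable_bounded_integrable => //.
- exact: measurable_disc.
- exact: area_disc_fin.
- exists M; split; first exact: num_real.
  by move=> x Mx v dv; apply: le_trans (fM v dv) (ltW Mx).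
Qed.

Lemma int_disc_lines1 rho (f : T * T -> R) M : 0 <= rho ->
  measurable_fun (disc rho) f -> (forall v, disc rho v -> `|f v| <= M) ->
  (forall y : R, (\int[mu]_(x in chord (rho ^+ 2 - y ^+ 2)%R) (f (x, y))%:E = 0)%E) ->
  \int[area]_(v in disc rho) f v = 0.
Proof.
move=> r0 mf fM f0; rewrite /Rintegral integral_mkcond.
have fi : area.-integrable setT ((EFin \o f) \_ (disc rho)).
  by apply: (iffLR (integrable_mkcond _ (measurable_disc rho)));
    exact: integrable_disc r0 mf fM.
rewrite -(integral21_prod_meas1 fi) integral0_eq //= => y _.
rewrite /fubini_G -[RHS](f0 y) [RHS]integral_mkcond.
apply: eq_integral => x _; rewrite /patch /=.
have -> : ((x, y) \in disc rho) = (x \in chord (rho ^+ 2 - y ^+ 2)).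
  by apply/idP/idP; rewrite !inE /disc /chord /= ltrBrDr.
by [].
Qed.

Lemma int_disc_lines2 rho (f : T * T -> R) M : 0 <= rho ->
  measurable_fun (disc rho) f -> (forall v, disc rho v -> `|f v| <= M) ->
  (forall x : R, (\int[mu]_(y in chord (rho ^+ 2 - x ^+ 2)%R) (f (x, y))%:E = 0)%E) ->
  \int[area]_(v in disc rho) f v = 0.
Proof.
move=> r0 mf fM f0; rewrite /Rintegral integral_mkcond.
have fi : area.-integrable setT ((EFin \o f) \_ (disc rho)).
  by apply: (iffLR (integrable_mkcond _ (measurable_disc rho)));
    exact: integrable_disc r0 mf fM.
rewrite -(integral12_prod_meas1 fi) integral0_eq //= => x _.
rewrite /fubini_F -[RHS](f0 x) [RHS]integral_mkcond.
apply: eq_integral => y _; rewrite /patch /=.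
have -> : ((x, y) \in disc rho) = (y \in chord (rho ^+ 2 - x ^+ 2)%R).
  by apply/idP/idP; rewrite !inE /disc /chord /= ltrBrDr addrC.
by [].
Qed.

Lemma int_deriv_poly (Q : {poly R}) c :
  (forall x, x ^+ 2 = c -> Q.[x] = 0) ->
  (\int[mu]_(x in chord c) ((Q^`()).[x])%:E = 0)%E.
Proof.
move=> Q0; have [c0|c0] := leP c 0.
  rewrite (_ : chord c = set0) ?integral_set0 //.
  apply/seteqP; split => // x /= h.
  by have := le_lt_trans (sqr_ge0 _) (lt_le_trans h c0); rewrite ltxx.
have s0 : 0 < Num.sqrt c by rewrite sqrtr_gt0.
have sK : Num.sqrt c ^+ 2 = c by rewrite sqr_sqrtr // ltW.
set s := Num.sqrt c in s0 sK.
have ss : - s < s by rewrite gtrN.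
rewrite (_ : chord c = `]-s, s[%classic); last first.
  apply/seteqP; split => x; rewrite /= in_itv /= -ltr_norml -sK;
    by rewrite -[_ < s](@ltr_pXn2r _ 2) ?nnegrE ?(ltW s0) // real_normK ?num_real.
have mP : measurable_fun (`]-s, s[%classic : set T) (fun x : R => ((Q^`()).[x])%:E).
  apply/measurable_EFinP/measurable_funTS.
  by apply: continuous_measurable_fun; exact: continuous_horner.
rewrite -(integral_itv_bndoo true false mP).
rewrite (@continuous_FTC2 R (horner Q^`()) (horner Q)) //.
- by rewrite !Q0 ?sqrrN // subee.
- by apply: continuous_subspaceT => x; exact: continuous_horner.
- split.
  + by move=> x _; exact: derivable_horner.
  + exact/cvg_at_right_filter/continuous_horner.
  + exact/cvg_at_left_filter/continuous_horner.
- by move=> x _; rewrite derivE.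
Qed.

Lemma repoly_horner (g : C -> R) : g 0 = 0 -> {morph g : x y / x + y} ->
  (forall w (x : R), g (w * ofreal x) = g w * x) ->
  forall (p : {poly C}) (x : R), (map_poly g p).[x] = g p.[ofreal x].
Proof.
move=> g0 gD gZ p x; rewrite (horner_coef_wide x (size_poly _ _)) horner_coef.
rewrite (big_morph g gD g0); apply: eq_bigr => i _.
by rewrite coef_map_id0 // -gZ rmorphXn.
Qed.

(** [g] stands for the real or the imaginary part: the integral over a chord of the
    derivative of a polynomial vanishing at both ends is 0. *)
Lemma int_deriv_cpoly (g : C -> R) (Q : {poly C}) c :
  g 0 = 0 -> {morph g : x y / x + y} ->
  (forall w (x : R), g (w * ofreal x) = g w * x) ->
  (forall x : R, x ^+ 2 = c -> Q.[ofreal x] = 0) ->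
  (\int[mu]_(x in chord c) (g (Q^`()).[ofreal x])%:E = 0)%E.
Proof.
move=> g0 gD gZ Q0; rewrite -(int_deriv_poly (Q := map_poly g Q) (c := c)).
  apply: eq_integral => x _; rewrite -repoly_horner //; congr (_.[_])%:E.
  apply/polyP => i; rewrite coef_deriv !coef_map_id0 // coef_deriv.
  by move: Q`_i.+1 => z; elim: i.+1 => [|n IH]; rewrite ?mulr0n // !mulrS gD IH.
by move=> x xc; rewrite repoly_horner // Q0.
Qed.

End PlaneDisc.

(** * Orthogonality of monomials on a disc *)

Section Moments.
Variable R : realType.
Local Notation C := (cplx R).
Local Notation T := (measurableTypeR R).
Local Notation mu := (@lebesgue_measure R).
Local Notation area := (mu \x mu)%E.
Variable rho : R.
Hypothesis rho0 : 0 < rho.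
Local Notation D := (disc rho).
Implicit Types (u v : T * T -> C).

Definition bounded_mfun u := [/\ measurable_fun D (fun p => re (u p)),
  measurable_fun D (fun p => im (u p)) & exists M, forall p, D p -> modulus (u p) <= M].

Definition cint u : C :=
  Complex (\int[area]_(p in D) re (u p)) (\int[area]_(p in D) im (u p)).

Lemma bounded_mfun_re u : bounded_mfun u -> area.-integrable D (EFin \o (fun p => re (u p))).
Proof.
move=> [mr _ [M uM]]; apply: (integrable_disc (M := M) (ltW rho0) mr) => p Dp.
exact: le_trans (re_le_modulus _) (uM p Dp).
Qed.
Lemma bounded_mfun_im u : bounded_mfun u -> area.-integrable D (EFin \o (fun p => im (u p))).
Proof.
move=> [_ mi [M uM]]; apply: (integrable_disc (M := M) (ltW rho0) mi) => p Dp.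
exact: le_trans (im_le_modulus _) (uM p Dp).
Qed.

Lemma bounded_mfun_cst k : bounded_mfun (fun=> k).
Proof. by split; [exact: measurable_cst.. | exists (modulus k)]. Qed.

Lemma bounded_mfunD u v : bounded_mfun u -> bounded_mfun v -> bounded_mfun (fun p => u p + v p).
Proof.
move=> [ur ui [M uM]] [vr vi [N vN]]; split.
- by under eq_fun do rewrite reD; exact: measurable_funD.
- by under eq_fun do rewrite imD; exact: measurable_funD.
- exists (M + N) => p Dp; apply: le_trans (ler_modulusD _ _) _.
  by rewrite lerD ?uM ?vN.
Qed.

Lemma bounded_mfunM u v : bounded_mfun u -> bounded_mfun v -> bounded_mfun (fun p => u p * v p).
Proof.
move=> [ur ui [M uM]] [vr vi [N vN]]; split.
- by under eq_fun do rewrite reM; apply: measurable_funB; exact: measurable_funM.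
- by under eq_fun do rewrite imM; apply: measurable_funD; exact: measurable_funM.
- exists (M * N) => p Dp; rewrite modulusM.
  by rewrite ler_pM ?modulus_ge0 ?uM ?vN.
Qed.

Lemma bounded_mfunX u n : bounded_mfun u -> bounded_mfun (fun p => u p ^+ n).
Proof.
move=> tu; elim: n => [|n IH]; first exact: bounded_mfun_cst.
by under eq_fun do rewrite exprS; exact: bounded_mfunM.
Qed.

Lemma bounded_mfun_sum (I : Type) (s : seq I) (F : I -> T * T -> C) :
  (forall i, bounded_mfun (F i)) -> bounded_mfun (fun p => \sum_(i <- s) F i p).
Proof.
move=> tF; elim: s => [|i s IH].
  by under eq_fun do rewrite big_nil; exact: bounded_mfun_cst.
by under eq_fun do rewrite big_cons; exact: bounded_mfunD.
Qed.

Lemma cintD u v : bounded_mfun u -> bounded_mfun v -> cint (fun p => u p + v p) = cint u + cint v.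
Proof.
move=> tu tv; apply: reim_eq; rewrite ?reD ?imD /cint /re /im /=.
  rewrite -RintegralD; [|exact: measurable_disc|exact: bounded_mfun_re..].
  by apply: eq_Rintegral => p _; exact: reD.
rewrite -RintegralD; [|exact: measurable_disc|exact: bounded_mfun_im..].
by apply: eq_Rintegral => p _; exact: imD.
Qed.

Lemma RintegralZ_re (k : R) u : bounded_mfun u ->
  k * (\int[area]_(p in D) re (u p)) = \int[area]_(p in D) (k * re (u p)).
Proof. by move=> tu; rewrite RintegralZl //; [exact: measurable_disc|exact: bounded_mfun_re]. Qed.
Lemma RintegralZ_im (k : R) u : bounded_mfun u ->
  k * (\int[area]_(p in D) im (u p)) = \int[area]_(p in D) (k * im (u p)).
Proof. by move=> tu; rewrite RintegralZl //; [exact: measurable_disc|exact: bounded_mfun_im]. Qed.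

Lemma cintZ (k : C) u : bounded_mfun u -> cint (fun p => k * u p) = k * cint u.
Proof.
move=> tu; case: k => a b.
have iZ (k : R) (f : T * T -> R) : area.-integrable D (EFin \o f) ->
    area.-integrable D (EFin \o (fun p => k * f p)).
  by move=> fi; exact: (integrableZl (measurable_disc rho) k fi).
apply: reim_eq.
  rewrite reM /cint /re /im /= RintegralZ_re // RintegralZ_im //.
  rewrite -RintegralB; [|exact: measurable_disc| | ].
  - by apply: eq_Rintegral => p _; exact: reM.
  - exact/iZ/bounded_mfun_re.
  - exact/iZ/bounded_mfun_im.
rewrite imM /cint /re /im /= RintegralZ_re // RintegralZ_im //.
rewrite -RintegralD; [|exact: measurable_disc| | ].
- by apply: eq_Rintegral => p _; exact: imM.
- exact/iZ/bounded_mfun_im.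
- exact/iZ/bounded_mfun_re.
Qed.

Lemma cint_sum (I : Type) (s : seq I) (F : I -> T * T -> C) :
  (forall i, bounded_mfun (F i)) -> cint (fun p => \sum_(i <- s) F i p) =
    \sum_(i <- s) cint (F i).
Proof.
move=> tF; elim: s => [|i s IH].
  under eq_fun do rewrite big_nil.
  rewrite big_nil; transitivity (cint (fun p => 0 * 1)).
    by congr cint; apply/funext => p; rewrite mul0r.
  by rewrite cintZ ?mul0r //; exact: bounded_mfun_cst.
under eq_fun do rewrite big_cons.
by rewrite cintD ?IH ?big_cons //; exact: bounded_mfun_sum.
Qed.

Lemma cint_lines1 u (W : R -> {poly C}) : bounded_mfun u ->
  (forall x y : R, u (x, y) = ((W y)^`()).[ofreal x]) ->
  (forall x y : R, x ^+ 2 + y ^+ 2 = rho ^+ 2 -> (W y).[ofreal x] = 0) ->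
  cint u = 0.
Proof.
move=> tu uW W0; have [mr mi [M uM]] := tu.
have W0' y x : x ^+ 2 = rho ^+ 2 - y ^+ 2 -> (W y).[ofreal x] = 0.
  by move=> xy; apply: W0; rewrite xy subrK.
apply: reim_eq; rewrite /cint /re /im /=.
  apply: (int_disc_lines1 (M := M) (ltW rho0) mr) => [p Dp|y].
    exact: le_trans (re_le_modulus _) (uM p Dp).
  under eq_integral do rewrite uW.
  apply: (int_deriv_cpoly (g := @re R)); [by []|exact: reD| |exact: W0'].
  by move=> w x; rewrite reM re_ofreal im_ofreal mulr0 subr0.
apply: (int_disc_lines1 (M := M) (ltW rho0) mi) => [p Dp|y].
  exact: le_trans (im_le_modulus _) (uM p Dp).
under eq_integral do rewrite uW.
apply: (int_deriv_cpoly (g := @im R)); [by []|exact: imD| |exact: W0'].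
by move=> w x; rewrite imM re_ofreal im_ofreal mulr0 add0r.
Qed.

Lemma cint_lines2 u (W : R -> {poly C}) : bounded_mfun u ->
  (forall x y : R, u (x, y) = ((W x)^`()).[ofreal y]) ->
  (forall x y : R, x ^+ 2 + y ^+ 2 = rho ^+ 2 -> (W x).[ofreal y] = 0) ->
  cint u = 0.
Proof.
move=> tu uW W0; have [mr mi [M uM]] := tu.
have W0' x y : y ^+ 2 = rho ^+ 2 - x ^+ 2 -> (W x).[ofreal y] = 0.
  by move=> xy; apply: W0; rewrite xy addrC subrK.
apply: reim_eq; rewrite /cint /re /im /=.
  apply: (int_disc_lines2 (M := M) (ltW rho0) mr) => [p Dp|x].
    exact: le_trans (re_le_modulus _) (uM p Dp).
  under eq_integral do rewrite uW.
  apply: (int_deriv_cpoly (g := @re R)); [by []|exact: reD| |exact: W0'].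
  by move=> w y; rewrite reM re_ofreal im_ofreal mulr0 subr0.
apply: (int_disc_lines2 (M := M) (ltW rho0) mi) => [p Dp|x].
  exact: le_trans (im_le_modulus _) (uM p Dp).
under eq_integral do rewrite uW.
apply: (int_deriv_cpoly (g := @im R)); [by []|exact: imD| |exact: W0'].
by move=> w y; rewrite imM re_ofreal im_ofreal mulr0 add0r.
Qed.

Definition affix (p : T * T) : C := complex_of_pair p.
Definition affix_conj (p : T * T) : C := (complex_of_pair p : C)^*.

Lemma affixE (x y : R) : affix (x, y) = ofreal x + 'i * ofreal y.
Proof. by rewrite [LHS]ofreal_re_im. Qed.
Lemma affix_conjE (x y : R) : affix_conj (x, y) = ofreal x - 'i * ofreal y.
Proof.
rewrite /affix_conj -/(affix (x, y)) affixE; apply: reim_eq; rewrite ?(re_conj, im_conj).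
  by rewrite !(reD, reN, reM, re_ofreal, im_ofreal) -[('i : C)]complexiE /re /im /=
    !(mul0r, mulr0, subr0, addr0, oppr0).
by rewrite !(imD, imN, imM, re_ofreal, im_ofreal) -[('i : C)]complexiE /re /im /=
  !(mul0r, mulr0, subr0, add0r, addr0, oppr0).
Qed.

Lemma bounded_mfun_affix : bounded_mfun affix.
Proof.
split.
- exact: measurable_funTS (@measurable_coord1 R).
- exact: measurable_funTS (@measurable_coord2 R).
- exists (rho + rho) => p /(disc_coord_lt (ltW rho0))[/ltW h1 /ltW h2].
  by apply: le_trans (modulus_le_reim _) _; rewrite lerD.
Qed.

Lemma bounded_mfun_affix_conj : bounded_mfun affix_conj.
Proof.
have [h1 h2 [M h3]] := bounded_mfun_affix; split.
- by rewrite /affix_conj; under eq_fun do rewrite re_conj.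
- by rewrite /affix_conj; under eq_fun do rewrite im_conj; exact: measurable_funN.
- by exists M => p Dp; rewrite /affix_conj modulus_conj; exact: h3.
Qed.

(** The claim is that [moment m n] is 0 for [m <> n].  Instead of polar coordinates,
    two recursions come from integrating along horizontal and vertical chords the
    derivatives of [(rho^2 - |w|^2) w^m conj(w)^n], which vanishes on the circle. *)
Definition moment m n := cint (fun p => affix p ^+ m * affix_conj p ^+ n).

Lemma bounded_mfun_mono m n : bounded_mfun (fun p => affix p ^+ m * affix_conj p ^+ n).
Proof. by apply: bounded_mfunM; apply: bounded_mfunX;
  [exact: bounded_mfun_affix|exact: bounded_mfun_affix_conj]. Qed.

Lemma cint_lincomb (a1 a2 a3 a4 : C) (m1 m2 m3 m4 n1 n2 n3 n4 : nat) :
  let mono m n p := affix p ^+ m * affix_conj p ^+ n in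
  let u p := a1 * mono m1 n1 p + a2 * mono m2 n2 p + a3 * mono m3 n3 p + a4 * mono m4 n4 p in
  bounded_mfun u /\
  cint u = a1 * moment m1 n1 + a2 * moment m2 n2 + a3 * moment m3 n3 + a4 * moment m4 n4.
Proof.
move=> mono u.
have t a m n : bounded_mfun (fun p => a * mono m n p).
  by apply: bounded_mfunM; [exact: bounded_mfun_cst|exact: bounded_mfun_mono].
split; first by do 3 (apply: bounded_mfunD; last exact: t); exact: t.
rewrite /u cintD; [|by do 2 (apply: bounded_mfunD; last exact: t); exact: t|exact: t].
rewrite cintD; [|by apply: bounded_mfunD; exact: t|exact: t].
by rewrite cintD; [|exact: t|exact: t]; rewrite !cintZ //; exact: bounded_mfun_mono.
Qed.

Lemma normsq_circle (x y : R) : x ^+ 2 + y ^+ 2 = rho ^+ 2 ->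
  (ofreal x + 'i * ofreal y) * (ofreal x - 'i * ofreal y) = ofreal rho ^+ 2.
Proof.
move=> xy; rewrite mulrC -subr_sqr exprMn sqrCi mulN1r opprK -!rmorphXn -rmorphD xy.
by rewrite rmorphXn.
Qed.

(** On a chord with parameter [t], the functions [w] and [conj w] are polynomials [A]
    and [B] of degree 1. *)
Lemma deriv_boundary_poly (k t a b da db : C) (A B : {poly C}) m n :
  A.[t] = a -> B.[t] = b -> A^`() = da%:P -> B^`() = db%:P ->
  ((k%:P * (A ^+ m * B ^+ n) - A ^+ m.+1 * B ^+ n.+1)^`()).[t] =
  k * (m%:R * da * (a ^+ m.-1 * b ^+ n) + n%:R * db * (a ^+ m * b ^+ n.-1)) -
  (m.+1%:R * da * (a ^+ m * b ^+ n.+1) + n.+1%:R * db * (a ^+ m.+1 * b ^+ n)).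
Proof.
move=> Aa Bb A' B'.
rewrite derivB !derivM derivC mul0r add0r !deriv_exp A' B' /=.
rewrite !(hornerD, hornerN, hornerM, horner_exp, hornerMn, hornerC) Aa Bb.
rewrite -[in LHS](mulr_natr _ m) -[in LHS](mulr_natr _ n).
rewrite -[in LHS](mulr_natr _ m.+1) -[in LHS](mulr_natr _ n.+1).
move: (a ^+ m.-1) (b ^+ n.-1) (a ^+ m) (b ^+ n) (a ^+ m.+1) (b ^+ n.+1).
move: (m%:R : C) (n%:R : C) (m.+1%:R : C) (n.+1%:R : C) => *.
by ring.
Qed.

Lemma moment_dx m n :
  ofreal rho ^+ 2 * (m%:R * moment m.-1 n + n%:R * moment m n.-1) =
  m.+1%:R * moment m n.+1 + n.+1%:R * moment m.+1 n.
Proof.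
have [tu uE] := cint_lincomb (ofreal rho ^+ 2 * m%:R) (ofreal rho ^+ 2 * n%:R)
  (- m.+1%:R) (- n.+1%:R) m.-1 m m m.+1 n n.-1 n.+1 n.
apply/eqP; rewrite -subr_eq0 mulrDr opprD !addrA !mulrA -!mulNr -uE; apply/eqP.
pose A (y : R) : {poly C} := 'X + ('i * ofreal y)%:P.
pose B (y : R) : {poly C} := 'X - ('i * ofreal y)%:P.
apply: (cint_lines1 (W := fun y => (ofreal rho ^+ 2)%:P * (A y ^+ m * B y ^+ n)
   - A y ^+ m.+1 * B y ^+ n.+1)) => // [x y|x y xy].
  rewrite affixE affix_conjE; set a := ofreal x + _; set b := ofreal x - _.
  have Ax : (A y).[ofreal x] = a by rewrite /A !hornerE.
  have Bx : (B y).[ofreal x] = b by rewrite /B !hornerE.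
  have A' : (A y)^`() = 1%:P by rewrite /A derivD derivX derivC addr0.
  have B' : (B y)^`() = 1%:P by rewrite /B derivB derivX derivC subr0.
  rewrite (deriv_boundary_poly _ _ _ Ax Bx A' B').
  move: (a ^+ m.-1) (b ^+ n.-1) (a ^+ m) (b ^+ n) (a ^+ m.+1) (b ^+ n.+1).
  move: (m%:R : C) (n%:R : C) (m.+1%:R : C) (n.+1%:R : C) => *.
  by ring.
have Ax : (A y).[ofreal x] = ofreal x + 'i * ofreal y by rewrite /A !hornerE.
have Bx : (B y).[ofreal x] = ofreal x - 'i * ofreal y by rewrite /B !hornerE.
move: (A y) (B y) Ax Bx => A0 B0 Ax Bx.
rewrite !(hornerD, hornerN, hornerM, horner_exp, hornerC) Ax Bx -(normsq_circle xy) !exprS.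
by rewrite mulrACA subrr.
Qed.

Lemma moment_dy m n :
  ofreal rho ^+ 2 * (m%:R * moment m.-1 n - n%:R * moment m n.-1) =
  m.+1%:R * moment m n.+1 - n.+1%:R * moment m.+1 n.
Proof.
have [tu uE] := cint_lincomb ('i * (ofreal rho ^+ 2 * m%:R)) ('i * (- (ofreal rho ^+ 2 * n%:R)))
  ('i * - m.+1%:R) ('i * n.+1%:R) m.-1 m m m.+1 n n.-1 n.+1 n.
have i0 : ('i : C) != 0 by exact: neq0Ci.
apply: (mulfI i0); apply/eqP; rewrite -subr_eq0.
rewrite (_ : _ - _ = cint (fun p =>
       'i * (ofreal rho ^+ 2 * m%:R) * (affix p ^+ m.-1 * affix_conj p ^+ n) +
       'i * - (ofreal rho ^+ 2 * n%:R) * (affix p ^+ m * affix_conj p ^+ n.-1) +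
       'i * - m.+1%:R * (affix p ^+ m * affix_conj p ^+ n.+1) +
       'i * n.+1%:R * (affix p ^+ m.+1 * affix_conj p ^+ n))); last first.
  rewrite uE; move: (m%:R : C) (n%:R : C) (m.+1%:R : C) (n.+1%:R : C) => *.
  by ring.
apply/eqP.
pose A (x : R) : {poly C} := (ofreal x)%:P + 'i%:P * 'X.
pose B (x : R) : {poly C} := (ofreal x)%:P - 'i%:P * 'X.
apply: (cint_lines2 (W := fun y => (ofreal rho ^+ 2)%:P * (A y ^+ m * B y ^+ n)
   - A y ^+ m.+1 * B y ^+ n.+1)) => // [x y|x y xy].
  rewrite affixE affix_conjE; set a := ofreal x + _; set b := ofreal x - _.
  have Ax : (A x).[ofreal y] = a by rewrite /A !hornerE.
  have Bx : (B x).[ofreal y] = b by rewrite /B !hornerE.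
  have A' : (A x)^`() = 'i%:P by rewrite /A derivD derivM !derivC derivX mul0r mulr1 !add0r.
  have B' : (B x)^`() = (- 'i)%:P by rewrite /B derivB derivM !derivC derivX mul0r mulr1 !add0r
    polyCN.
  rewrite (deriv_boundary_poly _ _ _ Ax Bx A' B').
  move: (a ^+ m.-1) (b ^+ n.-1) (a ^+ m) (b ^+ n) (a ^+ m.+1) (b ^+ n.+1).
  move: (m%:R : C) (n%:R : C) (m.+1%:R : C) (n.+1%:R : C) => *.
  by ring.
have Ax : (A x).[ofreal y] = ofreal x + 'i * ofreal y by rewrite /A !hornerE.
have Bx : (B x).[ofreal y] = ofreal x - 'i * ofreal y by rewrite /B !hornerE.
move: (A x) (B x) Ax Bx => A0 B0 Ax Bx.
rewrite !(hornerD, hornerN, hornerM, horner_exp, hornerC) Ax Bx -(normsq_circle xy) !exprS.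
by rewrite mulrACA subrr.
Qed.

(** Sum and difference of [moment_dx] and [moment_dy], that is, the divergence theorem
    for the two Wirtinger derivatives. *)
Lemma moment_rec1 m n :
  ofreal rho ^+ 2 * (m.+1%:R * moment m n) = m.+2%:R * moment m.+1 n.+1.
Proof.
have := moment_dx m.+1 n; have := moment_dy m.+1 n; rewrite /= => h2 h1.
have t0 : (2%:R : C) != 0 by rewrite pnatr_eq0.
apply: (mulfI t0); transitivity (
  (ofreal rho ^+ 2 * (m.+1%:R * moment m n + n%:R * moment m.+1 n.-1)) +
  (ofreal rho ^+ 2 * (m.+1%:R * moment m n - n%:R * moment m.+1 n.-1))).
  by move: (m.+1%:R : C) (n%:R : C) => *; ring.
by rewrite h1 h2; move: (m.+2%:R : C) (n.+1%:R : C) => *; ring.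
Qed.

Lemma moment_rec2 m n :
  ofreal rho ^+ 2 * (n.+1%:R * moment m n) = n.+2%:R * moment m.+1 n.+1.
Proof.
have := moment_dx m n.+1; have := moment_dy m n.+1; rewrite /= => h2 h1.
have t0 : (2%:R : C) != 0 by rewrite pnatr_eq0.
apply: (mulfI t0); transitivity (
  (ofreal rho ^+ 2 * (m%:R * moment m.-1 n.+1 + n.+1%:R * moment m n)) -
  (ofreal rho ^+ 2 * (m%:R * moment m.-1 n.+1 - n.+1%:R * moment m n))).
  by move: (m%:R : C) (n.+1%:R : C) => *; ring.
by rewrite h1 h2; move: (m.+1%:R : C) (n.+2%:R : C) => *; ring.
Qed.

Lemma rho_neq0 : ofreal rho ^+ 2 != 0.
Proof. by rewrite expf_eq0 /= fmorph_eq0 gt_eqF. Qed.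

(** The two recursions express the moment of exponents [m.+1] and [n.+1] through
    [moment m n], with factors proportional to [m.+1 / m.+2] and [n.+1 / n.+2]. *)
Lemma moment_neq m n : m != n -> moment m n = 0.
Proof.
move=> mn; have h1 := moment_rec1 m n; have h2 := moment_rec2 m n.
have : ofreal rho ^+ 2 * (m%:R - n%:R) * moment m n = 0.
  have : ofreal rho ^+ 2 * (n.+2%:R * (m.+1%:R * moment m n) -
      m.+2%:R * (n.+1%:R * moment m n)) = 0.
    by rewrite mulrBr mulrCA h1 [X in _ - X]mulrCA h2 mulrCA subrr.
  by rewrite -!natr1; move: (m%:R : C) (n%:R : C) => a b <-; ring.
move=> /eqP; rewrite -mulrA mulf_eq0 (negPf rho_neq0) /= mulf_eq0 subr_eq0 eqr_nat (negPf mn) /=.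
by move=> /eqP.
Qed.

Lemma moment_diag n : moment n n = ofreal ((rho ^+ 2) ^+ n / n.+1%:R) * moment 0 0.
Proof.
elim: n => [|n IH]; first by rewrite expr0 divr1 (rmorph1 (@ofreal R)) mul1r.
have n0 k : (k.+1%:R : C) != 0 by rewrite pnatr_eq0.
have E k : ofreal ((rho ^+ 2) ^+ k / k.+1%:R) = (ofreal rho ^+ 2) ^+ k / k.+1%:R.
  by rewrite [LHS]rmorphM [X in _ * X = _]fmorphV rmorph_nat !rmorphXn.
apply: (mulfI (n0 n.+1)); rewrite -moment_rec1 IH !E [(_ ^+ 2) ^+ n.+1]exprS.
move: (n0 n) (n0 n.+1) (_ ^+ n : C).
move: (n.+1%:R : C) (n.+2%:R : C) => a b a0 b0 z.
by field; rewrite a0 b0.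
Qed.

End Moments.

(** * Mean squares of power series on discs *)

Section Parseval.
Variable R : realType.
Local Notation C := (cplx R).
Local Notation T := (measurableTypeR R).
Local Notation mu := (@lebesgue_measure R).
Local Notation area := (mu \x mu)%E.
Local Notation affix := (@affix R).
Implicit Types (a : nat -> C) (f : C -> C) (rho r M : R).

Definition disc_area rho : R := fine (area (disc rho)).

Lemma disc_area_gt0 rho : 0 < rho -> 0 < disc_area rho.
Proof.
by move=> r0; apply: fine_gt0; rewrite area_disc_gt0 // area_disc_fin // ltW.
Qed.

Lemma le_disc_area rho r : 0 <= rho <= r -> disc_area rho <= disc_area r.
Proof.
move=> /andP[r0 rr]; apply: fine_le.
- by rewrite ge0_fin_numE ?area_disc_fin.
- by rewrite ge0_fin_numE ?area_disc_fin // (le_trans r0).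
- apply: le_measure; rewrite ?inE; [exact: measurable_disc..|].
  move=> p; rewrite /disc /= => h; apply: lt_le_trans h _.
  by rewrite lerXn2r ?nnegrE // (le_trans r0).
Qed.

Lemma affix_disc rho p : 0 <= rho -> disc rho p <-> modulus (affix p) < rho.
Proof.
move=> r0; rewrite -[_ < rho](@ltr_pXn2r _ 2) ?nnegrE ?modulus_ge0 //.
by rewrite modulus2_reim.
Qed.

Lemma re_cint rho u : re (cint rho u) = \int[area]_(p in disc rho) re (u p).
Proof. by []. Qed.
Lemma im_cint rho u : im (cint rho u) = \int[area]_(p in disc rho) im (u p).
Proof. by []. Qed.

Lemma moment00 rho : moment rho 0 0 = ofreal (disc_area rho).
Proof.
apply: reim_eq; rewrite /moment ?re_cint ?im_cint.
  transitivity (\int[area]_(p in disc rho) (1 : R)).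
    by apply: eq_Rintegral => p _; rewrite !expr0 mulr1.
  by rewrite Rintegral_cst ?mul1r //; exact: measurable_disc.
transitivity (\int[area]_(p in disc rho) (0 : R)).
  by apply: eq_Rintegral => p _; rewrite !expr0 mulr1.
by rewrite Rintegral_cst ?mul0r //; exact: measurable_disc.
Qed.

(** [k.+1%:R^-1 * rho ^+ (2 * k)] is the mean of [|w|^(2 k)] over the disc of radius
    [rho]. *)
Definition wnorm rho a N : R :=
  \sum_(0 <= k < N) modulus (a k) ^+ 2 * (rho ^+ 2) ^+ k / k.+1%:R.

Lemma int_modulus_poly rho a N : 0 < rho ->
  \int[area]_(p in disc rho) (modulus (\sum_(0 <= k < N) a k * affix p ^+ k) ^+ 2) =
  disc_area rho * wnorm rho a N.
Proof.
move=> r0; apply: (@ofreal_inj R).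
have tz := bounded_mfun_affix r0; have tb := bounded_mfun_affix_conj r0.
have E : cint rho (fun p => \sum_(0 <= i < N) \sum_(0 <= j < N)
     (a i * (a j)^*) * (affix p ^+ i * affix_conj p ^+ j)) =
   ofreal (\int[area]_(p in disc rho) (modulus (\sum_(0 <= k < N) a k * affix p ^+ k) ^+ 2)).
  have F p : \sum_(0 <= i < N) \sum_(0 <= j < N)
        (a i * (a j)^*) * (affix p ^+ i * affix_conj p ^+ j)
      = ofreal (modulus (\sum_(0 <= k < N) a k * affix p ^+ k) ^+ 2).
    rewrite modulus_sqr rmorph_sum mulr_suml; apply: eq_bigr => i _.
    rewrite mulr_sumr; apply: eq_bigr => j _.
    by rewrite rmorphM rmorphXn /affix_conj -/(affix p) mulrACA.
  apply: reim_eq; rewrite ?re_cint ?im_cint ?re_ofreal ?im_ofreal.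
    by apply: eq_Rintegral => p _; rewrite F.
  transitivity (\int[area]_(p in disc rho) (0 : R)).
    by apply: eq_Rintegral => p _; rewrite F.
  by rewrite Rintegral_cst ?mul0r //; exact: measurable_disc.
rewrite -E cint_sum //; last first.
  move=> i; apply: bounded_mfun_sum => j; apply: bounded_mfunM => //;
    [exact: bounded_mfun_cst|exact: bounded_mfun_mono].
rewrite [RHS]rmorphM /= -moment00 [in RHS]rmorph_sum mulr_sumr; apply: eq_big_nat => i /andP[_ iN].
rewrite cint_sum //; last by move=> j; apply: bounded_mfunM => //;
    [exact: bounded_mfun_cst|exact: bounded_mfun_mono].
rewrite (bigD1_seq i) ?mem_index_iota ?iota_uniq //=.
rewrite big1 ?addr0; last first.
  move=> j ji; rewrite cintZ //; last exact: bounded_mfun_mono.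
  by rewrite -/(moment rho i j) moment_neq ?mulr0 // eq_sym.
rewrite cintZ //; last exact: bounded_mfun_mono.
rewrite -/(moment rho i i) moment_diag // -modulus_sqr mulrA -rmorphM mulrC.
by rewrite mulrA.
Qed.

Lemma measurable_psum_disc rho a f :
  (forall p, disc rho p -> psum a (affix p) (f (affix p))) ->
  measurable_fun (disc rho) (fun p => modulus (f (affix p)) ^+ 2).
Proof.
move=> h; pose s N p := series (fun k => a k * affix p ^+ k) N.
apply: (@measurable_realfun.measurable_fun_cvg _ _ _ _ (fun N p => modulus (s N p) ^+ 2)).
  move=> N; rewrite /s /series /=.
  under eq_fun do rewrite modulus2_reim.
  have mz (g : C -> R) : (g = @re R \/ g = @im R) ->
      measurable_fun [set: T * T] (fun p => g (\sum_(0 <= k < N) a k * affix p ^+ k)).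
    have P n : measurable_fun [set: T * T] (fun p => re (affix p ^+ n)) /\
       measurable_fun [set: T * T] (fun p => im (affix p ^+ n)).
      elim: n => [|n [h1 h2]]; first by split; exact: measurable_cst.
      split; under eq_fun do rewrite exprS ?(reM, imM).
        by apply: measurable_funB; apply: measurable_funM => //;
         [exact: measurable_coord1|exact: measurable_coord2].
      by apply: measurable_funD; apply: measurable_funM => //;
         [exact: measurable_coord1|exact: measurable_coord2].
    case=> ->.
      under eq_fun do rewrite re_sum.
      apply: measurable_sum => k; have [h1 h2] := P k; under eq_fun do rewrite reM.
      by apply: measurable_funB; apply: measurable_funM => //; exact: measurable_cst.
    under eq_fun do rewrite im_sum.
    apply: measurable_sum => k; have [h1 h2] := P k; under eq_fun do rewrite imM.
    by apply: measurable_funD; apply: measurable_funM => //; exact: measurable_cst.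
  apply: measurable_funTS; apply: measurable_funD; apply: measurable_funX.
    by apply: mz; left.
  by apply: mz; right.
by move=> p Dp; apply: cvgM; apply: cvg_modulus; exact: h.
Qed.

End Parseval.

Section ParsevalLimit.
Variable R : realType.
Local Notation C := (cplx R).
Local Notation T := (measurableTypeR R).
Local Notation mu := (@lebesgue_measure R).
Local Notation area := (mu \x mu)%E.
Local Notation affix := (@affix R).
Implicit Types (a : nat -> C) (f : C -> C) (rho r M : R).

(** Inside the disc of convergence the partial sums are uniformly bounded, so dominated
    convergence applies. *)
Lemma parseval_disc rho r M a f : 0 < rho -> rho < r -> coef_bound a r M ->
  (forall p, disc rho p -> psum a (affix p) (f (affix p))) ->
  exists I : R, (\int[area]_(p in disc rho) (modulus (f (affix p)) ^+ 2)%:E = I%:E)%E /\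
    (fun N => disc_area rho * wnorm rho a N) @ \oo --> I.
Proof.
move=> rho0 rr aM h; have r0 : 0 < r by exact: lt_trans rr.
have [t0 t1] := ratio_lt1 (ltW rho0) rr; set th := rho / r in t0 t1.
pose s N p := series (fun k => a k * affix p ^+ k) N.
pose K := M / (1 - th).
have sK N p : disc rho p -> modulus (s N p) <= K.
  move=> /(affix_disc _ (ltW rho0)) zr; apply: le_trans (modulus_sum _ _ _) _.
  rewrite /K -[1 in X in _ <= X](expr0 th).
  apply: (@le_trans _ _ (\sum_(0 <= k < N) M * (if (k < 0)%N then 0 else th ^+ k))).
    apply: ler_sum => k _; rewrite modulusM modulusX /=.
    apply: le_trans (coef_bound_term _ r0 (ltW rho0) aM).
    by rewrite ler_wpM2l ?modulus_ge0 // lerXn2r ?nnegrE ?modulus_ge0 ?(ltW rho0) ?(ltW zr).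
  rewrite -mulr_sumr ler_wpM2l ?(coef_bound_ge0 aM) //.
  apply: le_trans (sum_geo_tail 0 N t0 t1) _.
  by rewrite expr0 div1r.
have ms N : measurable_fun (disc rho) (fun p => modulus (s N p) ^+ 2).
  apply: (@measurable_psum_disc _ rho (fun k => if (k < N)%N then a k else 0)
    (fun w => \sum_(0 <= k < N) a k * w ^+ k)) => p _.
  apply: (@cvg_near_cst _ _ _ _ _) => //; near=> m.
  have Nm : (N <= m)%N by near: m; exact: nbhs_infty_ge.
  rewrite /series /= (big_cat_nat _ Nm) //= [X in _ + X]big_nat_cond [X in _ + X]big1 ?addr0.
    rewrite big_nat_cond [RHS]big_nat_cond; apply: eq_bigr => k /andP[/andP[_ ->] _].
    by [].
  by move=> k /andP[/andP[Nk _] _]; rewrite ltnNge Nk mul0r.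
have mf : measurable_fun (disc rho) (fun p => modulus (f (affix p)) ^+ 2).
  exact: measurable_psum_disc h.
have isN N : area.-integrable (disc rho) (EFin \o (fun p => modulus (s N p) ^+ 2)).
  apply: (integrable_disc (M := K ^+ 2) (ltW rho0) (ms N)) => p Dp.
  rewrite ger0_norm ?sqr_ge0 // lerXn2r ?nnegrE ?modulus_ge0 ?sK //.
  exact: le_trans (modulus_ge0 _) (sK N p Dp).
have [fi _ cv] := @dominated_convergence _ _ _ area (disc rho) (measurable_disc rho)
  (fun N p => (modulus (s N p) ^+ 2)%:E) (fun p => (modulus (f (affix p)) ^+ 2)%:E)
  (fun=> (K ^+ 2)%:E) (fun N => (measurable_EFinP _ _).2 (ms N))
  ((measurable_EFinP _ _).2 mf)
  ltac:(by apply: aeW => p Dp; apply: cvg_EFin; [exact: nearW|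
     apply: cvgM; apply: cvg_modulus; exact: h])
  ltac:(by apply: (integrable_disc (M := K ^+ 2) (ltW rho0)) => [|p _];
    [exact: measurable_cst|rewrite ger0_norm // sqr_ge0])
  ltac:(by apply: aeW => p N Dp; rewrite abse_EFin lee_fin ger0_norm ?sqr_ge0 //
     lerXn2r ?nnegrE ?modulus_ge0 ?sK //; exact: le_trans (modulus_ge0 _) (sK N p Dp)).
have If := integrable_fin_num (measurable_disc rho) fi.
exists (fine (\int[area]_(p in disc rho) (modulus (f (affix p)) ^+ 2)%:E)%E).
split; first by rewrite fineK.
rewrite -[X in X @ _ --> _](_ : fine \o (fun N => (disc_area rho * wnorm rho a N)%:E) = _) //.
apply: fine_cvg; rewrite fineK //.
move: cv; apply: cvg_trans; apply: near_eq_cvg; apply: nearW => N /=.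
have Y := integrable_fin_num (measurable_disc rho) (isN N).
by rewrite -int_modulus_poly // /Rintegral; symmetry; apply: (fineK Y).
Unshelve. all: by end_near.
Qed.

End ParsevalLimit.

(** * Mean squares on the unit disc *)

Section UnitParseval.
Variable R : realType.
Local Notation C := (cplx R).
Local Notation T := (measurableTypeR R).
Local Notation mu := (@lebesgue_measure R).
Local Notation area := (mu \x mu)%E.
Local Notation affix := (@affix R).
Implicit Types (a : nat -> C) (f : C -> C) (rho r M : R).

Definition taylor f a := forall w, modulus w < 1 -> psum a w (f w).

Lemma taylor_coef_bound f a r : taylor f a -> 0 <= r -> r < 1 ->
  exists M, coef_bound a r M.
Proof.
move=> h r0 r1; have hr : modulus (ofreal r) < 1 by rewrite modulus_ofreal.
exact: psum_coef_bound r0 (h _ hr).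
Qed.

(** The coefficients of a function on the unit disc may grow, so that
    [parseval_disc] applies to smaller discs only; these exhaust the unit disc. *)
Definition radii (k : nat) : R := 1 - k.+2%:R^-1.

Lemma radii_gt0 k : 0 < radii k.
Proof. by rewrite subr_gt0 invf_lt1 ?ltr1n // ltr0n. Qed.
Lemma radii_lt1 k : radii k < 1.
Proof. by rewrite gtrBl invr_gt0 ltr0n. Qed.
Lemma radii_cvg : radii @ \oo --> (1 : R).
Proof.
rewrite -[X in _ --> X]subr0; apply: cvgB; first exact: cvg_cst.
have := @cvg_harmonic R; rewrite -cvg_shiftS; exact.
Qed.
Lemma radii_le k l : (k <= l)%N -> radii k <= radii l.
Proof. by move=> kl; rewrite lerD2l lerN2 lef_pV2 ?posrE ?ltr0n // ler_nat. Qed.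

Lemma disc_radii_ndecr : nondecreasing_seq (fun k => disc (radii k)).
Proof.
move=> k l kl; apply/subsetPset => p; rewrite /disc /= => h; apply: lt_le_trans h _.
by rewrite lerXn2r ?nnegrE ?(ltW (radii_gt0 _)) ?radii_le.
Qed.

Lemma disc_radii_bigcup : \bigcup_k disc (radii k) = disc 1.
Proof.
apply/seteqP; split => [p [k _]|p].
  rewrite /disc /= => h; apply: lt_le_trans h _.
  by rewrite lerXn2r ?nnegrE ?ler01 ?(ltW (radii_gt0 k)) ?(ltW (radii_lt1 k)).
move=> /(affix_disc _ ler01) h.
have : \forall k \near \oo, modulus (affix p) < radii k.
  by apply: (cvgr_gt _ radii_cvg).
move=> [k _ /(_ k (leqnn _))] hk; exists k => //.
by apply/(affix_disc _ (ltW (radii_gt0 k))).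
Qed.

Lemma disc_area_radii_cvg : (fun k => disc_area (radii k)) @ \oo --> disc_area (1 : R).
Proof.
apply: fine_cvg; rewrite fineK; last first.
  by rewrite ge0_fin_numE // area_disc_fin.
have := @nondecreasing_cvg_mu _ _ _ area (fun k => disc (radii k)).
rewrite disc_radii_bigcup; apply; last exact: disc_radii_ndecr.
- by move=> k; exact: measurable_disc.
- exact: measurable_disc.
Qed.

Lemma wnorm_term_ge0 rho a k : 0 <= modulus (a k) ^+ 2 * (rho ^+ 2) ^+ k / k.+1%:R.
Proof.
by rewrite divr_ge0 // mulr_ge0 ?sqr_ge0 // exprn_ge0 // sqr_ge0.
Qed.

Lemma wnorm_le rho r a N : 0 <= rho <= r -> wnorm rho a N <= wnorm r a N.
Proof.
move=> /andP[r0 rr]; apply: ler_sum => k _.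
rewrite ler_wpM2r ?invr_ge0 // ler_wpM2l ?sqr_ge0 //.
by rewrite lerXn2r ?nnegrE ?sqr_ge0 // lerXn2r ?nnegrE // (le_trans r0).
Qed.

Lemma wnorm_ndecr rho a : nondecreasing_seq (wnorm rho a).
Proof.
apply/nondecreasing_seqP => N; rewrite /wnorm big_nat_recr //= lerDl.
exact: wnorm_term_ge0.
Qed.

Lemma wnorm_radii_cvg a N : (fun k => wnorm (radii k) a N) @ \oo --> wnorm 1 a N.
Proof.
elim: N => [|N IH].
  rewrite /wnorm big_nil (_ : (fun k => _) = cst 0); first exact: cvg_cst.
  by apply/funext => k; rewrite big_nil.
rewrite /wnorm big_nat_recr //=.
rewrite (_ : (fun k => _) = (fun k => wnorm (radii k) a N +
   modulus (a N) ^+ 2 * (radii k ^+ 2) ^+ N / N.+1%:R)); last first.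
  by apply/funext => k; rewrite /wnorm big_nat_recr.
apply: cvgD; first exact: IH.
apply: cvgMl; apply: cvgMr.
have E n (u : nat -> R) (l : R) : u @ \oo --> l -> (fun k => u k ^+ n) @ \oo --> l ^+ n.
  move=> ul; elim: n => [|n IHn]; first by under eq_fun do rewrite expr0; exact: cvg_cst.
  by under eq_fun do rewrite exprS; rewrite exprS; exact: cvgM.
exact/E/E/radii_cvg.
Qed.

Lemma taylor_psum_disc f a rho : taylor f a -> 0 <= rho <= 1 ->
  forall p, disc rho p -> psum a (affix p) (f (affix p)).
Proof.
move=> fa /andP[r0 r1] p /(affix_disc _ r0) h; apply: fa; exact: lt_le_trans r1.
Qed.

Lemma parseval_radii f a k : taylor f a ->
  exists I : R, (\int[area]_(p in disc (radii k)) (modulus (f (affix p)) ^+ 2)%:E = I%:E)%E /\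
    (fun N => disc_area (radii k) * wnorm (radii k) a N) @ \oo --> I.
Proof.
move=> fa; have k0 := radii_gt0 k; have k1 := radii_lt1 k.
have kl : radii k < radii k.+1 by rewrite ltrD2l ltrN2 ltf_pV2 ?posrE ?ltr0n // ltr_nat.
have [M aM] := taylor_coef_bound fa (ltW (radii_gt0 k.+1)) (radii_lt1 k.+1).
apply: (parseval_disc k0 kl aM); apply: taylor_psum_disc => //.
by rewrite !ltW.
Qed.

Lemma measurable_taylor f a rho : taylor f a -> 0 <= rho <= 1 ->
  measurable_fun (disc rho) (fun p => (modulus (f (affix p)) ^+ 2)%:E).
Proof.
move=> fa r1; apply/measurable_EFinP; apply: (@measurable_psum_disc _ _ a).
exact: taylor_psum_disc.
Qed.

Lemma radii01 k : 0 <= radii k <= 1.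
Proof. by rewrite !ltW ?radii_gt0 ?radii_lt1. Qed.

Lemma parseval_le f a S : taylor f a -> (forall N, wnorm 1 a N <= S) ->
  (\int[area]_(p in disc 1) (modulus (f (affix p)) ^+ 2)%:E <= (disc_area 1 * S)%:E)%E.
Proof.
move=> fa aS; rewrite -disc_radii_bigcup.
have cv := @ge0_nondecreasing_set_cvg_integral _ _ _ (fun k => disc (radii k))
  (fun p => (modulus (f (affix p)) ^+ 2)%:E) area disc_radii_ndecr
  (fun k => measurable_disc (radii k)) (fun k => measurable_taylor fa (radii01 k))
  (fun k p _ => sqr_ge0 _).
apply: (lee_cvg_to cv (cvg_cst _)); apply: nearW => k /=.
have [I [-> cvI]] := parseval_radii k fa; rewrite lee_fin.
apply: (ler_cvg_to cvI (cvg_cst _)); apply: nearW => N.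
apply: ler_pM => //.
- by rewrite ltW // disc_area_gt0 // radii_gt0.
- by apply: sumr_ge0 => i _; exact: wnorm_term_ge0.
- exact/le_disc_area/radii01.
- apply: le_trans (aS N); exact/wnorm_le/radii01.
Qed.

Lemma parseval_ge f a B : taylor f a ->
  (\int[area]_(p in disc 1) (modulus (f (affix p)) ^+ 2)%:E <= B%:E)%E ->
  forall N, disc_area 1 * wnorm 1 a N <= B.
Proof.
move=> fa fB N.
have cv : (fun k => disc_area (radii k) * wnorm (radii k) a N) @ \oo --> disc_area 1 * wnorm 1 a N.
  by apply: cvgM; [exact: disc_area_radii_cvg|exact: wnorm_radii_cvg].
apply: (ler_cvg_to cv (cvg_cst _)); apply: nearW => k.
have [I [IE cvI]] := parseval_radii k fa.
apply: (@le_trans _ _ I).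
  apply: (ler_cvg_to (cvg_cst _) cvI); near=> n.
  rewrite ler_wpM2l ?(ltW (disc_area_gt0 (radii_gt0 k))) //.
  by apply: wnorm_ndecr; near: n; exact: nbhs_infty_ge.
rewrite -lee_fin -IE; apply: le_trans fB; apply: ge0_subset_integral => //.
- exact: measurable_disc.
- exact: measurable_disc.
- by apply: (measurable_taylor fa); rewrite ler01 lexx.
- by move=> p _; rewrite lee_fin sqr_ge0.
- by rewrite -disc_radii_bigcup => p kp; exists k.
Unshelve. all: by end_near.
Qed.

Lemma parseval f a S : taylor f a -> wnorm 1 a @ \oo --> S ->
  (\int[area]_(p in disc 1) (modulus (f (affix p)) ^+ 2)%:E = (disc_area 1 * S)%:E)%E.
Proof.
move=> fa aS.
have le N : wnorm 1 a N <= S.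
  have cv : cvgn (wnorm 1 a) by apply/cvg_ex; exists S.
  have := nondecreasing_cvgn_le (@wnorm_ndecr 1 a) cv N.
  by rewrite (cvg_lim _ aS).
have h1 := parseval_le fa le.
apply/eqP; rewrite eq_le h1 /=.
have h0 : (0 <= \int[area]_(p in disc 1) (modulus (f (affix p)) ^+ 2)%:E)%E.
  by apply: integral_ge0 => p _; rewrite lee_fin sqr_ge0.
have fn : (\int[area]_(p in disc 1) (modulus (f (affix p)) ^+ 2)%:E)%E \is a fin_num.
  by rewrite ge0_fin_numE //; apply: le_lt_trans h1 _; rewrite ltry.
rewrite -(fineK fn) lee_fin.
have cv : (fun N => disc_area 1 * wnorm 1 a N) @ \oo --> disc_area 1 * S.
  by apply: cvgMr.
apply: (ler_cvg_to cv (cvg_cst _)); apply: nearW => N.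
by apply: (parseval_ge fa); rewrite fineK.
Qed.

Lemma parseval_finite f a : taylor f a ->
  (\int[area]_(p in disc 1) (modulus (f (affix p)) ^+ 2)%:E < +oo)%E ->
  exists S : R, wnorm 1 a @ \oo --> S.
Proof.
move=> fa fy; set I := (\int[area]_(p in _) _)%E in fy.
have h0 : (0 <= I)%E.
  by apply: integral_ge0 => p _; rewrite lee_fin sqr_ge0.
have fn : I \is a fin_num by rewrite ge0_fin_numE.
have le N : wnorm 1 a N <= fine I / disc_area 1.
  rewrite ler_pdivlMr ?disc_area_gt0 // mulrC.
  by apply: (parseval_ge fa); rewrite fineK.
apply/cvg_ex; apply: nondecreasing_is_cvgn; first exact: wnorm_ndecr.
by exists (fine I / disc_area 1) => _ [N _ <-].
Qed.

End UnitParseval.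

(** * Convergence of the Taylor series in the whole disc *)

Section GlobalTaylor.
Variable R : realType.
Local Notation C := (cplx R).
Local Notation T := (measurableTypeR R).
Local Notation mu := (@lebesgue_measure R).
Local Notation area := (mu \x mu)%E.
Local Notation affix := (@affix R).
Implicit Types (a : nat -> C) (f : C -> C) (rho r s M : R).

(** Cauchy's estimate, with a factor lost because it is read off from the mean
    square over a disc instead of a circle. *)
Lemma cauchy_estimate a f r s L : 0 < s -> s < r ->
  (forall w, modulus w < r -> psum a w (f w)) ->
  (forall w, modulus w < r -> modulus (f w) <= L) ->
  forall n, modulus (a n) * s ^+ n <= n.+1%:R * L.
Proof.
move=> s0 sr fa fL n.
pose r' := (s + r) / 2; have sr' : s < r' by rewrite /r'; lra.
have r'r : r' < r by rewrite /r'; lra.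
have r'0 : 0 <= r' by rewrite ltW // (lt_trans s0).
have L0 : 0 <= L.
  by apply: le_trans (modulus_ge0 _) (fL 0 _); rewrite modulus0; lra.
have [|M aM] := psum_coef_bound r'0 (fa (ofreal r') _); first by rewrite modulus_ofreal.
have h p : disc s p -> psum a (affix p) (f (affix p)).
  by move=> /(affix_disc _ (ltW s0)) zs; apply: fa; exact: lt_trans sr.
have [I [IE cvI]] := parseval_disc s0 sr' aM h.
have A0 := disc_area_gt0 s0.
have IL : I <= disc_area s * L ^+ 2.
  rewrite -lee_fin -IE.
  have -> : (disc_area s * L ^+ 2)%:E = (\int[area]_(p in disc s) (L ^+ 2)%:E)%E.
    rewrite integral_cst; last exact: measurable_disc.
    rewrite EFinM muleC; congr (_ * _)%E; apply: fineK.
    by rewrite ge0_fin_numE; [exact: area_disc_fin (ltW s0)|exact: measure_ge0].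
  apply: ge0_le_integral.
  - exact: measurable_disc.
  - by move=> p _; rewrite lee_fin sqr_ge0.
  - by apply/measurable_EFinP; exact: measurable_psum_disc h.
  - exact: measurable_cst.
  - move=> p /(affix_disc _ (ltW s0)) zs; rewrite lee_fin lerXn2r ?nnegrE ?modulus_ge0 //.
    by apply: fL; exact: lt_trans sr.
have W : wnorm s a n.+1 <= L ^+ 2.
  rewrite -(ler_pM2l A0); apply: le_trans IL.
  apply: (ler_cvg_to (cvg_cst _) cvI); near=> N.
  rewrite ler_wpM2l ?(ltW A0) //.
  by apply: wnorm_ndecr; near: N; exact: nbhs_infty_ge.
have : modulus (a n) ^+ 2 * (s ^+ 2) ^+ n / n.+1%:R <= L ^+ 2.
  apply: le_trans W; rewrite /wnorm big_nat_recr //= lerDr.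
  by apply: sumr_ge0 => k _; exact: wnorm_term_ge0.
rewrite ler_pdivrMr ?ltr0n // -exprM mulnC exprM -exprMn => H.
rewrite -(@ler_pXn2r _ 2) ?nnegrE ?mulr_ge0 ?modulus_ge0 ?exprn_ge0 ?(ltW s0) //.
apply: le_trans H _; rewrite exprMn mulrC ler_wpM2r ?sqr_ge0 //.
by rewrite expr2 ler_peMr // ler1n.
Unshelve. all: by end_near.
Qed.

Lemma psum_recenter a r M k u : coef_bound a r M -> modulus u < r ->
  psum (fun n => a (n + k)%N * 'C(n + k, k)%:R) u (recenter a u k).
Proof.
move=> aM ur; have := recenter_cvg (k:=k) aM ur.
rewrite -(cvg_shiftn k) /psum; apply: cvg_trans; apply: near_eq_cvg; apply: nearW => n.
rewrite /series /= (big_cat_nat _ (leq_addl n k)) //= big_nat_cond big1 ?add0r; last first.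
  by move=> i /andP[/andP[_ ik] _]; rewrite bin_small // mulr0 mul0r.
by rewrite -{1}(add0n k) big_addn addnK; apply: eq_bigr => i _; rewrite addnK.
Qed.

Lemma quad_geo_bound (th : R) : 0 <= th -> th < 1 ->
  exists K : R, forall n, n.+1%:R ^+ 2 * th ^+ n <= K.
Proof.
move=> t0 t1; have [K [e [K0 e0 e1 Ke]]] := lin_geo_bound t0 t1.
have [K' [e' [K'0 e'0 e'1 Ke']]] := lin_geo_bound e0 e1.
exists (K * K') => n; rewrite expr2 -mulrA.
apply: le_trans (ler_wpM2l _ (Ke n)) _ => //; rewrite mulrCA ler_wpM2l //.
by apply: le_trans (Ke' n) _; rewrite ler_piMr // exprn_ile1 // ltW.
Qed.

(** One number [dl] bounds the radius from below and the coefficients from above.  The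
    condition then holds for all small [dl], so that finitely many of them have a
    common one. *)
Definition uniform_expansion f (dl : R) (b : C) := exists c,
  (forall k, modulus (c k) * dl ^+ k <= dl^-1) /\
  forall u, modulus u < dl -> psum c u (f (b + u)).

Lemma local_uniform_expansion f x : analytic_at f x -> exists2 e : R, 0 < e &
  forall b dl, modulus (b - x) < e -> 0 < dl -> dl < e -> uniform_expansion f dl b.
Proof.
move=> /analytic_expansion[c [r [M [r0 cM h]]]].
have M0 := coef_bound_ge0 cM.
(* The first bound keeps the discs of radius [r / 4] inside half of the disc of [x],
   where the recentered coefficients are bounded by [2 M]; the second makes
   [2 M <= dl^-1]. *)
exists (Num.min (r / 4) (2 * M + 1)^-1).
  by rewrite lt_min divr_gt0 // invr_gt0 ltr_wpDl // mulr_ge0.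
move=> b dl; rewrite !lt_min => /andP[bx _] d0 /andP[d4 dM].
exists (recenter c (b - x)); split=> [k|u ud].
  have b4 : modulus (b - x) + r / 4 < r by lra.
  have r40 : 0 < r / 4 by lra.
  have := recenter_bound cM r40 b4 k.
  have h2 : M / (1 - (modulus (b - x) + r / 4) / r) <= 2 * M.
    have q : (modulus (b - x) + r / 4) / r <= 1 / 2 by rewrite ler_pdivrMr //; lra.
    rewrite ler_pdivrMr; last by lra.
    by rewrite mulrAC; apply: ler_peMl => //; lra.
  move=> h3; apply: (@le_trans _ _ (2 * M)); first apply: le_trans h2.
    apply: le_trans h3; rewrite ler_wpM2l ?modulus_ge0 //.
    by rewrite lerXn2r ?nnegrE ?ltW.
  have X0 : 0 < 2 * M + 1 by lra.
  have : 2 * M + 1 <= dl^-1.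
    by rewrite -[leLHS]invrK lef_pV2 ?posrE ?invr_gt0 // ltW.
  lra.
apply: (recenter_sum cM (b := b - x)); first by lra.
rewrite -[b]/(b) (_ : b + u = x + (b - x + u)); last by rewrite addrA (addrC x) subrK.
apply: h; apply: le_lt_trans (ler_modulusD _ _) _; lra.
Qed.


Lemma nbhs_plane (p : R * R) (e : R) : 0 < e ->
  \forall q \near p, modulus (complex_of_pair q - complex_of_pair p : C) < e.
Proof.
move=> e0; have e20 : 0 < e / 2 by rewrite divr_gt0.
exists (ball p.1 (e / 2), ball p.2 (e / 2)); first by split; exact: nbhsx_ballx.
move=> [x y] [hx hy]; apply: le_lt_trans (modulus_le_reim _) _.
rewrite reD imD reN imN (splitr e) distrC (distrC (im _)).
by apply: ltrD; [exact: hx|exact: hy].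
Qed.

Lemma uniform_expansion_closed_disc f s : analytic_on_disc f -> 0 < s -> s < 1 ->
  exists dl, [/\ 0 < dl, dl < s & forall b, modulus b <= s -> uniform_expansion f dl b].
Proof.
move=> fA s0 s1.
pose K : set (R * R) := [set p | modulus (complex_of_pair p : C) <= s].
have cK : compact K.
  apply: (@subclosed_compact _ _ (`[- s, s]%classic `*` `[- s, s]%classic)).
  - rewrite (_ : K = (fun p : R * R => p.1 ^+ 2 + p.2 ^+ 2) @^-1` [set x | x <= s ^+ 2]).
      apply: closed_comp; last exact: closed_le.
      move=> p _; apply: cvgD; apply: cvgM; exact: cvg_fst || exact: cvg_snd.
    apply/predeqP => p; rewrite /K /preimage /mkset.
    by rewrite -[modulus _ <= s](@ler_pXn2r _ 2) ?nnegrE ?modulus_ge0 ?(ltW s0) // modulus2_reim.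
  - by apply: compact_setX; exact: segment_compact.
  - move=> [x y] h; split; rewrite /mkset in_itv -[is_true _]/(is_true (- s <= _ <= s)) -ler_norml.
      exact: le_trans (re_le_modulus (complex_of_pair (x, y))) h.
    exact: le_trans (im_le_modulus (complex_of_pair (x, y))) h.
have near_dl : \forall dl \near (0 : R)^'+,
    K `<=` (fun p => uniform_expansion f dl (complex_of_pair p)).
  apply: ((compact_near_coveringP K).1 cK) => p Kp.
  have [|e e0 h] := local_uniform_expansion (fA (complex_of_pair p) _).
    by apply/unit_discE; exact: le_lt_trans s1.
  exists ([set q | modulus (complex_of_pair q - complex_of_pair p : C) < e],
          [set dl | 0 < dl < e]).
    split; first exact: nbhs_plane.
    near=> dl; apply/andP; split; near: dl; [exact: nbhs_right_gt|exact: nbhs_right_lt].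
  by move=> [q dl] [hq /andP[d0 de]]; exact: h.
have [dl [h d0 ds]] : exists dl, [/\ K `<=` (fun p => uniform_expansion f dl (complex_of_pair p)),
    0 < dl & dl < s].
  apply: (@filter_ex _ ((0 : R)^'+)); near=> dl; split.
  - by near: dl.
  - by near: dl; exact: nbhs_right_gt.
  - by near: dl; exact: nbhs_right_lt.
exists dl; split=> // b bs.
have := h (re b, im b); rewrite /K /mkset.
have -> : (complex_of_pair (re b, im b) : C) = b by exact: reim_eq.
exact.
Unshelve. all: by end_near.
Qed.

(** If the Taylor series at 0 sums to [f] on the disc of radius [s < 1], then it
    still does on a larger disc: the expansions about the points of the first disc
    converge on discs of a common radius [dl], and Cauchy's estimate for their
    coefficients, which are the [k]-th derivatives of the series divided by [k`!],
    yields [|a_N| (s' + dl)^N <= (N + 1)^2 / dl] for all [s' < s]. *)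
Lemma taylor_extend f a s : analytic_on_disc f -> 0 < s -> s < 1 ->
  (forall w, modulus w < s -> psum a w (f w)) ->
  exists2 r, s < r & forall w, modulus w < r -> psum a w (f w).
Proof.
move=> fA s0 s1 fa.
have [dl [d0 ds U]] := uniform_expansion_closed_disc fA s0 s1.
have reexp b c : modulus b < s ->
    (forall u, modulus u < dl -> psum c u (f (b + u))) -> recenter a b = c.
  move=> bs hc; have [r [r0 br rs]] := radius_between bs.
  have [|M aM] := psum_coef_bound r0 (fa (ofreal r) _); first by rewrite modulus_ofreal.
  have fr u : modulus u < r -> psum a u (f (0 + u)).
    by move=> ur; rewrite add0r; apply: fa; exact: lt_trans rs.
  have := expansion_recenter aM fr br; rewrite add0r => h1.
  exact: expansion_unique h1 (expansion_of_psum d0 hc).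
have recb b k : modulus b < s -> modulus (recenter a b k) <= dl^-1 / dl ^+ k.
  move=> bs; have [c [h1 h2]] := U b (ltW bs).
  by rewrite (reexp b c bs h2) ler_pdivlMr ?exprn_gt0.
have est n k t : 0 < t -> t < s ->
    'C(n + k, k)%:R * modulus (a (n + k)%N) * t ^+ n * dl ^+ k <= n.+1%:R / dl.
  move=> t0 ts; rewrite -ler_pdivlMr ?exprn_gt0 // -mulrA.
  have := @cauchy_estimate (fun n => a (n + k)%N * 'C(n + k, k)%:R)
    (fun b => recenter a b k) s t (dl^-1 / dl ^+ k) t0 ts _ (fun b bs => recb b k bs) n.
  rewrite modulusM modulus_nat -mulrA mulrCA !mulrA; apply=> b bs.
  have [r [r0 br rs]] := radius_between bs.
  have [|M aM] := psum_coef_bound r0 (fa (ofreal r) _); first by rewrite modulus_ofreal.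
  exact: psum_recenter aM br.
(* [t < s], as the estimate requires, while [t + dl] is larger than [s]. *)
pose t := s - dl / 2; have t0 : 0 < t by rewrite /t; lra.
have ts : t < s by rewrite /t; lra.
have aN N : modulus (a N) * (t + dl) ^+ N <= N.+1%:R ^+ 2 / dl.
  rewrite exprDn mulr_sumr.
  apply: (@le_trans _ _ (\sum_(i < N.+1) N.+1%:R / dl)); last first.
    by rewrite sumr_const card_ord -[leLHS]mulr_natl mulrA expr2.
  apply: ler_sum => -[i iN] _ /=; rewrite ltnS in iN.
  have := est (N - i)%N i t t0 ts; rewrite subnK // => h.
  rewrite -mulr_natl; apply: le_trans (_ : _ <= (N - i).+1%:R / dl) _.
    apply: le_trans h; rewrite le_eqVlt; apply/orP; left; apply/eqP.
    by move: (modulus _) (t ^+ _) (dl ^+ i) => x y v; ring.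
  by rewrite ler_wpM2r ?invr_ge0 ?(ltW d0) // ler_nat ltnS leq_subr.
pose r' := s + dl / 4; have r't : r' < t + dl by rewrite /r' /t; lra.
have r'0 : 0 <= r' by rewrite /r'; lra.
have [h0 h1] := ratio_lt1 r'0 r't.
have td0 : 0 < t + dl by lra.
have [K hK] := quad_geo_bound h0 h1.
have aM : coef_bound a r' (K / dl).
  move=> n; have := ler_wpM2l (exprn_ge0 n h0) (aN n).
  rewrite mulrCA -exprMn divfK ?gt_eqF // => h; apply: le_trans h _.
  by rewrite mulrA (mulrC (_ ^+ n)) ler_wpM2r ?invr_ge0 ?(ltW d0).
exists r'; first by rewrite /r'; lra.
move=> w wr; have [ws|sw] := ltP (modulus w) s; first exact: fa.
have w0 : 0 < modulus w by exact: lt_le_trans sw.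
have wn0 : ofreal (modulus w) != 0 :> C.
  by rewrite ofreal_eq0 gt_eqF.
(* [w] is within reach of the expansion about the point [b] of modulus [t] on the
   segment from 0 to [w]; there both series have the same coefficients. *)
pose b := ofreal (t / modulus w) * w; pose u := w - b.
have bE : modulus b = t.
  by rewrite modulusM modulus_ofreal ?divr_ge0 ?ltW // divfK // gt_eqF.
have uE : modulus u = modulus w - t.
  rewrite /u /b -[X in X - _]mul1r -mulrBl modulusM -(rmorph1 (@ofreal R)) -rmorphB.
  rewrite modulus_ofreal; last first.
    by rewrite subr_ge0 ler_pdivrMr // mul1r; lra.
  by rewrite mulrBl mul1r divfK // gt_eqF.
have ud : modulus u < dl by rewrite uE /t; move: wr; rewrite /r'; lra.
have bs : modulus b < s by rewrite bE.
have [c [_ hc]] := U b (ltW bs); have := hc u ud.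
have wE : b + u = w by rewrite /u addrC subrK.
rewrite -(reexp b c bs hc) wE => h.
have [W aW] := psum_exists aM wr.
have bu : modulus b + modulus u < r' by rewrite uE bE addrC subrK.
have := recenter_sum aM bu; rewrite wE => /(_ _ aW) h'.
by rewrite (psum_unique h h').
Qed.

(** By [taylor_extend], the radius up to which the Taylor series at 0 sums to [f] has
    no other supremum than 1. *)
Lemma analytic_taylor f : analytic_on_disc f -> exists a, taylor f a.
Proof.
move=> fA.
have [|a [r0 [M [r00 aM h]]]] := (analytic_expansion f 0).1 (fA 0 _).
  by apply/unit_discE; rewrite modulus0.
exists a; pose E := [set s : R | s <= 1 /\ forall w, modulus w < s -> psum a w (f w)].
have E0 : E (Num.min r0 1).
  split; first by rewrite ge_min lexx orbT.
  by move=> w; rewrite lt_min => /andP[wr _]; have := h w wr; rewrite add0r.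
have Eub : has_ubound E by exists 1 => s [].
have Es : has_sup E by split; [exists (Num.min r0 1)|].
have S0 : 0 < sup E by apply: lt_le_trans (ub_le_sup Eub E0); rewrite lt_min r00 ltr01.
have S1 : sup E <= 1 by apply: ge_sup; [exists (Num.min r0 1)|move=> s []].
have ES w : modulus w < sup E -> psum a w (f w).
  move=> wS; have [|e [e1 he]] := @sup_adherent _ E (sup E - modulus w) _ Es.
    by rewrite subr_gt0.
  by rewrite opprB addrC subrK => we; exact: he.
suff S1' : sup E = 1 by move=> w; rewrite -S1'; exact: ES.
apply/eqP; rewrite eq_le S1 leNgt; apply/negP => S11.
have [r Sr hr] := taylor_extend fA S0 S11 ES.
have : E (Num.min r 1).
  split; first by rewrite ge_min lexx orbT.
  by move=> w; rewrite lt_min => /andP[wr _]; exact: hr.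
by move=> /(ub_le_sup Eub); rewrite leNgt lt_min Sr S11.
Qed.

Lemma taylor_expansion0 f a : taylor f a -> expansion f 0 a.
Proof.
by move=> fa; apply: (expansion_of_psum ltr01) => u u1; rewrite add0r; exact: fa.
Qed.

Lemma taylor_unique f a b : taylor f a -> taylor f b -> a = b.
Proof.
by move=> /taylor_expansion0 fa /taylor_expansion0 fb; exact: expansion_unique fa fb.
Qed.

Lemma taylor_expansion f a b : taylor f a -> modulus b < 1 -> expansion f b (recenter a b).
Proof.
move=> fa b1; have [r [r0 br r1]] := radius_between b1.
have [M aM] := taylor_coef_bound fa r0 r1.
have fr u : modulus u < r -> psum a u (f (0 + u)).
  by move=> ur; rewrite add0r; apply: fa; exact: lt_trans r1.
by have := expansion_recenter aM fr br; rewrite add0r.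
Qed.

Lemma taylor_analytic f a : taylor f a -> analytic_on_disc f.
Proof.
move=> fa b /unit_discE b1; apply/analytic_expansion.
by exists (recenter a b); exact: taylor_expansion.
Qed.

End GlobalTaylor.

(** * Algebra of Taylor series *)

Section TaylorAlgebra.
Variable R : realType.
Local Notation C := (cplx R).
Implicit Types (a b : nat -> C) (f g : C -> C) (r M : R).

Definition overconv a := exists r M, 1 < r /\ coef_bound a r M.

Lemma taylorD f g a b : taylor f a -> taylor g b ->
  taylor (fun w => f w + g w) (fun n => a n + b n).
Proof. by move=> fa gb w w1; exact: psumD (fa w w1) (gb w w1). Qed.

Lemma taylorZ (k : C) f a : taylor f a -> taylor (fun w => k * f w) (fun n => k * a n).
Proof. by move=> fa w w1; exact: psumZ (fa w w1). Qed.

Lemma taylorX f a : taylor f a ->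
  taylor (fun w => w * f w) (fun n => if n is n'.+1 then a n' else 0).
Proof. by move=> fa w w1; exact: psum_shift (fa w w1). Qed.

Lemma taylor_cst (k : C) : taylor (fun=> k) (fun n => if n is 0%N then k else 0).
Proof. by move=> w w1; exact: psum_cst. Qed.

Lemma taylorM f g a b : taylor f a -> taylor g b ->
  taylor (fun w => f w * g w) (conv a b).
Proof.
move=> fa gb w w1; have [r [r0 wr r1]] := radius_between w1.
have [M aM] := taylor_coef_bound fa r0 r1.
have [N bN] := taylor_coef_bound gb r0 r1.
exact: psum_conv aM bN wr (fa w w1) (gb w w1).
Qed.

Lemma eq_taylor f g a : (forall w, modulus w < 1 -> f w = g w) -> taylor f a -> taylor g a.
Proof. by move=> fg fa w w1; rewrite -fg //; exact: fa. Qed.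

Lemma eq_taylor_seq f a b : a =1 b -> taylor f a -> taylor f b.
Proof. by move=> /funext ->. Qed.

Lemma overconvD a b : overconv a -> overconv b -> overconv (fun n => a n + b n).
Proof.
move=> [r [M [r1 aM]]] [s [N [s1 bN]]]; pose t := Num.min r s.
have t1 : 1 < t by rewrite lt_min r1 s1.
have [tr ts] : t <= r /\ t <= s by split; rewrite ge_min lexx ?orbT.
have t0 : 0 <= t by rewrite ltW // (lt_trans ltr01).
have aM' : coef_bound a t M by apply: coef_bound_le aM; rewrite t0.
have bN' : coef_bound b t N by apply: coef_bound_le bN; rewrite t0.
exists t, (M + N); split=> // n.
apply: le_trans (ler_wpM2r (exprn_ge0 n t0) (ler_modulusD _ _)) _.
by rewrite mulrDl lerD.
Qed.

Lemma overconvM a b : overconv a -> overconv b -> overconv (conv a b).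
Proof.
move=> [r [M [r1 aM]]] [s [N [s1 bN]]]; pose t := Num.min r s.
have t1 : 1 < t by rewrite lt_min r1 s1.
have [tr ts] : t <= r /\ t <= s by split; rewrite ge_min lexx ?orbT.
have t0 : 0 <= t by rewrite ltW // (lt_trans ltr01).
have aM' : coef_bound a t M by apply: coef_bound_le aM; rewrite t0.
have bN' : coef_bound b t N by apply: coef_bound_le bN; rewrite t0.
pose u := (1 + t) / 2; have u0 : 0 <= u by rewrite /u; lra.
have ut : u < t by rewrite /u; lra.
have [K cK] := coef_bound_conv u0 ut aM' bN'.
by exists u, K; split=> //; rewrite /u; lra.
Qed.

Lemma overconvZ (k : C) a : overconv a -> overconv (fun n => k * a n).
Proof.
move=> [r [M [r1 aM]]]; exists r, (modulus k * M); split=> // n.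
by rewrite modulusM -mulrA ler_wpM2l ?modulus_ge0.
Qed.

Lemma overconvX a : overconv a -> overconv (fun n => if n is n'.+1 then a n' else 0).
Proof.
move=> [r [M [r1 aM]]]; have r0 : 0 < r by exact: lt_trans r1.
exists r, (r * M); split=> // -[|n].
  by rewrite modulus0 mul0r mulr_ge0 ?(coef_bound_ge0 aM) // ltW.
by rewrite exprS mulrCA ler_wpM2l // ltW.
Qed.

Lemma overconv_cst (k : C) : overconv (fun n => if n is 0%N then k else 0).
Proof.
exists 2, (modulus k); split; first by rewrite ltr1n.
by case=> [|n]; rewrite ?expr0 ?mulr1 // modulus0 mul0r modulus_ge0.
Qed.

Lemma taylor_geometric (be : C) : modulus be <= 1 ->
  taylor (fun w => (1 - be * w)^-1) (fun n => be ^+ n).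
Proof.
move=> be1 w w1.
have bw : modulus (be * w) < 1.
  rewrite modulusM; apply: le_lt_trans w1.
  by rewrite ler_piMl ?modulus_ge0.
have n0 : 1 - be * w != 0.
  by apply/negP => /eqP/subr0_eq h; move: bw; rewrite -h modulus1 ltxx.
apply: (@squeeze_modulus _ _ _
  (fun n => modulus (1 - be * w)^-1 * modulus (be * w) ^+ n)); last first.
  by apply: cvg_geo => //; exact: modulus_ge0.
move=> n; rewrite /series /=.
have -> : \sum_(0 <= k < n) be ^+ k * w ^+ k = (1 - be * w)^-1 * (1 - (be * w) ^+ n).
  apply: (mulfI n0); rewrite mulrA mulfV // mul1r.
  elim: n => [|n IH]; first by rewrite big_nil mulr0 expr0 subrr.
  by rewrite big_nat_recr //= mulrDr IH -exprMn exprS; ring.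
rewrite mulrBr mulr1 addrAC subrr sub0r modulusN.
by rewrite [leLHS]modulusM modulusX lexx.
Qed.

Lemma overconv_geometric (be : C) : modulus be < 1 -> overconv (fun n => be ^+ n).
Proof.
move=> be1; have [->|b0] := eqVneq be 0.
  exists 2, 1; split; first by rewrite ltr1n.
  by case=> [|n]; rewrite ?expr0 ?modulus1 ?mulr1 // exprS mul0r modulus0 mul0r.
exists (modulus be)^-1, 1; split; first by rewrite invf_gt1 // modulus_gt0.
by move=> n; rewrite modulusX -exprMn mulfV ?expr1n // modulus_eq0.
Qed.

(** The Taylor coefficients of [(1 - be * w)^-(j + 1)]. *)
Definition kernel_seq (be : C) j n : C := 'C(n + j, j)%:R * be ^+ n.

Lemma hockey_stick n j : (\sum_(0 <= i < n.+1) 'C(i + j, j) = 'C(n + j.+1, j.+1))%N.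
Proof.
elim: n => [|n IH]; first by rewrite big_nat1 !add0n !binn.
by rewrite big_nat_recr //= IH [in RHS]addSn binS addSnnS.
Qed.

Lemma kernel_conv be j : conv (kernel_seq be j) (fun n => be ^+ n) = kernel_seq be j.+1.
Proof.
apply/funext => n; rewrite /conv /kernel_seq -hockey_stick natr_sum mulr_suml.
apply: eq_big_nat => i /andP[_ iN]; rewrite -mulrA -exprD subnKC //.
Qed.

Lemma taylor_kernel (be : C) j : modulus be <= 1 ->
  taylor (fun w => ((1 - be * w) ^+ j.+1)^-1) (kernel_seq be j).
Proof.
move=> be1; elim: j => [|j IH].
  apply: eq_taylor_seq (eq_taylor _ (taylor_geometric be1)) => [n|w _].
    by rewrite /kernel_seq addn0 bin0 mul1r.
  by rewrite expr1.
rewrite -kernel_conv; apply: eq_taylor (taylorM IH (taylor_geometric be1)) => w _.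
by rewrite -invfM -exprSr.
Qed.

End TaylorAlgebra.

(** * The weighted norm of Taylor coefficients *)

Section WeightedL2.
Variable R : realType.
Local Notation C := (cplx R).
Implicit Types (a b h : nat -> C) (r M A B : R).

(** Up to the area of the disc, the partial sums of the squared norm and of the inner
    product in the space of square integrable analytic functions. *)
Definition sq a N : R := \sum_(0 <= k < N) modulus (a k) ^+ 2 / k.+1%:R.
Definition inner a b N : C := \sum_(0 <= k < N) a k * (b k)^* / k.+1%:R.

Lemma wnorm1 a : wnorm 1 a = sq a.
Proof.
apply/funext => N; apply: eq_bigr => k _.
by rewrite !expr1n mulr1.
Qed.

Lemma sq_term_ge0 a k : 0 <= modulus (a k) ^+ 2 / k.+1%:R.
Proof. by apply: divr_ge0; [exact: sqr_ge0|exact: ler0n]. Qed.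

Lemma sq_ge_term a A k : sq a @ \oo --> A -> modulus (a k) ^+ 2 / k.+1%:R <= A.
Proof.
move=> aA; apply: (ler_cvg_to (cvg_cst _) aA); near=> N.
have kN : (k < N)%N by near: N; exact: nbhs_infty_gt.
rewrite /sq (bigD1_seq k) ?mem_index_iota ?iota_uniq //= lerDl.
by apply: sumr_ge0 => i _; exact: sq_term_ge0.
Unshelve. all: by end_near.
Qed.

Lemma sq_ge0 a A : sq a @ \oo --> A -> 0 <= A.
Proof. by move=> /(sq_ge_term 0); apply: le_trans; exact: sq_term_ge0. Qed.

Lemma sq_eq0 a k : sq a @ \oo --> (0 : R) -> a k = 0.
Proof.
move=> /(sq_ge_term k); rewrite pmulr_lle0 ?invr_gt0 ?ltr0n // => h.
apply/eqP; rewrite -modulus_eq0 -sqrf_eq0.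
by rewrite eq_le h sqr_ge0.
Qed.

Lemma sq_overconv a : overconv a -> exists A : R, sq a @ \oo --> A.
Proof.
move=> [r [M [r1 aM]]]; have r0 : 0 < r by exact: lt_trans r1.
have M0 := coef_bound_ge0 aM.
have [t0 t1] : 0 <= r^-1 /\ r^-1 < 1 by rewrite invr_ge0 ltW // invf_lt1.
apply/cvg_ex; apply: (@series_le_cvg _ _ (geometric (M ^+ 2) (r^-1))).
- by move=> n; exact: sq_term_ge0.
- by move=> n; rewrite mulr_ge0 ?sqr_ge0 ?exprn_ge0.
- move=> n /=; have h : modulus (a n) <= M * r^-1 ^+ n.
    by rewrite exprVn ler_pdivlMr ?exprn_gt0.
  apply: (@le_trans _ _ (modulus (a n) ^+ 2)).
    by rewrite ler_piMr ?sqr_ge0 // invf_le1 ?ltr0n // ler1n.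
  apply: (@le_trans _ _ ((M * r^-1 ^+ n) ^+ 2)).
    by rewrite lerXn2r ?nnegrE ?modulus_ge0 // (le_trans _ h) ?modulus_ge0.
  rewrite exprMn ler_wpM2l ?sqr_ge0 // expr2 ler_piMr ?exprn_ge0 //.
  by rewrite exprn_ile1 // ltW.
- by apply: is_cvg_geometric_series; rewrite ger0_norm.
Qed.

Lemma re_inner_self a N : inner a a N = ofreal (sq a N).
Proof.
rewrite /inner /sq rmorph_sum; apply: eq_bigr => k _.
by rewrite -modulus_sqr [RHS]rmorphM fmorphV rmorph_nat.
Qed.

Lemma modulus_sub2 (x y t : C) : modulus (x - t * y) ^+ 2 =
  modulus x ^+ 2 - 2 * re (t^* * (x * y^*)) + modulus t ^+ 2 * modulus y ^+ 2.
Proof.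
rewrite !modulus2_reim !(reD, imD, reN, imN, reM, imM, re_conj, im_conj).
by ring.
Qed.

Lemma sq_sub a b (t l : C) A B : sq a @ \oo --> A -> sq b @ \oo --> B ->
  inner a b @ \oo --> l ->
  sq (fun n => a n - t * b n) @ \oo --> A - 2 * re (t^* * l) + modulus t ^+ 2 * B.
Proof.
move=> aA bB abl.
have -> : sq (fun n => a n - t * b n) =
    (fun N => sq a N - 2 * re (t^* * inner a b N) + modulus t ^+ 2 * sq b N).
  apply/funext => N; rewrite /sq /inner !mulr_sumr re_sum mulr_sumr -sumrB -big_split /=.
  apply: eq_bigr => k _; rewrite modulus_sub2.
  have -> : (k.+1%:R^-1 : C) = ofreal k.+1%:R^-1 by rewrite fmorphV rmorph_nat.
  have -> : re (t^* * (a k * (b k)^* * ofreal k.+1%:R^-1)) =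
      re (t^* * (a k * (b k)^*)) / k.+1%:R.
    by rewrite mulrA [LHS]reM re_ofreal im_ofreal mulr0 subr0.
  by move: (re _) => x; ring.
apply: cvgD; last by apply: cvgMr.
apply: cvgB => //; apply: cvgMr; apply: cvg_re.
by apply: cvgM; [exact: cvg_cst|exact: abl].
Qed.

End WeightedL2.

(** * Expansivity of the one-point divisor *)

(* Keeps simplification from unfolding a modulus into a square root. *)
Arguments modulus {R} w : simpl never.

Section Expansivity.
Variable R : realType.
Local Notation C := (cplx R).
Implicit Types (a b h : nat -> C) (r M A B : R).

Lemma expansive_term (al a b c : C) (x := modulus al ^+ 2) :
  modulus (al * ofreal (2 - x) * a - (b + b) + al^* * c) ^+ 2 -
    (2 - x) * modulus (a - (al^* * b + al^* * b) + al^* * (al^* * c)) ^+ 2 =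
  (1 - x) ^+ 2 * (- (2 - x) * modulus a ^+ 2 + 4 * modulus b ^+ 2 + x * modulus c ^+ 2
    - 4 * re (al * (b * c^*))).
Proof.
rewrite /x !modulus2_reim.
rewrite !(reD, imD, reN, imN, reM, imM, re_conj, im_conj, re_ofreal, im_ofreal).
by ring.
Qed.

Definition shift1 h n : C := if n is n'.+1 then h n' else 0.

Lemma weighted_square_ge0 (al a b : C) (p q : R) :
  0 <= p ^+ 2 * modulus a ^+ 2 + q ^+ 2 * (modulus al ^+ 2 * modulus b ^+ 2)
    - 2 * (p * q) * re (al * (a * b^*)).
Proof.
have := sqr_ge0 (modulus (ofreal p * a - ofreal q * (al^* * b))).
rewrite !modulus2_reim !(reD, imD, reN, imN, reM, imM, re_conj, im_conj, re_ofreal, im_ofreal).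
by move=> /le_trans; apply; rewrite le_eqVlt; apply/orP; left; apply/eqP; ring.
Qed.

(** The Taylor coefficients of [(al - w) (2 - |al|^2 - al^* w) h(w)] and, below, of
    [(1 - al^* w)^2 h(w)], where [h] has the coefficients [h n]. *)
Definition div_num_seq (al : C) h n : C :=
  al * ofreal (2 - modulus al ^+ 2) * h n - (shift1 h n + shift1 h n)
    + al^* * shift1 (shift1 h) n.
Definition div_den_seq (al : C) h n : C :=
  h n - (al^* * shift1 h n + al^* * shift1 h n) + al^* * (al^* * shift1 (shift1 h) n).

(** The one-point divisor at [al] is expansive.  Up to a constant factor it is
    [(al - w) (2 - |al|^2 - al^* w) / (1 - al^* w)^2]; with the denominator cleared,
    the difference of the two weighted norms is a sum of positive multiples of the
    squares [|n h_n - (n + 1) al^* h_(n-1)|^2] and of a boundary term that tends to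
    zero. *)
Lemma expansive_partial (al : C) (h : nat -> C) (x := modulus al ^+ 2) N :
  (1 - x) ^+ 2 * (x / N.+1%:R * modulus (h N) ^+ 2 - (2 - x) / N.+2%:R * modulus (h N.+1) ^+ 2)
    <= sq (div_num_seq al h) N.+2 - (2 - x) * sq (div_den_seq al h) N.+2.
Proof.
pose P := div_num_seq al h; pose Q := div_den_seq al h; rewrite -/P -/Q.
have S n : sq P n.+1 - (2 - x) * sq Q n.+1 = sq P n - (2 - x) * sq Q n +
    (1 - x) ^+ 2 * ((- (2 - x) * modulus (h n) ^+ 2 + 4 * modulus (shift1 h n) ^+ 2
     + x * modulus (shift1 (shift1 h) n) ^+ 2
    - 4 * re (al * (shift1 h n * (shift1 (shift1 h) n)^*))) / n.+1%:R).
  rewrite mulrA -expansive_term -/x -/(P n) -/(Q n) /sq !big_nat_recr //=.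
  by move: (modulus (P n)) (modulus (Q n)) => *; ring.
elim: N => [|N IH].
  rewrite !S /sq !big_geq //= modulus0 expr0n /=.
  have -> : re (al * (0 * 0^*)) = 0 by rewrite mul0r mulr0.
  have -> : re (al * (h 0%N * 0^*)) = 0 by rewrite conjC0 !mulr0.
  rewrite le_eqVlt; apply/orP; left; apply/eqP.
  by move: (modulus (h 0%N) ^+ 2) (modulus (h 1%N) ^+ 2) => u v; field.
rewrite S; apply: le_trans (lerD IH (lexx _)); rewrite -mulrDr ler_wpM2l ?sqr_ge0 //=.
have := weighted_square_ge0 al (h N.+1) (h N) N.+1%:R N.+2%:R; rewrite -/x.
move: (modulus (h N.+2) ^+ 2) (modulus (h N.+1) ^+ 2) (modulus (h N) ^+ 2) (re _) => u v t s.
have n0 : (0 : R) < N.+1%:R by rewrite ltr0n.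
have E3 : (N.+3%:R : R) = N.+1%:R + 2 by rewrite -addn2 natrD.
have E2 : (N.+2%:R : R) = N.+1%:R + 1 by rewrite -addn1 natrD.
rewrite E3 E2.
move: (N.+1%:R : R) n0 => n n0 H.
rewrite -subr_ge0 [X in 0 <= X](_ : _ = 2 / (n * (n + 1) * (n + 2)) *
    (n ^+ 2 * v + (n + 1) ^+ 2 * (x * t) - 2 * (n * (n + 1)) * s)).
  by rewrite mulr_ge0 // divr_ge0 // !mulr_ge0 //; lra.
field; lra.
Qed.

End Expansivity.

(** * Kernels orthogonal to functions with prescribed zeros *)

Section Reproducing.
Variable R : realType.
Local Notation C := (cplx R).
Implicit Types (a b h : nat -> C) (f g : C -> C) (r M A B : R).

Lemma expansive (al : C) h (A B : R) : modulus al < 1 -> overconv h ->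
  sq (div_num_seq al h) @ \oo --> A -> sq (div_den_seq al h) @ \oo --> B ->
  (2 - modulus al ^+ 2) * B <= A.
Proof.
move=> al1 /sq_overconv[H hH] cA cB; set x := modulus al ^+ 2.
have x1 : x < 1 by rewrite /x expr2 mulr_ilt1 ?modulus_ge0.
have x0 : 0 <= x by exact: sqr_ge0.
have t0 : (fun N => modulus (h N) ^+ 2 / N.+1%:R) @ \oo --> (0 : R).
  by apply: (@cvg_series_cvg_0 R R); apply/cvg_ex; exists H.
have cL : (fun N => (1 - x) ^+ 2 * (2 - x) * - (modulus (h N.+1) ^+ 2 / N.+2%:R)) @ \oo --> (0 : R).
  rewrite -[X in _ --> X](mulr0 ((1 - x) ^+ 2 * (2 - x))); apply: cvgMr.
  rewrite -oppr0; apply: cvgN.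
  by rewrite -(@cvg_shiftS R) in t0.
have cR : (fun N => sq (div_num_seq al h) N.+2 - (2 - x) * sq (div_den_seq al h) N.+2) @ \oo
    --> A - (2 - x) * B.
  have sh (u : nat -> R) (l : R) : u @ \oo --> l -> (fun n => u n.+2) @ \oo --> l.
    move=> ul; have := ul; rewrite -(@cvg_shiftS R) -(@cvg_shiftS R); exact.
  by apply: cvgB; [exact: sh|apply: cvgMr; exact: sh].
rewrite -subr_ge0; apply: (ler_cvg_to cL cR); apply: nearW => N.
apply: le_trans (expansive_partial al h N); rewrite -/x -mulrA.
rewrite ler_wpM2l ?sqr_ge0 // mulrN mulrA mulrAC lerBrDr addrC subrr.
by rewrite mulr_ge0 ?sqr_ge0 // divr_ge0.
Qed.

(** The weight [1 / (k + 1)] turns the coefficient [C(k + j + 1, j + 1)] of the kernel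
    into [C(k + j + 1, j) / (j + 1)].  By Vandermonde's identity this is a combination
    of the [C(k, i)] with [i <= j], so the pairing is a combination of the derivatives
    of [f] at [b] up to the order [j]. *)
Lemma inner_kernel f a (b : C) j : taylor f a -> modulus b < 1 ->
  (forall i, (i <= j)%N -> recenter a b i = 0) ->
  inner a (kernel_seq b^* j.+1) @ \oo --> (0 : C).
Proof.
move=> fa b1 b0.
pose S i N := \sum_(0 <= k < N) a k * 'C(k, i)%:R * b ^+ (k - i).
have Si i : (i <= j)%N -> S i @ \oo --> (0 : C).
  move=> ij; rewrite -(b0 i ij); have [r [r0 br r1]] := radius_between b1.
  have [M aM] := taylor_coef_bound fa r0 r1.
  exact: recenter_cvg aM br.
have -> : inner a (kernel_seq b^* j.+1) = (fun N => \sum_(0 <= i < j.+1)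
    ('C(j.+1, j - i)%:R / j.+1%:R * b ^+ i) * S i N).
  apply/funext => N; rewrite /inner /S.
  under [RHS]eq_bigr do rewrite mulr_sumr.
  rewrite exchange_big /=; apply: eq_bigr => k _.
  have j0 : (j.+1%:R : C) != 0 by rewrite pnatr_eq0.
  have k0 : (k.+1%:R : C) != 0 by rewrite pnatr_eq0.
  have E : 'C(k + j.+1, j.+1)%:R / k.+1%:R = 'C(k + j.+1, j)%:R / j.+1%:R :> C.
    apply/eqP; rewrite eqr_div // -!natrM eqr_nat mulnC mul_bin_left.
    by rewrite -addSnnS addnK mulnC.
  rewrite /kernel_seq rmorphM rmorph_nat rmorphXn /= conjCK.
  transitivity (a k * b ^+ k * ('C(k + j.+1, j.+1)%:R / k.+1%:R)).
    by rewrite mulrA -!mulrA; congr (_ * _); rewrite mulrCA !mulrA.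
  rewrite E -binomial.Vandermonde natr_sum big_mkord mulr_suml mulr_sumr.
  apply: eq_bigr => i _; rewrite natrM; have [ik|ki] := leqP i k.
    have -> : b ^+ k = b ^+ i * b ^+ (k - i) by rewrite -exprD subnKC.
    move: (b ^+ i) (b ^+ (k - i)) => x y.
    by move: ('C(k, i)%:R : C) ('C(j.+1, j - i)%:R : C) (j.+1%:R^-1 : C) => *; ring.
  by rewrite bin_small // mul0r mul0r mulr0 mulr0 mul0r mulr0.
rewrite -[X in _ --> X](_ : \sum_(0 <= i < j.+1)
    ('C(j.+1, j - i)%:R / j.+1%:R * b ^+ i) * 0 = 0); last first.
  by rewrite big1 // => i _; rewrite mulr0.
rewrite (_ : (fun N => _) = (fun N => \sum_(0 <= i < j.+1)
   (if (i <= j)%N then ('C(j.+1, j - i)%:R / j.+1%:R * b ^+ i) * S i N else 0))); last first.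
  by apply/funext => N; apply: eq_big_nat => i /andP[_]; rewrite ltnS => ->.
apply: (@cvg_finite_sum _ j.+1 (fun i N =>
   if (i <= j)%N then ('C(j.+1, j - i)%:R / j.+1%:R * b ^+ i) * S i N else 0)
   (fun i => ('C(j.+1, j - i)%:R / j.+1%:R * b ^+ i) * 0)) => i.
rewrite mulr0; case: (leqP i j) => [ij|_]; last exact: cvg_cst.
rewrite -[X in _ --> X](mulr0 ('C(j.+1, j - i)%:R / j.+1%:R * b ^+ i)).
by apply: cvgM; [exact: cvg_cst|exact: Si].
Qed.

Lemma inner_monomial a (m : nat) (k : C) :
  inner a (fun n => if n == m then k else 0) @ \oo --> a m * k^* / m.+1%:R.
Proof.
apply: cvg_near_cst; near=> N.
have mN : (m < N)%N by near: N; exact: nbhs_infty_gt.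
rewrite /inner (bigD1_seq m) ?mem_index_iota ?iota_uniq //= eqxx big1 ?addr0 //.
by move=> i /negPf ->; rewrite conjC0 mulr0 mul0r.
Unshelve. all: by end_near.
Qed.

Lemma innerD a b b' (l l' : C) : inner a b @ \oo --> l -> inner a b' @ \oo --> l' ->
  inner a (fun n => b n + b' n) @ \oo --> l + l'.
Proof.
move=> h h'; rewrite (_ : inner a (fun n => _) = inner a b \+ inner a b').
  by apply: cvgD; [exact: h|exact: h'].
apply/funext => N; rewrite /inner /= -big_split /=; apply: eq_bigr => k _.
by rewrite rmorphD mulrDr mulrDl.
Qed.

Lemma innerZ a b (k l : C) : inner a b @ \oo --> l ->
  inner a (fun n => k * b n) @ \oo --> k^* * l.
Proof.
move=> h; rewrite (_ : inner a (fun n => _) = (fun N => k^* * inner a b N)).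
  by apply: cvgM; [exact: cvg_cst|exact: h].
apply/funext => N; rewrite /inner mulr_sumr; apply: eq_bigr => i _.
by rewrite rmorphM mulrCA !mulrA.
Qed.

Section Spaces.
Variables (N : nat) (z : 'I_N -> C) (e : 'I_N -> nat) (m : nat).
Hypothesis z1 : forall n, modulus (z n) < 1.

(** The zeros are expressed through recentered coefficients because this is the form
    that [inner_kernel] uses. *)
Definition zero_space f a := taylor f a /\
  forall n j, (j < e n)%N -> recenter a (z n) j = 0.

(** Pairing with such an [f] is a multiple of the [m]-th Taylor coefficient on
    [zero_space].  A nonzero [f] that belongs to [zero_space] itself spans the
    orthogonal complement there of the functions with [a m = 0]: it is, up to a
    factor, the solution of the extremal problem. *)
Definition extremal_kernel f b := taylor f b /\
  exists ga, forall g a, zero_space g a -> inner a b @ \oo --> (ga * a m : C).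

Lemma zero_spaceP f a : taylor f a ->
  zero_space f a <-> forall n, vanishes_to_order f (z n) (e n).
Proof.
move=> fa; split=> [[_ h] n|h].
  by apply/(expansion_vanishes _ (taylor_expansion fa (z1 n))); exact: h.
by split=> // n; have := (expansion_vanishes (e n) (taylor_expansion fa (z1 n))).1 (h n).
Qed.

Lemma kernel_cst0 : extremal_kernel (fun=> 0) (fun=> 0).
Proof.
split.
  by apply: eq_taylor_seq (@taylor_cst R 0) => -[].
exists 0 => g a _; rewrite mul0r (_ : inner a _ = cst 0); first exact: cvg_cst.
by apply/funext => k; rewrite /inner big1 // => i _; rewrite conjC0 mulr0 mul0r.
Qed.

Lemma kernelD f g a b : extremal_kernel f a -> extremal_kernel g b ->
  extremal_kernel (fun w => f w + g w) (fun n => a n + b n).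
Proof.
move=> [fa [k hk]] [gb [l hl]]; split; first exact: taylorD.
by exists (k + l) => h c hc; rewrite mulrDl; apply: innerD; [exact: hk hc|exact: hl hc].
Qed.

Lemma kernelZ (k : C) f a : extremal_kernel f a ->
  extremal_kernel (fun w => k * f w) (fun n => k * a n).
Proof.
move=> [fa [l hl]]; split; first exact: taylorZ.
by exists (k^* * l) => h c hc; rewrite -mulrA; apply: innerZ; exact: hl hc.
Qed.

Lemma kernel_pole n j : (j < e n)%N -> extremal_kernel
  (fun w => ((1 - (z n)^* * w) ^+ j.+2)^-1) (kernel_seq (z n)^* j.+1).
Proof.
move=> je; split; first by apply: taylor_kernel; rewrite modulus_conj ltW.
exists 0 => g a [ga ha]; rewrite mul0r; apply: (inner_kernel ga) => // i ij.
by apply: ha; exact: leq_ltn_trans je.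
Qed.

Lemma taylor_monomial i : taylor (fun w : C => w ^+ i) (fun n => if n == i then 1 else 0).
Proof.
elim: i => [|i IH]; first by apply: eq_taylor_seq (@taylor_cst R 1) => -[].
apply: eq_taylor_seq (eq_taylor _ (taylorX IH)) => [[|n]|w _] //.
by rewrite exprS.
Qed.

Lemma kernel_monomial i : (forall g a j, zero_space g a -> (j < m)%N -> a j = 0) ->
  (i <= m)%N -> extremal_kernel (fun w : C => w ^+ i) (fun n => if n == i then 1 else 0).
Proof.
move=> low im; split; first exact: taylor_monomial.
exists (if i == m then m.+1%:R^-1 else 0) => g a ha.
have := @inner_monomial a i 1; rewrite conjC1 mulr1.
case: eqVneq => [->|nim]; first by rewrite mulrC.
by rewrite (low g a i ha) ?mul0r // ltn_neqAle nim.
Qed.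

End Spaces.
End Reproducing.

(** * Absence of further zeros *)

Section NoExtraZero.
Variable R : realType.
Local Notation C := (cplx R).
Implicit Types (a b hc : nat -> C) (f g h : C -> C) (al : C) (r M A B : R).
Variables (N : nat) (z : 'I_N -> C) (e : 'I_N -> nat) (m : nat).
Hypothesis z1 : forall n, modulus (z n) < 1.

Lemma cvg_ofreal (u : nat -> R) (l : R) : u @ \oo --> l ->
  (fun n => ofreal (u n)) @ \oo --> (ofreal l : C).
Proof.
move=> ul; apply/cvg_modulusP.
have : (fun n => `|u n - l|) @ \oo --> (0 : R).
  by rewrite -(normr0 R) -(subrr l); apply: cvg_norm; apply: cvgB => //; exact: cvg_cst.
apply: cvg_trans; apply: near_eq_cvg; apply: nearW => n.
by apply: (@ofreal_inj R); rewrite -norm_modulus -rmorphB;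
  have := normc_def (ofreal (u n - l)); rewrite /= expr0n addr0 sqrtr_sqr.
Qed.

(** The factor is found by pairing [f] with itself. *)
Lemma kernel_norm f b B : extremal_kernel z e m f b -> zero_space z e f b ->
  sq b @ \oo --> B ->
  exists2 ga, ofreal B = ga * b m & forall g a, zero_space z e g a ->
    inner a b @ \oo --> (ga * a m : C).
Proof.
move=> [_ [ga hg]] zb bB; exists ga => //.
apply: limit_unique (cvg_ofreal bB) _.
have := hg f b zb; rewrite (_ : inner b b = fun n => ofreal (sq b n)); first exact.
by apply/funext => n; rewrite re_inner_self.
Qed.

Lemma kernel_nonzero f b : extremal_kernel z e m f b -> zero_space z e f b ->
  b m = 0 -> forall w, modulus w < 1 -> f w = 0.
Proof.
move=> [fb [ga hg]] zb bm w w1.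
have h := hg f b zb; rewrite bm mulr0 in h.
have s0 : sq b @ \oo --> (0 : R).
  have := cvg_re h; apply: cvg_trans; apply: near_eq_cvg; apply: nearW => n.
  by rewrite /= re_inner_self re_ofreal.
have b0 : b = fun=> 0 by apply/funext => k; exact: sq_eq0 s0.
have := fb w w1; rewrite b0 => H.
apply: (limit_unique H).
rewrite (_ : series _ = cst 0); first exact: cvg_cst.
by apply/funext => n; rewrite /series /= big1 // => i _; rewrite mul0r.
Qed.

Lemma taylor_div_num al h hc : taylor h hc ->
  taylor (fun w => (al - w) * (ofreal (2 - modulus al ^+ 2) - al^* * w) * h w)
    (div_num_seq al hc).
Proof.
move=> hh; pose x := ofreal (2 - modulus al ^+ 2).
have h1 := taylorX hh; have h2 := taylorX h1.
have := taylorD (taylorD (taylorZ (k := al * x) hh)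
  (taylorZ (k := - 1) (taylorD h1 h1))) (taylorZ (k := al^*) h2).
move=> H; apply: eq_taylor_seq (eq_taylor _ H) => [n|w _].
  by rewrite /div_num_seq -/x mulN1r; case: n => [|[|n]].
have E : al * al^* = 2 - x by rewrite -modulus_sqr /x rmorphB rmorph_nat opprB addrC subrK.
rewrite -/x; transitivity ((al * x - (al * al^*) * w - x * w + al^* * w ^+ 2) * h w).
  by rewrite E; ring.
by ring.
Qed.

Lemma taylor_div_den al h hc : taylor h hc ->
  taylor (fun w => (1 - al^* * w) ^+ 2 * h w) (div_den_seq al hc).
Proof.
move=> hh; have h1 := taylorX hh; have h2 := taylorX h1.
have := taylorD (taylorD hh (taylorZ (k := - 1)
  (taylorD (taylorZ (k := al^*) h1) (taylorZ (k := al^*) h1))))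
  (taylorZ (k := al^*) (taylorZ (k := al^*) h2)).
move=> H; apply: eq_taylor_seq (eq_taylor _ H) => [n|w _].
  by rewrite /div_den_seq mulN1r; case: n => [|[|n]].
by ring.
Qed.

(** If [f] had the zero [al] besides those of [zero_space], dividing it by the
    one-point divisor of [al] would give an element of [zero_space] of no larger
    norm and of larger [m]-th coefficient, against the extremality of [f]. *)
Lemma no_extra_zero f b h hc al : extremal_kernel z e m f b -> zero_space z e f b ->
  b m != 0 -> modulus al < 1 -> taylor h hc -> overconv hc ->
  (forall j, (j < m)%N -> hc j = 0) ->
  zero_space z e (fun w => (1 - al^* * w) ^+ 2 * h w) (div_den_seq al hc) ->
  (forall w, modulus w < 1 ->
     f w = (al - w) * (ofreal (2 - modulus al ^+ 2) - al^* * w) * h w) -> False.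
Proof.
move=> kb zb bm al1 hh oh low zd fE.
set x := modulus al ^+ 2 in fE.
have x1 : x < 1 by rewrite /x expr2 mulr_ilt1 ?modulus_ge0.
have x0 : 0 <= x by exact: sqr_ge0.
have bE : b = div_num_seq al hc.
  apply: (taylor_unique kb.1); apply: eq_taylor (taylor_div_num (al := al) hh) => w w1.
  by rewrite fE.
have sh1 j : (j <= m)%N -> shift1 hc j = 0 by case: j => // j; exact: low.
have sh2 j : (j <= m)%N -> shift1 (shift1 hc) j = 0.
  by case: j => // j jm; apply: sh1; exact: ltnW.
have ob : overconv (div_num_seq al hc).
  apply: overconvD.
    apply: overconvD; first exact: overconvZ.
    have := overconvZ (- 1) (overconvD (overconvX oh) (overconvX oh)).
    by congr overconv; apply/funext => n; rewrite mulN1r.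
  by apply: overconvZ; apply: overconvX; exact: overconvX.
have od : overconv (div_den_seq al hc).
  apply: overconvD.
    apply: overconvD => //.
    have := overconvZ (- 1) (overconvD (overconvZ al^* (overconvX oh))
      (overconvZ al^* (overconvX oh))).
    by congr overconv; apply/funext => n; rewrite mulN1r.
  by do 2 apply: overconvZ; apply: overconvX; exact: overconvX.
have [A cA] := sq_overconv ob; have [B cB] := sq_overconv od.
have AB := expansive al1 oh cA cB; rewrite -/x in AB.
rewrite -bE in cA.
have [ga gaA hg] := kernel_norm kb zb cA.
have dm : div_den_seq al hc m = hc m.
  by rewrite /div_den_seq sh1 // sh2 // !mulr0 !addr0 subr0.
have bmE : b m = al * ofreal (2 - x) * hc m.
  by rewrite bE /div_num_seq sh1 // sh2 // mulr0 !addr0 subr0.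
have al0 : al != 0 by apply: contraNneq bm => al0; rewrite bmE al0 !mul0r.
have x2 : ofreal (2 - x) != 0 :> C.
  by rewrite ofreal_eq0 gt_eqF //; lra.
(* The projection of the quotient on [f] is [t * f]; the squared distance between them
   is the nonnegative quantity used below. *)
pose t := (al * ofreal (2 - x))^-1.
have hm : hc m = t * b m by rewrite bmE mulrA mulVf ?mul1r // mulf_neq0.
have := hg _ _ zd; rewrite dm hm mulrCA -gaA => cI.
have := sq_ge0 (sq_sub (t := t) cB cA cI).
have -> : re (t^* * (t * ofreal A)) = modulus t ^+ 2 * A.
  by rewrite mulrA (mulrC _ t) -modulus_sqr -rmorphM re_ofreal.
have tE : modulus t ^+ 2 = (x * (2 - x) ^+ 2)^-1.
  by rewrite /t modulusV exprVn modulusM modulus_ofreal; [rewrite exprMn|lra].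
have xp : 0 < x by rewrite lt_def x0 andbT /x sqrf_eq0 modulus_eq0.
have A0 : 0 < A.
  rewrite lt_def (sq_ge0 cA) andbT; apply: contraNneq bm => A0.
  by rewrite A0 in cA; apply/eqP; exact: sq_eq0 cA.
have D0 : 0 < x * (2 - x) ^+ 2 by rewrite mulr_gt0 // exprn_gt0 //; lra.
rewrite tE => H.
have : A <= x * (2 - x) ^+ 2 * B.
  by rewrite mulrC -ler_pdivrMr // mulrC; lra.
move=> H1; have : A <= x * (2 - x) * A.
  apply: le_trans H1 _; rewrite expr2 mulrA -(mulrA (x * (2 - x))) ler_wpM2l //.
  by rewrite mulr_ge0 //; lra.
have : 0 < (1 - x) ^+ 2 * A by rewrite mulr_gt0 // exprn_gt0 // subr_gt0.
by nra.
Qed.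

End NoExtraZero.

(** * Partial fractions *)

Section PartialFractions.
Variable K : fieldType.
Implicit Types (P B : {poly K}) (be w : K).

Lemma horner_pole be w : (1 - be *: 'X : {poly K}).[w] = 1 - be * w.
Proof. by rewrite !(hornerD, hornerN, hornerC, hornerZ, hornerX). Qed.

Lemma divide_pole be P : be != 0 -> root P be^-1 ->
  exists2 P', P = (1 - be *: 'X) * P' & size P' = (size P).-1.
Proof.
move=> b0 /factor_theorem[q ->]; exists (- be^-1 *: q).
  have E : be%:P * be^-1%:P = 1 by rewrite -polyCM mulfV.
  rewrite -!mul_polyC polyCN; move: E; set b := be%:P; set b' := be^-1%:P => E.
  transitivity ((b * b') * 'X * q - b' * q); last by ring.
  by rewrite E mul1r; ring.
have [->|q0] := eqVneq q 0; first by rewrite scaler0 mul0r size_poly0.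
rewrite size_scale ?oppr_eq0 ?invr_eq0 // size_Mmonic ?monicXsubC //.
by rewrite size_XsubC addn2.
Qed.

(** Subtracting the right polar term of the highest order makes the numerator divisible
    by [1 - be * w], which lowers the order of the pole by one. *)
Lemma partial_fraction_pole be B D0 s k P : be != 0 -> B.[be^-1] != 0 ->
  (0 < D0)%N -> (size B <= s.+1)%N -> (size P <= D0 + k + s)%N ->
  exists (P' : {poly K}) (c : nat -> K), (size P' <= D0 + s)%N /\
    forall w, 1 - be * w != 0 -> B.[w] != 0 ->
      P.[w] / ((1 - be * w) ^+ k * B.[w]) =
      P'.[w] / B.[w] + \sum_(0 <= j < k) c j / (1 - be * w) ^+ j.+1.
Proof.
move=> b0 Bb D00 sB; elim: k P => [|k IH] P sP.
  exists P, (fun=> 0); split; first by rewrite addn0 in sP.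
  by move=> w _ _; rewrite expr0 mul1r big_geq ?addr0.
pose c0 := P.[be^-1] / B.[be^-1].
have rP : root (P - c0 *: B) be^-1.
  by rewrite /root hornerD hornerN hornerZ /c0 divfK ?subrr.
have [P1 PE sP1] := divide_pole b0 rP.
have [|P' [c [sP' h]]] := IH P1.
  rewrite sP1 -subn1 leq_subLR; apply: leq_trans (size_polyD _ _) _.
  rewrite size_polyN geq_max; apply/andP; split; first by apply: leq_trans sP _; lia.
  by apply: leq_trans (size_scale_leq _ _) _; apply: leq_trans sB _; lia.
exists P', (fun j => if j == k then c0 else c j); split=> // w w0 Bw.
rewrite big_nat_recr //= eqxx.
rewrite (eq_big_nat _ _ (F2 := fun j => c j / (1 - be * w) ^+ j.+1)); last first.
  by move=> j /andP[_ jk]; rewrite ltn_eqF.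
rewrite addrA -h //.
have -> : P.[w] = c0 * B.[w] + (1 - be * w) * P1.[w].
  by rewrite -horner_pole -hornerM -PE hornerD hornerN hornerZ addrC subrK.
rewrite exprS; field.
by rewrite Bw w0 expf_neq0.
Qed.

Variables (I : eqType) (be : I -> K) (k : I -> nat).

Definition pole_prod (s : seq I) : {poly K} := \prod_(n <- s) (1 - be n *: 'X) ^+ k n.

Lemma horner_pole_prod s w : (pole_prod s).[w] = \prod_(n <- s) (1 - be n * w) ^+ k n.
Proof.
rewrite /pole_prod horner_prod; apply: eq_bigr => n _.
by rewrite horner_exp horner_pole.
Qed.

Lemma size_pole_prod s : (size (pole_prod s) <= (\sum_(n <- s) k n).+1)%N.
Proof.
elim: s => [|n s IH]; first by rewrite /pole_prod !big_nil size_poly1.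
rewrite /pole_prod !big_cons -/(pole_prod s).
apply: leq_trans (size_polyMleq _ _) _.
have h1 : (size (1 - be n *: 'X)%R <= 2)%N.
  apply: leq_trans (size_polyD _ _) _; rewrite size_polyN geq_max size_poly1 /=.
  by apply: leq_trans (size_scale_leq _ _) _; rewrite size_polyX.
have h2 : (size ((1 - be n *: 'X) ^+ k n)%R <= (k n).+1)%N.
  apply: leq_trans (size_poly_exp_leq _ _) _; rewrite ltnS.
  by move: h1; case: (size _) => [|[|[|?]]] //= _; rewrite ?mul0n ?mul1n.
by rewrite -subn1 leq_subLR; apply: leq_trans (leq_add h2 IH) _; lia.
Qed.

Lemma partial_fractions D0 (s : seq I) P : uniq s -> (0 < D0)%N ->
  (forall n, n \in s -> be n != 0) -> {in s &, injective be} ->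
  (size P <= D0 + \sum_(n <- s) k n)%N ->
  exists (p0 : {poly K}) (c : I -> nat -> K), (size p0 <= D0)%N /\
    forall w, (forall n, n \in s -> 1 - be n * w != 0) ->
      P.[w] / \prod_(n <- s) (1 - be n * w) ^+ k n =
      p0.[w] + \sum_(n <- s) \sum_(0 <= j < k n) c n j / (1 - be n * w) ^+ j.+1.
Proof.
elim: s P => [|n s IH] P us D00 b0 binj sP.
  exists P, (fun _ _ => 0); split; first by rewrite big_nil addn0 in sP.
  by move=> w _; rewrite !big_nil divr1 addr0.
move: us => /= /andP[ns us].
have Bb : (pole_prod s).[(be n)^-1] != 0.
  rewrite horner_pole_prod prodf_seq_neq0; apply/allP => l ls /=.
  rewrite expf_neq0 // subr_eq0; apply/negP => /eqP E.
  have bn0 : be n != 0 by apply: b0; rewrite mem_head.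
  have : be n = be l by apply: (mulIf (invr_neq0 bn0)); rewrite mulfV.
  move=> /binj; rewrite mem_head inE ls orbT => /(_ isT isT) nl.
  by move: ns; rewrite nl ls.
have [|P' [c [sP' hP']]] := partial_fraction_pole (k := k n) (P := P)
  (b0 n (mem_head _ _)) Bb D00 (size_pole_prod s).
  by rewrite big_cons addnA in sP.
have [||p0 [c' [sp0 h]]] := IH P' us D00 _ _ sP'.
- by move=> l ls; apply: b0; rewrite inE ls orbT.
- by move=> l l' ls ls'; apply: binj; rewrite inE ?ls ?ls' orbT.
exists p0, (fun l => if l == n then c else c' l); split=> // w hw.
have hs l : l \in s -> 1 - be l * w != 0 by move=> ls; apply: hw; rewrite inE ls orbT.
have Bw : (pole_prod s).[w] != 0.
  rewrite horner_pole_prod prodf_seq_neq0; apply/allP => l ls /=.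
  by rewrite expf_neq0 // hs.
rewrite !big_cons -horner_pole_prod hP' ?hw ?mem_head // eqxx.
rewrite horner_pole_prod h // -addrA [X in _ = _ + X]addrC; congr (_ + (_ + _)).
apply: eq_big_seq => l ls; case: eqP => // ln; by move: ns; rewrite -ln ls.
Qed.

End PartialFractions.

(** * Rational functions with prescribed zeros and no simple poles *)

Section RationalDivisor.
Variable R : realType.
Local Notation C := (cplx R).
Variables (N : nat) (z : 'I_N -> C) (e : 'I_N -> nat).
Hypothesis z1 : forall n, modulus (z n) < 1.
Hypothesis z_inj : injective z.

Definition origin_mult : nat := \sum_(n < N | z n == 0) e n.
Definition off_origin : seq 'I_N := [seq n <- enum 'I_N | z n != 0].
Definition zero_poly : {poly C} := \prod_(n < N) ('X - (z n)%:P) ^+ e n.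

Lemma sum_off_origin (F : 'I_N -> nat) :
  (\sum_(n <- off_origin) F n = \sum_(n < N | z n != 0%R) F n)%N.
Proof. by rewrite big_filter big_enum_cond. Qed.

Lemma pole_neq0 n w : modulus w < 1 -> 1 - (z n)^* * w != 0.
Proof.
move=> w1; rewrite subr_eq0; apply/eqP => E.
have : modulus ((z n)^* * w) < 1.
  by rewrite modulusM modulus_conj mulr_ilt1 ?modulus_ge0.
by rewrite -E modulus1 ltxx.
Qed.

Lemma size_zero_poly : size zero_poly = (\sum_(n < N) e n).+1.
Proof.
rewrite /zero_poly size_prod_seq; last by move=> n _; rewrite expf_neq0 // polyXsubC_eq0.
under eq_bigr do rewrite size_exp_XsubC.
rewrite (eq_bigr (fun n => e n + 1)%N); last by move=> n _; rewrite addn1.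
by rewrite big_split /= sum1_size -addSn addnK.
Qed.

(** Prescribing the numerator [zero_poly * Q] leaves one more coefficient of [Q]
    than there are simple poles, so that all the simple poles can be removed. *)
Lemma simple_poles_removable : exists (Q p0 : {poly C}) (c : 'I_N -> nat -> C),
  [/\ Q != 0, (size p0 <= origin_mult.+1)%N & forall w, modulus w < 1 ->
    zero_poly.[w] * Q.[w] / \prod_(n <- off_origin) (1 - (z n)^* * w) ^+ (e n).+1 =
    p0.[w] + \sum_(n <- off_origin) \sum_(0 <= j < e n) c n j / (1 - (z n)^* * w) ^+ j.+2].
Proof.
pose s := off_origin; pose be n := (z n)^*.
have us : uniq s by rewrite filter_uniq // enum_uniq.
have b0 n : n \in s -> be n != 0 by rewrite mem_filter conjC_eq0 => /andP[].
have binj : {in s &, injective be} by move=> n l _ _ /(inv_inj (@conjCK _))/z_inj.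
have /choice[pp hpp] (i : 'I_(size s).+1) : exists pc : {poly C} * ('I_N -> nat -> C),
    (size pc.1 <= origin_mult.+1)%N /\ forall w, modulus w < 1 ->
    zero_poly.[w] * w ^+ i / \prod_(n <- s) (1 - be n * w) ^+ (e n).+1 =
    pc.1.[w] + \sum_(n <- s) \sum_(0 <= j < (e n).+1) pc.2 n j / (1 - be n * w) ^+ j.+1.
  have [|p0 [c [sp0 h]]] := partial_fractions (be := be) (k := fun n => (e n).+1)
    (P := zero_poly * 'X^i) us (ltn0Sn origin_mult) b0 binj.
    rewrite size_mulXn -?size_poly_eq0 ?size_zero_poly //.
    have -> : (\sum_(n <- s) (e n).+1 = \sum_(n <- s) e n + size s)%N.
      by rewrite -sum1_size -big_split /=; apply: eq_bigr => n _; rewrite addn1.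
    rewrite /s sum_off_origin (bigID (fun n => z n == 0)) /= -/(origin_mult) -/s.
    by have := ltn_ord i; rewrite ltnS; lia.
  exists (p0, c); split=> // w w1; rewrite -h; last by move=> n _; exact: pole_neq0.
  by rewrite hornerM hornerXn.
(* Row [i] holds the coefficients of the simple poles for the numerator
   [zero_poly * 'X^i]; a vector of its left kernel is a suitable [Q]. *)
pose S := \matrix_(i < (size s).+1, j < size s) (pp i).2 (tnth (in_tuple s) j) 0%N.
have : kermx S != 0.
  rewrite kermx_eq0; apply/negP => /eqP rS.
  by have := rank_leq_col S; rewrite rS ltnn.
move=> /rowV0Pn[v /sub_kermxP vS v0].
exists (\poly_(i < (size s).+1) v 0 (inord i)), (\sum_i v 0 i *: (pp i).1),
  (fun n j => \sum_i v 0 i * (pp i).2 n j.+1); split.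
- apply: contraNneq v0 => Q0; apply/eqP/rowP => i; rewrite mxE.
  have := congr1 (fun p : {poly C} => p`_i) Q0.
  by rewrite coef_poly ltn_ord inord_val coef0.
- apply: (leq_trans (size_sum _ _ _)); apply/bigmax_leqP => i _.
  by apply: leq_trans (size_scale_leq _ _) _; case: (hpp i).
move=> w w1; rewrite horner_poly mulr_sumr mulr_suml.
transitivity (\sum_(i < (size s).+1) v 0 i * ((pp i).1.[w] +
   \sum_(n <- s) \sum_(0 <= j < (e n).+1) (pp i).2 n j / (1 - be n * w) ^+ j.+1)).
  apply: eq_bigr => i _; rewrite -(hpp i).2 // inord_val.
  by rewrite mulrCA !mulrA.
under eq_bigr do rewrite mulrDr; rewrite big_split /= horner_sum; congr (_ + _).
  by apply: eq_bigr => i _; rewrite hornerZ.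
under eq_bigr do rewrite mulr_sumr; rewrite exchange_big /= -/s.
apply: eq_big_seq => n ns.
under eq_bigr do rewrite mulr_sumr; rewrite exchange_big /= big_nat_recl //=.
rewrite [X in X + _](_ : _ = 0) ?add0r; last first.
  have ks : (index n s < size s)%N by rewrite index_mem.
  have E : \sum_i v 0 i * (pp i).2 n 0%N = 0.
    transitivity ((v *m S) 0 (Ordinal ks)); last by rewrite vS mxE.
    rewrite mxE; apply: eq_bigr => i _; rewrite mxE (tnth_nth n) /= nth_index //.
  rewrite (eq_bigr (fun i => v 0 i * (pp i).2 n 0%N / (1 - be n * w) ^+ 1)).
    by rewrite -mulr_suml E mul0r.
  by move=> i _; rewrite mulrA.
apply: eq_bigr => j _; rewrite mulr_suml; apply: eq_bigr => i _.
by rewrite mulrA.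
Qed.

End RationalDivisor.

(** * The divisor for square integrable functions *)

Section HilbertDivisor.
Variable R : realType.
Local Notation C := (cplx R).
Implicit Types (a b : nat -> C) (f g h U : C -> C) (al be k w : C).

(** Analytic beyond the closed disc, which ensures a finite norm. *)
Definition overconvergent f := exists2 a, taylor f a & overconv a.

Lemma overconvergentM f g : overconvergent f -> overconvergent g ->
  overconvergent (fun w => f w * g w).
Proof.
move=> [a fa oa] [b gb ob]; exists (conv a b); first exact: taylorM.
exact: overconvM.
Qed.

Lemma overconvergentD f g : overconvergent f -> overconvergent g ->
  overconvergent (fun w => f w + g w).
Proof.
move=> [a fa oa] [b gb ob]; exists (fun n => a n + b n); first exact: taylorD.
exact: overconvD.
Qed.

Lemma overconvergent_cst k : overconvergent (fun=> k).
Proof.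
by exists (fun n => if n is 0%N then k else 0); [exact: taylor_cst|exact: overconv_cst].
Qed.

Lemma eq_overconvergent f g : (forall w, modulus w < 1 -> f w = g w) ->
  overconvergent f -> overconvergent g.
Proof. by move=> fg [a fa oa]; exists a; [exact: eq_taylor fg fa|exact: oa]. Qed.

Lemma overconvergent_poly (p : {poly C}) : overconvergent (horner p).
Proof.
elim/poly_ind: p => [|p c IH].
  by apply: eq_overconvergent (overconvergent_cst 0) => w _; rewrite horner0.
apply: (@eq_overconvergent (fun w => w * p.[w] + c)).
  by move=> w _; rewrite hornerMXaddC mulrC.
apply: overconvergentD; last exact: overconvergent_cst.
have [a pa oa] := IH.
by eexists; [exact: taylorX pa|exact: overconvX].
Qed.

Lemma overconvergentX f n : overconvergent f -> overconvergent (fun w => f w ^+ n).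
Proof.
move=> fo; elim: n => [|n IH].
  by apply: eq_overconvergent (overconvergent_cst 1) => w _; rewrite expr0.
by apply: eq_overconvergent (overconvergentM fo IH) => w _; rewrite exprS.
Qed.

Lemma overconvergent_pole be : modulus be < 1 -> overconvergent (fun w => (1 - be * w)^-1).
Proof.
move=> be1; exists (fun n => be ^+ n); last exact: overconv_geometric.
by apply: taylor_geometric; exact: ltW.
Qed.

Lemma overconvergent_prod (I : Type) (s : seq I) (F : I -> C -> C) :
  (forall i, overconvergent (F i)) -> overconvergent (fun w => \prod_(i <- s) F i w).
Proof.
move=> Fo; elim: s => [|i s IH].
  by apply: eq_overconvergent (overconvergent_cst 1) => w _; rewrite big_nil.
by apply: eq_overconvergent (overconvergentM (Fo i) IH) => w _; rewrite big_cons.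
Qed.

Variables (N : nat) (z : 'I_N -> C) (e : 'I_N -> nat).
Hypothesis z1 : forall n, modulus (z n) < 1.
Hypothesis z_inj : injective z.
Local Notation m := (origin_mult z e).
Local Notation off := (off_origin z).
Local Notation zp := (zero_poly z e).

Lemma origin_multE n : z n = 0 -> m = e n.
Proof.
move=> zn; rewrite /origin_mult (bigD1 n) ?zn ?eqxx //= big1 ?addn0 // => l.
by rewrite -zn => /andP[/eqP/z_inj ->]; rewrite eqxx.
Qed.

Lemma zero_space_low g a j : zero_space z e g a -> (j < m)%N -> a j = 0.
Proof.
move=> [ga h] jm; have [[n zn]|no] := pselect (exists n, z n = 0); last first.
  move: jm; rewrite /origin_mult big1 // => n /eqP zn; by case: no; exists n.
rewrite (origin_multE zn) in jm; have := h n j jm; rewrite zn => <-.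
have m0 : modulus (0 : C) < 1 by rewrite modulus0.
exact: (congr1 (fun s => s j) (expansion_unique (taylor_expansion0 ga) (taylor_expansion ga m0))).
Qed.

Lemma horner_zero_poly w : zp.[w] = \prod_(n < N) (w - z n) ^+ e n.
Proof.
rewrite /zero_poly horner_prod; apply: eq_bigr => n _.
by rewrite horner_exp hornerXsubC.
Qed.

Lemma zero_poly_factor U n : analytic_on_disc U ->
  exists2 u, expansion (fun w => zp.[w] * U w) (z n) (shift_seq (e n) u) &
  u 0%N = (\prod_(l < N | l != n) (z n - z l) ^+ e l) * U (z n).
Proof.
move=> UA; have : analytic_at (fun w => (\prod_(l < N | l != n) (w - z l) ^+ e l) * U w) (z n).
  apply: analyticM; last by apply: UA; exact/unit_discE.
  apply: analytic_prod => l _; apply: analyticX.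
  by apply: analyticD; [exact: analytic_id|exact: analytic_cst].
move=> /analytic_expansion[u hu]; exists u; last by rewrite -(expansion0 hu).
apply: eq_expansion (expansion_XsubC (e n) hu) => w.
by rewrite horner_zero_poly [in RHS](bigD1 n) //= mulrA.
Qed.

Lemma zero_spaceM U a : analytic_on_disc U -> taylor (fun w => zp.[w] * U w) a ->
  zero_space z e (fun w => zp.[w] * U w) a.
Proof.
move=> UA ta; apply/(zero_spaceP e z1 ta) => n.
have [u hu _] := zero_poly_factor n UA.
by apply/(expansion_vanishes _ hu) => j jn; rewrite /shift_seq jn.
Qed.

Lemma eq_zero_space f g a : (forall w, modulus w < 1 -> f w = g w) ->
  zero_space z e f a -> zero_space z e g a.
Proof. by move=> fg [fa h]; split; [exact: eq_taylor fg fa|exact: h]. Qed.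

Lemma eq_kernel f g b : (forall w, modulus w < 1 -> f w = g w) ->
  extremal_kernel z e m f b -> extremal_kernel z e m g b.
Proof. by move=> fg [fb h]; split; [exact: eq_taylor fg fb|exact: h]. Qed.

Lemma kernel_sum (I : eqType) (s : seq I) (F : I -> C -> C) :
  (forall i, i \in s -> exists b, extremal_kernel z e m (F i) b) ->
  exists b, extremal_kernel z e m (fun w => \sum_(i <- s) F i w) b.
Proof.
elim: s => [|i s IH] hF.
  exists (fun=> 0); apply: eq_kernel (kernel_cst0 z e m) => w _; by rewrite big_nil.
have [|b hb] := IH; first by move=> j js; apply: hF; rewrite inE js orbT.
have [c hc] := hF i (mem_head _ _).
exists (fun n => c n + b n); apply: eq_kernel (kernelD hc hb) => w _.
by rewrite big_cons.
Qed.

(** Both forms of the theorem at once: [m] is 0 if no [z n] is the origin. *)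
Definition principal_form f := exists (p0 : {poly C}) (c : 'I_N -> nat -> C),
  (size p0 <= m.+1)%N /\ forall w, modulus w < 1 -> f w = p0.[w] +
    \sum_(n <- off) \sum_(0 <= j < e n) c n j / (1 - (z n)^* * w) ^+ j.+2.

(** Poles of order between 2 and [e n + 1] pair with the derivatives of order below
    [e n], monomials with single Taylor coefficients. *)
Lemma principal_form_kernel f : principal_form f -> exists b, extremal_kernel z e m f b.
Proof.
move=> [p0 [c [sp0 fE]]].
have [b hb] : exists b, extremal_kernel z e m (fun w => \sum_(i <- iota 0 m.+1) p0`_i * w ^+ i) b.
  apply: kernel_sum => i; rewrite mem_iota ltnS => /andP[_ im].
  eexists; apply: kernelZ; apply: kernel_monomial => //.
  by move=> g a j; exact: zero_space_low.
have [b' hb'] : exists b, extremal_kernel z e m (fun w => \sum_(n <- off)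
    \sum_(j <- iota 0 (e n)) c n j * ((1 - (z n)^* * w) ^+ j.+2)^-1) b.
  apply: kernel_sum => n _; apply: kernel_sum => j; rewrite mem_iota => /andP[_ jn].
  by eexists; apply: kernelZ; apply: kernel_pole.
exists (fun n => b n + b' n); apply: eq_kernel (kernelD hb hb') => w w1.
rewrite fE // (horner_coef_wide _ sp0) -(big_mkord predT (fun i => p0`_i * w ^+ i)).
by rewrite /index_iota subn0; congr (_ + _); apply: eq_bigr => n _; rewrite subn0.
Qed.

Lemma poly_disc_neq0 (p : {poly C}) : p != 0 -> exists2 w, modulus w < 1 & p.[w] != 0.
Proof.
move=> p0; apply: contrapT => no.
pose rs := [seq (i.+2%:R : C)^-1 | i <- iota 0 (size p)].
have : all (root p) rs.
  apply/allP => _ /mapP[i _ ->]; apply/negPn/negP => ri; apply: no.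
  exists (i.+2%:R)^-1 => //; rewrite modulusV modulus_nat.
  by rewrite invf_lt1 ?ltr0n // ltr1n.
move=> /(max_poly_roots p0); rewrite size_map size_iota ltnn.
suff u : uniq rs by move=> /(_ u).
rewrite map_inj_uniq ?iota_uniq // => i j /invr_inj/eqP.
by rewrite eqr_nat => /eqP[].
Qed.

(** The function provided by [simple_poles_removable] is a kernel and has the given
    zeros; by [no_extra_zero], [Q] has no root in the disc. *)
Lemma hilbert_divisor : exists (Q : {poly C}) (b : nat -> C),
  let f w := zp.[w] * (Q.[w] / \prod_(n <- off) (1 - (z n)^* * w) ^+ (e n).+1) in
  [/\ Q != 0, forall w, root Q w -> 1 <= modulus w, principal_form f &
   [/\ zero_space z e f b, extremal_kernel z e m f b, overconv b & b m != 0]].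
Proof.
have [Q [p0 [c [Q0 sp0 fE]]]] := simple_poles_removable e z1 z_inj.
pose D w := \prod_(n <- off) (1 - (z n)^* * w) ^+ (e n).+1.
have Do : overconvergent (fun w => (D w)^-1).
  apply: (@eq_overconvergent (fun w => \prod_(n <- off) ((1 - (z n)^* * w)^-1) ^+ (e n).+1)).
    by move=> w _; rewrite /D -prodfV; apply: eq_bigr => n _; rewrite exprVn.
  apply: overconvergent_prod => n; apply: overconvergentX; apply: overconvergent_pole.
  by rewrite modulus_conj.
have D0 w : modulus w < 1 -> D w != 0.
  move=> w1; rewrite prodf_seq_neq0; apply/allP => n _ /=.
  by rewrite expf_neq0 // pole_neq0.
pose f w := zp.[w] * (Q.[w] / D w).
have pf : principal_form f.
  by exists p0, c; split=> // w w1; rewrite -fE // /f -mulrA.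
have [b kb] := principal_form_kernel pf.
have Uo (q : {poly C}) : overconvergent (fun w => q.[w] / D w).
  exact: overconvergentM (overconvergent_poly q) Do.
have Ua (q : {poly C}) : analytic_on_disc (fun w => q.[w] / D w).
  by have [u hu _] := Uo q; exact: taylor_analytic hu.
have zb : zero_space z e f b by apply: zero_spaceM => //; exact: kb.1.
have ob : overconv b.
  have [b' fb' ob'] := overconvergentM (overconvergent_poly zp) (Uo Q).
  by rewrite (taylor_unique kb.1 fb').
have zp0 : zp != 0 by rewrite -size_poly_eq0 size_zero_poly.
have bm : b m != 0.
  apply/negP => /eqP bm; have [w w1] := poly_disc_neq0 (mulf_neq0 zp0 Q0).
  have /eqP := kernel_nonzero kb zb bm w1.
  rewrite /f mulrA mulf_eq0 invr_eq0 (negPf (D0 w w1)) orbF -hornerM => /eqP ->.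
  by rewrite eqxx.
exists Q, b; split=> // al; rewrite leNgt; move=> /factor_theorem[Q' QE].
apply/negP => al1; set x := modulus al ^+ 2.
have x1 : x < 1 by rewrite /x expr2 mulr_ilt1 ?modulus_ge0.
have x0 : 0 <= x by exact: sqr_ge0.
have x2 : ofreal (2 - x) != 0 :> C.
  by rewrite ofreal_eq0 gt_eqF //; lra.
pose ga := al^* / ofreal (2 - x).
have ga1 : modulus ga < 1.
  rewrite modulusM modulusV modulus_conj modulus_ofreal; last by lra.
  by rewrite ltr_pdivrMr; lra.
have ga0 w : modulus w < 1 -> 1 - ga * w != 0.
  move=> w1; rewrite subr_eq0; apply/eqP => E; have : modulus (ga * w) < 1.
    by rewrite modulusM mulr_ilt1 ?modulus_ge0.
  by rewrite -E modulus1 ltxx.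
(* The quotient of [Q / D] by the numerator of the one-point divisor at [al], whose
   second factor [2 - x - al^* w] equals [(2 - x) (1 - ga w)]. *)
pose V w := (- (ofreal (2 - x))^-1) * ((Q'.[w] / D w) * (1 - ga * w)^-1).
have Vo : overconvergent V.
  apply: overconvergentM; first exact: overconvergent_cst.
  by apply: overconvergentM; [exact: Uo|exact: overconvergent_pole].
have Va : analytic_on_disc V by have [u hu _] := Vo; exact: taylor_analytic hu.
have [hc hh oh] := overconvergentM (overconvergent_poly zp) Vo.
apply: (no_extra_zero kb zb bm al1 hh oh).
- by move=> j jm; apply: (zero_space_low (zero_spaceM Va hh)).
- have ho : overconvergent (fun w => (1 - al^* * w) ^+ 2 * V w).
    apply: overconvergentM Vo; apply: overconvergentX.
    apply: (@eq_overconvergent (horner (1 - al^* *: 'X))); last exact: overconvergent_poly.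
    by move=> w _; rewrite horner_pole.
  have hoA : analytic_on_disc (fun w => (1 - al^* * w) ^+ 2 * V w).
    by have [u hu _] := ho; exact: taylor_analytic hu.
  have t := taylor_div_den (al := al) hh.
  apply: (@eq_zero_space (fun w => zp.[w] * ((1 - al^* * w) ^+ 2 * V w))).
    by move=> w _; rewrite mulrCA.
  apply: (zero_spaceM hoA); apply: eq_taylor t => w _; by rewrite mulrCA.
- move=> w w1; rewrite /f /V QE hornerM hornerXsubC -/x.
  have -> : ofreal (2 - x) - al^* * w = ofreal (2 - x) * (1 - ga * w).
    by rewrite mulrBr mulr1 /ga; congr (_ - _); rewrite mulrA (mulrC _ (al^* / _)) divfK.
  have := ga0 w w1; have := D0 w w1; move: x2.
  move: (D w) (1 - ga * w) (ofreal (2 - x)) (Q'.[w]) (zp.[w]) => d g o q y o0 d0 g0.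
  by field; rewrite o0 d0 g0.
Qed.

End HilbertDivisor.

(** * Powers of analytic functions *)

Section PowerRoots.
Variable R : realType.
Local Notation C := (cplx R).
Implicit Types (a b : nat -> C) (f g U : C -> C) (be k w s t : C).
Variable q : nat.
Hypothesis q0 : (0 < q)%N.

(** The coefficients of [(1 - w)^t]. *)
Fixpoint binomial_seq t n : C :=
  if n is n'.+1 then binomial_seq t n' * (n'%:R - t) / n'.+1%:R else 1.

Lemma binomial_seqS t n : n.+1%:R * binomial_seq t n.+1 = (n%:R - t) * binomial_seq t n.
Proof. by rewrite /= mulrC divfK ?pnatr_eq0 // mulrC. Qed.

(** Vandermonde's identity for arbitrary exponents: both sides satisfy the recursion
    [binomial_seqS] for the exponent [s + t]. *)
Lemma conv_binomial s t : conv (binomial_seq s) (binomial_seq t) = binomial_seq (s + t).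
Proof.
apply/funext; elim=> [|n IH]; first by rewrite /conv big_nat1 /= mulr1.
have n0 : (n.+1%:R : C) != 0 by rewrite pnatr_eq0.
apply: (mulfI n0); rewrite binomial_seqS -IH.
have -> : n.+1%:R * conv (binomial_seq s) (binomial_seq t) n.+1 =
    (\sum_(0 <= i < n.+2) i%:R * binomial_seq s i * binomial_seq t (n.+1 - i)) +
    (\sum_(0 <= i < n.+2) binomial_seq s i * ((n.+1 - i)%:R * binomial_seq t (n.+1 - i))).
  rewrite /conv mulr_sumr -big_split /=; apply: eq_big_nat => i /andP[_]; rewrite ltnS => iN.
  have -> : (n.+1%:R : C) = i%:R + (n.+1 - i)%:R by rewrite -natrD subnKC.
  by move: (i%:R : C) ((n.+1 - i)%:R : C) => *; ring.
rewrite big_nat_recl //= !mul0r add0r [X in _ + X]big_nat_recr //= subnn mul0r mulr0 addr0.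
rewrite -big_split /= /conv mulr_sumr; apply: eq_big_nat => i /andP[_]; rewrite ltnS => iN.
rewrite -/(binomial_seq s i.+1) subSS subSn // binomial_seqS -/(binomial_seq t (n - i).+1).
rewrite [(n - i).+1%:R * _]binomial_seqS.
have -> : (n%:R : C) = i%:R + (n - i)%:R by rewrite -natrD subnKC.
by move: (i%:R : C) ((n - i)%:R : C) => *; ring.
Qed.

Lemma modulus_binomial_seq t n : modulus t <= 1 -> modulus (binomial_seq t n) <= 1.
Proof.
move=> t1; elim: n => [|n IH]; first by rewrite /= modulus1.
rewrite /= !modulusM modulusV modulus_nat ler_pdivrMr ?ltr0n // mul1r.
rewrite -[leRHS]mul1r; apply: ler_pM; rewrite ?modulus_ge0 //.
apply: le_trans (ler_modulusD _ _) _; rewrite modulusN modulus_nat.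
by rewrite -natr1 lerD2l.
Qed.

(** The root is the binomial series with exponent [1 / q]; its [k]-th power is the one
    with exponent [k / q]. *)
Lemma exists_linear_root be : modulus be <= 1 ->
  exists2 g, analytic_on_disc g & forall w, modulus w < 1 -> g w ^+ q = 1 - be * w.
Proof.
move=> be1; pose r (k : nat) n : C := binomial_seq (k%:R / q%:R) n * be ^+ n.
have bound : coef_bound (r 1%N) 1 1.
  move=> n; rewrite expr1n mulr1 modulusM modulusX.
  rewrite mulr_ile1 ?modulus_ge0 ?exprn_ge0 ?modulus_ge0 //.
    apply: modulus_binomial_seq; rewrite mul1r modulusV modulus_nat.
    by rewrite invf_le1 ?ltr0n // ler1n.
  by rewrite exprn_ile1 // modulus_ge0.
pose g w := limn (series (fun k : nat => r 1%N k * w ^+ k)).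
have tg : taylor g (r 1%N).
  by move=> w w1; have [S hS] := psum_exists bound w1; apply/cvg_ex; exists S.
have tgk (k : nat) : taylor (fun w => g w ^+ k) (r k).
  elim: k => [|k IH].
    apply: eq_taylor_seq (eq_taylor _ (@taylor_cst R 1)) => [n|w _]; last by rewrite expr0.
    rewrite /r mul0r; case: n => [|n]; first by rewrite /= mulr1.
    suff -> : binomial_seq 0 n.+1 = 0 by rewrite mul0r.
    elim: n => [|n IH]; first by rewrite /= subrr mulr0 mul0r.
    by rewrite -[LHS]/(binomial_seq 0 n.+1 * _ / _) IH !mul0r.
  apply: eq_taylor_seq (eq_taylor _ (taylorM tg IH)) => [n|w _]; last by rewrite exprS.
  rewrite /r; have -> : (k.+1%:R / q%:R : C) = 1%:R / q%:R + k%:R / q%:R by rewrite -mulrDl nat1r.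
  rewrite -conv_binomial /conv mulr_suml.
  apply: eq_big_nat => i /andP[_ iN]; rewrite mulrACA -exprD subnKC //.
exists g; first exact: taylor_analytic tg.
move=> w w1; have h := tgk q w w1; apply: (psum_unique h).
have := taylorD (@taylor_cst R 1) (taylorZ (k := - be) (taylorX (@taylor_cst R 1))).
move=> /(_ w w1); rewrite mulr1 mulNr; congr psum.
have qq : (q%:R / q%:R : C) = 1 by rewrite divff // pnatr_eq0 -lt0n.
apply/funext => -[|n]; first by rewrite /r /= mulr0 addr0 mulr1.
rewrite /r qq; case: n => [|n].
  by rewrite /= mul1r sub0r divr1 mulr1 mulN1r add0r expr1.
rewrite mulr0 addr0; suff -> : binomial_seq 1 n.+2 = 0 by rewrite mul0r.
elim: n => [|n IH]; first by rewrite /= subrr mulr0 mul0r.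
by rewrite -[LHS]/(binomial_seq 1 n.+2 * _ / _) IH !mul0r.
Qed.

Definition is_power f := exists2 g, analytic_on_disc g &
  forall w, modulus w < 1 -> f w = g w ^+ q.

Lemma eq_is_power f g : (forall w, modulus w < 1 -> f w = g w) -> is_power f -> is_power g.
Proof. by move=> fg [h hA fh]; exists h => // w w1; rewrite -fg // fh. Qed.

Lemma is_powerM f g : is_power f -> is_power g -> is_power (fun w => f w * g w).
Proof.
move=> [h hA fh] [l lA gl]; exists (fun w => h w * l w).
  by move=> w w1; apply: analyticM; [exact: hA|exact: lA].
by move=> w w1; rewrite fh // gl // exprMn.
Qed.

Lemma is_powerX f d : is_power f -> is_power (fun w => f w ^+ d).
Proof.
move=> [h hA fh]; exists (fun w => h w ^+ d).
  by move=> w w1; apply: analyticX; exact: hA.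
by move=> w w1; rewrite fh // exprAC.
Qed.

Lemma is_power_pow f d : analytic_on_disc f -> is_power (fun w => f w ^+ (q * d)).
Proof.
move=> fA; exists (fun w => f w ^+ d).
  by move=> w w1; apply: analyticX; exact: fA.
by move=> w w1; rewrite -exprM mulnC.
Qed.

Lemma is_power_cst k : is_power (fun=> k).
Proof.
exists (fun=> q.-root k); first by move=> w _; exact: analytic_cst.
by move=> w _; rewrite rootCK.
Qed.

Lemma is_power_prod (I : Type) (r : seq I) (F : I -> C -> C) :
  (forall i, is_power (F i)) -> is_power (fun w => \prod_(i <- r) F i w).
Proof.
move=> FP; elim: r => [|i r IH].
  by apply: eq_is_power (is_power_cst 1) => w _; rewrite big_nil.
by apply: eq_is_power (is_powerM (FP i) IH) => w _; rewrite big_cons.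
Qed.

Lemma is_power_linear be : modulus be <= 1 -> is_power (fun w => 1 - be * w).
Proof. by move=> /exists_linear_root[g gA gE]; exists g => // w w1; rewrite gE. Qed.

Lemma is_power_sub al : 1 <= modulus al -> is_power (fun w => w - al).
Proof.
move=> al1; have al0 : al != 0 by rewrite -modulus_gt0 (lt_le_trans _ al1).
apply: (@eq_is_power (fun w => - al * (1 - al^-1 * w))).
  by move=> w _; rewrite mulrBr mulr1 mulNr mulVKf // opprK addrC.
apply: is_powerM; first exact: is_power_cst.
apply: is_power_linear; rewrite modulusV invf_le1 //.
by rewrite modulus_gt0.
Qed.

Lemma is_power_pole be : modulus be < 1 -> is_power (fun w => (1 - be * w)^-1).
Proof.
move=> be1; have [g gA gE] := exists_linear_root (ltW be1).
exists (fun w => (1 - be * w)^-1 * g w ^+ q.-1).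
  move=> w w1; apply: analyticM; last by apply: analyticX; exact: gA.
  exact: (taylor_analytic (taylor_geometric (ltW be1))).
move=> w w1; rewrite exprMn -exprM mulnC exprM gE //.
have n0 : 1 - be * w != 0.
  rewrite subr_eq0; apply/eqP => E; have : modulus (be * w) < 1.
    by rewrite modulusM mulr_ilt1 ?modulus_ge0.
  by rewrite -E modulus1 ltxx.
by rewrite -[in X in _ = X * _](prednK q0) exprS exprVn mulfVK // expf_neq0.
Qed.

(** The product of the lowest nonzero coefficients is a coefficient of the product. *)
Lemma taylor_mul_eq0 f g a b : taylor f a -> taylor g b ->
  (forall w, modulus w < 1 -> f w * g w = 0) ->
  (forall w, modulus w < 1 -> f w = 0) \/ (forall w, modulus w < 1 -> g w = 0).
Proof.
move=> fa gb fg0.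
have zero (h : C -> C) c : taylor h c -> (forall n, c n = 0) -> forall w, modulus w < 1 -> h w = 0.
  move=> hc c0 w w1; apply: (psum_unique (hc w w1)).
  have -> : c = fun n => if n is 0%N then 0 else 0 by apply/funext => -[|n]; rewrite c0.
  exact: psum_cst.
have [[i ai]|na] := pselect (exists i, a i != 0); last first.
  left; apply: (zero f a fa) => n; apply/eqP/negPn/negP => an; by apply: na; exists n.
have [[j bj]|nb] := pselect (exists j, b j != 0); last first.
  right; apply: (zero g b gb) => n; apply/eqP/negPn/negP => bn; by apply: nb; exists n.
have ab0 : conv a b = fun n => if n is 0%N then 0 else 0.
  apply: (taylor_unique (taylorM fa gb)); apply: eq_taylor (@taylor_cst R 0) => w w1.
  by rewrite fg0.
have := ex_minnP (ex_intro (fun i => a i != 0) i ai); case=> k ak kmin.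
have := ex_minnP (ex_intro (fun i => b i != 0) j bj); case=> l bl lmin.
have [||_] := @conv_low R a b k l _ _.
- by move=> n nk; apply/eqP/negPn/negP => /kmin; rewrite leqNgt nk.
- by move=> n nk; apply/eqP/negPn/negP => /lmin; rewrite leqNgt nk.
rewrite ab0 => /esym/eqP; case: (k + l)%N => [|?];
  by rewrite mulf_eq0 (negPf ak) (negPf bl).
Qed.

(** [f^q - g^q] is the product of [f - ze * g] over the [q]-th roots of unity [ze], and
    one of the factors vanishes identically by [taylor_mul_eq0]. *)
Lemma pow_eq_proportional f g : analytic_on_disc f -> analytic_on_disc g ->
  (forall w, modulus w < 1 -> f w ^+ q = g w ^+ q) ->
  exists2 ze, ze ^+ q = 1 & forall w, modulus w < 1 -> f w = ze * g w.
Proof.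
move=> fA gA fg; have [a fa] := analytic_taylor fA; have [b gb] := analytic_taylor gA.
have [rs rsE] := closed_field_poly_normal ('X^q - 1 : {poly C}).
have lc : lead_coef ('X^q - 1 : {poly C}) = 1 by rewrite -[1 in LHS](polyC1 C) lead_coefXnsubC.
rewrite lc scale1r in rsE.
have rsP ze : (ze \in rs) = (ze ^+ q == 1).
  by rewrite -root_prod_XsubC -rsE /root !hornerE subr_eq0.
have H (r : seq C) : (forall w, modulus w < 1 -> \prod_(ze <- r) (f w - ze * g w) = 0) ->
    exists2 ze, ze \in r & forall w, modulus w < 1 -> f w - ze * g w = 0.
  elim: r => [|ze r IH] h.
    have := h 0; rewrite modulus0 big_nil ltr01 => /(_ isT)/eqP; by rewrite oner_eq0.
  have tz y : taylor (fun w => f w - y * g w) (fun n => a n + - y * b n).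
    apply: eq_taylor (taylorD fa (taylorZ (k := - y) gb)) => w _; by rewrite mulNr.
  have [c tc] : exists c, taylor (fun w => \prod_(y <- r) (f w - y * g w)) c.
    apply: analytic_taylor => w w1; apply: analytic_prod => y _.
    exact: (taylor_analytic (tz y)).
  have h' w : modulus w < 1 -> (f w - ze * g w) * \prod_(y <- r) (f w - y * g w) = 0.
    by move=> w1; have := h w w1; rewrite big_cons.
  have [h1|h1] := taylor_mul_eq0 (tz ze) tc h'.
    by exists ze; [exact: mem_head|].
  by have [y yr hy] := IH h1; exists y => //; rewrite inE yr orbT.
have [w w1|ze zr hz] := H rs; last first.
  exists ze; first by apply/eqP; rewrite -rsP.
  by move=> w w1; apply/eqP; rewrite -subr_eq0 hz.
apply/eqP; rewrite prodf_seq_eq0; apply/hasP.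
have [g0|g0] := eqVneq (g w) 0.
  exists 1; first by rewrite rsP expr1n.
  have := fg w w1; rewrite g0 expr0n gtn_eqF //= => /eqP; rewrite expf_eq0 q0 /= => /eqP ->.
  by rewrite mulr0 subr0.
exists (f w / g w); last by rewrite /= divfK // subrr.
by rewrite rsP expr_div_n fg // divff // expf_neq0.
Qed.

(** If [f] vanished at [c] to an order [l < d] only, the coefficient of [f^q] of index
    [q * l < q * d] would be nonzero. *)
Lemma power_vanishes f c a b d : expansion f c a -> expansion (fun w => f w ^+ q) c b ->
  (forall j, (j < q * d)%N -> b j = 0) -> forall j, (j < d)%N -> a j = 0.
Proof.
move=> fa fb hb; have H l : (l <= d)%N -> forall j, (j < l)%N -> a j = 0.
  elim: l => // l IH ld j; rewrite ltnS leq_eqVlt => /orP[/eqP ->|]; last first.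
    by apply: IH; exact: ltnW.
  have [b' [fb' _ bl]] := expansionX_low q fa (IH (ltnW ld)).
  have bb : b' = b := expansion_unique fb' fb.
  move: bl; rewrite bb hb ?ltn_pmul2l // => /esym/eqP.
  by rewrite expf_eq0 q0 /= => /eqP.
exact: H (leqnn d).
Qed.

End PowerRoots.

(** * The Bergman norm in terms of Taylor coefficients *)

Section BergmanNorm.
Variable R : realType.
Local Notation C := (cplx R).
Local Notation mu := (@lebesgue_measure R).
Local Notation area := (mu \x mu)%E.
Implicit Types (a b : nat -> C) (f g : C -> C) (A : R).
Variable q : nat.
Hypothesis q0 : (0 < q)%N.
Local Notation p := ((q * 2)%:R : R).

(** The measure of the unit disc under [sigma], a common factor of all mean squares. *)
Definition disc_mass : R := (pi : R)^-1 * disc_area 1.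

Lemma disc_mass_gt0 : 0 < disc_mass.
Proof. by rewrite mulr_gt0 ?invr_gt0 ?pi_gt0 // disc_area_gt0. Qed.

Lemma plane_discE : @plane_disc R = disc (1 : R).
Proof.
apply/predeqP => u; rewrite /plane_disc /preimage /mkset.
by rewrite unit_discE (affix_disc _ ler01).
Qed.

Lemma bergman_normE f a : taylor (fun w => f w ^+ q) a ->
  bergman_norm p f = (((pi : R)^-1%:E *
    \int[area]_(u in disc (1 : R)) (modulus (f (affix u) ^+ q) ^+ 2)%:E) `^ p^-1)%E.
Proof.
move=> fa; rewrite /bergman_norm plane_discE; congr (_ `^ _)%E.
rewrite (eq_integral (fun u => (modulus (f (affix u) ^+ q) ^+ 2)%:E)); last first.
  move=> u _; congr EFin.
  by rewrite powR_mulrn ?modulusX -?exprM //; exact: modulus_ge0.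
rewrite /sigma ge0_integral_mscale //.
- exact: measurable_disc.
- by apply: (measurable_taylor fa); rewrite ler01 lexx.
- by move=> u _; rewrite lee_fin sqr_ge0.
Qed.

Lemma bergman_norm_sq f a A : taylor (fun w => f w ^+ q) a -> sq a @ \oo --> A ->
  bergman_norm p f = ((disc_mass * A) `^ p^-1)%:E.
Proof.
move=> fa aA; rewrite (bergman_normE fa) (parseval fa (S := A)); last by rewrite wnorm1.
by rewrite -EFinM mulrA poweR_EFin.
Qed.

Lemma bergman_norm_eq1 f a A : taylor (fun w => f w ^+ q) a -> sq a @ \oo --> A ->
  bergman_norm p f = 1%E <-> A = disc_mass^-1.
Proof.
move=> fa aA; rewrite (bergman_norm_sq fa aA); have c0 := disc_mass_gt0.
have p0 : p != 0 by rewrite pnatr_eq0 -lt0n muln_gt0 q0.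
split=> [[h]|->]; last by rewrite mulfV ?gt_eqF // powR1.
have : disc_mass * A = 1.
  have x0 : 0 <= disc_mass * A by rewrite mulr_ge0 ?(ltW c0) // (sq_ge0 aA).
  by rewrite -[LHS](powRr1 x0) -[X in _ `^ X](mulVf p0) powRrM h powR1.
by move=> h1; apply: (mulfI (lt0r_neq0 c0)); rewrite h1 mulfV // gt_eqF.
Qed.

Lemma bergman_norm_lty f a A : taylor (fun w => f w ^+ q) a -> sq a @ \oo --> A ->
  (bergman_norm p f < +oo)%E.
Proof. by move=> fa aA; rewrite (bergman_norm_sq fa aA) ltry. Qed.

Lemma bergman_space_sq f : bergman_space p f -> exists a, taylor (fun w => f w ^+ q) a /\
  exists A : R, sq a @ \oo --> A.
Proof.
move=> [fA fn]; have [a fa] : exists a, taylor (fun w => f w ^+ q) a.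
  by apply: analytic_taylor => w w1; apply: analyticX; exact: fA.
exists a; split; first exact: fa.
rewrite -wnorm1; apply: (parseval_finite fa).
have p0 : p^-1 != 0 by rewrite invr_eq0 pnatr_eq0 -lt0n muln_gt0 q0.
rewrite (bergman_normE fa) in fn; have := lty_poweRy p0 fn.
set I := (\int[area]_(u in _) _)%E.
have I0 : (0 <= I)%E by apply: integral_ge0 => u _; rewrite lee_fin sqr_ge0.
have pi0 : 0 < (pi : R)^-1 by rewrite invr_gt0 pi_gt0.
by case: I I0 => [r||] // _; rewrite ?ltry // mulry gtr0_sg // mul1e ltxx.
Qed.

End BergmanNorm.

(** * Existence of the divisor *)

Section CanonicalDivisor.
Variable R : realType.
Local Notation C := (cplx R).
Implicit Types (a b : nat -> C) (f g G H : C -> C) (A : R).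
Variables (q : nat) (N : nat) (z : 'I_N -> C) (d : 'I_N -> nat).
Hypothesis q0 : (0 < q)%N.
Hypothesis z1 : forall n, modulus (z n) < 1.
Hypothesis z_inj : injective z.
Local Notation p := ((q * 2)%:R : R).
Local Notation e := (fun n => q * d n)%N.
Local Notation m := (origin_mult z e).
Local Notation mu := (finite_zero_set z d).
Local Notation c0 := (disc_mass R).

Lemma finite_zero_setE n : mu (z n) = d n.
Proof.
rewrite /finite_zero_set (bigD1 n) //= big1 ?addn0 // => l.
by move=> /andP[/eqP/z_inj ->]; rewrite eqxx.
Qed.

Lemma finite_zero_set_out (a : C) : (forall n, z n <> a) -> mu a = 0%N.
Proof. by move=> za; rewrite /finite_zero_set big1 // => n /eqP/za. Qed.

Lemma origin_mult_mu : m = (q * mu 0)%N.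
Proof. by rewrite /origin_mult /finite_zero_set big_distrr. Qed.

Lemma sqZ (k : C) a A : sq a @ \oo --> A -> sq (fun n => k * a n) @ \oo --> modulus k ^+ 2 * A.
Proof.
move=> aA; rewrite (_ : sq _ = fun n => modulus k ^+ 2 * sq a n); first exact: cvgMr.
apply/funext => n; rewrite /sq mulr_sumr; apply: eq_bigr => i _.
by rewrite modulusM exprMn mulrA.
Qed.

Lemma zero_spaceZ (k : C) f a : zero_space z e f a ->
  zero_space z e (fun w => k * f w) (fun n => k * a n).
Proof.
move=> [fa h]; have t := taylorZ (k := k) fa.
apply/(zero_spaceP e z1 t) => n; have fn := (zero_spaceP e z1 fa).1 (conj fa h) n.
have fl := taylor_expansion fa (z1 n).
apply/(expansion_vanishes _ (expansionM (expansion_cst k (z n)) fl)) => j jn.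
rewrite /conv big_nat_recl //= subn0 ((expansion_vanishes _ fl).1 fn) // mulr0 add0r.
by rewrite big1 // => i _; rewrite mul0r.
Qed.

Lemma zero_spaceD f g a b : zero_space z e f a -> zero_space z e g b ->
  zero_space z e (fun w => f w + g w) (fun n => a n + b n).
Proof.
move=> [fa h] [gb h']; have t := taylorD fa gb.
apply/(zero_spaceP e z1 t) => n.
apply/(expansion_vanishes _ (expansionD (taylor_expansion fa (z1 n))
  (taylor_expansion gb (z1 n)))) => j jn.
by rewrite h // h' // addr0.
Qed.

Lemma power_zero_space f a : analytic_on_disc f ->
  (forall n, vanishes_to_order f (z n) (d n)) -> taylor (fun w => f w ^+ q) a ->
  zero_space z e (fun w => f w ^+ q) a.
Proof.
move=> fA fv fa; apply/(zero_spaceP e z1 fa) => n.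
have [b fb] := (analytic_expansion f (z n)).1 (fA _ ((unit_discE _).2 (z1 n))).
have [b' [fb' low _]] := expansionX_low q fb ((expansion_vanishes _ fb).1 (fv n)).
by apply/(expansion_vanishes _ fb').
Qed.

(** What the Hilbert space case gives: an analytic [q]-th root of the normalized
    divisor for the [q]-fold multiplicities.  The positive number [s] is the Taylor
    coefficient of [G] whose index is its order of vanishing at 0. *)
Record divisor_data G b (s : R) : Prop := DivisorData {
  data_analytic : analytic_on_disc G;
  data_taylor : taylor (fun w => G w ^+ q) b;
  data_norm : sq b @ \oo --> c0^-1;
  data_vanishes : forall n, vanishes_to_order G (z n) (d n);
  data_kernel : extremal_kernel z e m (fun w => G w ^+ q) b;
  data_form : principal_form z e (fun w => G w ^+ q);
  data_order : forall n, has_zero_of_order (fun w => G w ^+ q) (z n) (e n);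
  data_pos : 0 < s;
  data_lead : b m = ofreal (s ^+ q);
  data_derive : derive1n (mu 0) G 0 = (mu 0)`!%:R * ofreal s }.

(** The function of [hilbert_divisor] is a [q]-th power factor by factor: the zeros
    have multiplicities divisible by [q], and each other factor is [w - be] with
    [|be| >= 1] or the inverse of [1 - (z n)^* w]. *)
Lemma divisor_exists : exists G b s, divisor_data G b s.
Proof.
have [Q [b [Q0 Qroots pf [zb kb ob bm]]]] := hilbert_divisor e z1 z_inj.
set F : C -> C := fun w => (zero_poly z e).[w] *
  (Q.[w] / \prod_(n <- off_origin z) (1 - (z n)^* * w) ^+ (e n).+1) in pf zb kb.
have [A cA] := sq_overconv ob.
have D0 w : modulus w < 1 -> \prod_(n <- off_origin z) (1 - (z n)^* * w) ^+ (e n).+1 != 0.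
  by move=> w1; rewrite prodf_seq_neq0; apply/allP => n _ /=; rewrite expf_neq0 // pole_neq0.
have [rs rsE] := closed_field_poly_normal Q.
have rs1 be : be \in rs -> 1 <= modulus be.
  move=> br; apply: Qroots; rewrite rsE rootZ ?lead_coef_eq0 //.
  by rewrite root_prod_XsubC.
have [g gA gE] : is_power q F.
  apply: is_powerM.
    apply: (@eq_is_power _ _ (fun w => \prod_(n < N) (w - z n) ^+ e n)).
      by move=> w _; rewrite horner_zero_poly.
    apply: is_power_prod => // n; apply: (@is_power_pow _ q (fun w => w - z n) (d n)) => w _.
    by apply: analyticD; [exact: analytic_id|exact: analytic_cst].
  apply: is_powerM.
    apply: (@eq_is_power _ _ (fun w => lead_coef Q * \prod_(be <- rs) (w - be))).
      by move=> w _; rewrite [in RHS]rsE hornerZ horner_prod; congr (_ * _);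
        apply: eq_bigr => be _; rewrite hornerXsubC.
    apply: is_powerM; first exact: is_power_cst.
    elim: rs rs1 {rsE} => [|be rs IH] rs1.
      by apply: eq_is_power (is_power_cst q0 1) => w _; rewrite big_nil.
    apply: (@eq_is_power _ _ (fun w => (w - be) * \prod_(be <- rs) (w - be))).
      by move=> w _; rewrite big_cons.
    apply: is_powerM; first by apply: is_power_sub => //; apply: rs1; exact: mem_head.
    by apply: IH => ga gr; apply: rs1; rewrite inE gr orbT.
  apply: (@eq_is_power _ _ (fun w => \prod_(n <- off_origin z) ((1 - (z n)^* * w)^-1) ^+ (e n).+1)).
    by move=> w _; rewrite -prodfV; apply: eq_bigr => n _; rewrite exprVn.
  apply: is_power_prod => // n; apply: is_powerX; apply: is_power_pole => //.
  by rewrite modulus_conj.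
have tg : taylor (fun w => g w ^+ q) b by apply: eq_taylor zb.1 => w w1; rewrite gE.
have [ga tga] := analytic_taylor gA.
have gv n : vanishes_to_order g (z n) (d n).
  have gl := taylor_expansion tga (z1 n); apply/(expansion_vanishes _ gl).
  apply: (power_vanishes q0 gl (taylor_expansion tg (z1 n))) => j jn.
  exact: zb.2.
have glow j : (j < mu 0)%N -> ga j = 0.
  apply: (power_vanishes q0 (taylor_expansion0 tga) (taylor_expansion0 tg)) => i.
  by rewrite -origin_mult_mu; exact: (zero_space_low z_inj zb).
have bmE : b m = ga (mu 0) ^+ q.
  have [b' [fb' _]] := expansionX_low q (taylor_expansion0 tga) glow.
  by rewrite (expansion_unique fb' (taylor_expansion0 tg)) -origin_mult_mu.
have gm : ga (mu 0) != 0 by apply: contraNneq bm => h; rewrite bmE h expr0n gtn_eqF.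
have A0 : 0 < A.
  rewrite lt_def (sq_ge0 cA) andbT; apply: contraNneq bm => A0.
  by rewrite A0 in cA; apply/eqP; exact: sq_eq0 cA.
have c00 := disc_mass_gt0 R.
have cA0 : 0 < (c0 * A)^-1 by rewrite invr_gt0 mulr_gt0.
(* A factor of modulus [t] normalizes the Bergman norm; the argument of [k] makes the
   leading coefficient positive. *)
pose t := (c0 * A)^-1 `^ p^-1.
have t0 : 0 < t by exact: powR_gt0.
have tE : t ^+ (q * 2) = (c0 * A)^-1.
  rewrite -powR_mulrn ?ltW // -powRrM mulVf ?powRr1 ?ltW //.
  by rewrite pnatr_eq0 -lt0n muln_gt0 q0.
have mg : 0 < modulus (ga (mu 0)) by rewrite modulus_gt0.
pose k := ofreal (t / modulus (ga (mu 0))) * (ga (mu 0))^*.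
have kE : modulus k = t.
  rewrite modulusM modulus_conj modulus_ofreal ?divfK ?gt_eqF //.
  by rewrite divr_ge0 // ltW.
have k0 : k != 0 by rewrite -modulus_gt0 kE.
have kg : k * ga (mu 0) = ofreal (t * modulus (ga (mu 0))).
  rewrite -mulrA (mulrC _^*) -modulus_sqr -rmorphM; congr ofreal.
  by rewrite expr2 mulrA divfK // gt_eqF.
pose G w := k * g w.
have GE w : modulus w < 1 -> k ^+ q * F w = G w ^+ q.
  by move=> w1; rewrite /G [in RHS](exprMn _ k) gE.
have GA : analytic_on_disc G.
  by move=> w w1; apply: analyticM; [exact: analytic_cst|exact: gA].
have GE' w : k ^+ q * g w ^+ q = G w ^+ q by rewrite /G [in RHS](exprMn _ k).
exists G, (fun n => k ^+ q * b n), (t * modulus (ga (mu 0))); split.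
- exact: GA.
- by apply: eq_taylor (taylorZ (k := k ^+ q) tg) => w _; exact: GE'.
- have := sqZ (k := k ^+ q) cA; rewrite modulusX kE -exprM tE.
  by rewrite invfM mulfVK // gt_eqF.
- move=> n; have gl := taylor_expansion tga (z1 n).
  apply/(expansion_vanishes _ (expansionM (expansion_cst k (z n)) gl)) => j jn.
  rewrite /conv big_nat_recl //= subn0 ((expansion_vanishes _ gl).1 (gv n)) // mulr0 add0r.
  by rewrite big1 // => i _; rewrite mul0r.
- by apply: eq_kernel (kernelZ (k ^+ q) kb) => w w1; exact: GE.
- have [p0 [c [sp0 fE]]] := pf.
  exists (k ^+ q *: p0), (fun n j => k ^+ q * c n j); split.
    by apply: leq_trans (size_scale_leq _ _) sp0.
  move=> w w1; rewrite -GE // fE // mulrDr hornerZ mulr_sumr; congr (_ + _).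
  by apply: eq_bigr => n _; rewrite mulr_sumr; apply: eq_bigr => j _; rewrite mulrA.
- move=> n; pose U w := k ^+ q * (Q.[w] / \prod_(n <- off_origin z) (1 - (z n)^* * w) ^+ (e n).+1).
  have UA : analytic_on_disc U.
    have [a ta _] := overconvergent_poly Q.
    move=> w w1; apply: analyticM; first exact: analytic_cst.
    apply: analyticM; first exact: (taylor_analytic ta).
    apply: (@eq_analytic _ (fun w => \prod_(n <- off_origin z) ((1 - (z n)^* * w)^-1) ^+ (e n).+1)).
      by move=> v; rewrite -prodfV; apply: eq_bigr => l _; rewrite exprVn.
    apply: analytic_prod => l _; apply: analyticX.
    by apply: (taylor_analytic (taylor_geometric _)) => //; rewrite modulus_conj ltW.
  have [u hu u0] := @zero_poly_factor R N z e z1 U n UA.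
  have r0 : 0 < 1 - modulus (z n) by rewrite subr_gt0.
  have hG : expansion (fun w => G w ^+ q) (z n) (shift_seq (e n) u).
    apply: (expansion_eq_near r0 _ hu) => v vr; rewrite -GE; last first.
      by apply: le_lt_trans (ler_modulusD _ _) _; rewrite -ltrBrDl.
    by rewrite /U /F mulrCA.
  split; first by apply/(expansion_vanishes _ hG) => j jn; rewrite /shift_seq jn.
  apply/eqP; rewrite (expansion_derive1n _ hG) /shift_seq ltnn subnn u0.
  apply: mulf_neq0; first by rewrite pnatr_eq0 -lt0n fact_gt0.
  apply: mulf_neq0.
    apply/prodf_neq0 => l ln.
    by rewrite expf_neq0 // subr_eq0 (inj_eq z_inj) eq_sym.
  rewrite /U; apply: mulf_neq0; first by rewrite expf_neq0.
  apply: mulf_neq0; last by rewrite invr_neq0 // D0.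
  by apply/negP => /Qroots; rewrite leNgt z1.
- by rewrite mulr_gt0.
- by rewrite bmE -exprMn kg rmorphXn.
- have h := taylor_expansion0 (taylorZ (k := k) tga).
  by rewrite (expansion_derive1n (mu 0) h) kg.
Qed.

End CanonicalDivisor.

(** * Extremality and uniqueness *)

Section Extremality.
Variable R : realType.
Local Notation C := (cplx R).
Implicit Types (a b : nat -> C) (f g G H : C -> C) (A s : R).
Variables (q : nat) (N : nat) (z : 'I_N -> C) (d : 'I_N -> nat).
Hypothesis q0 : (0 < q)%N.
Hypothesis z1 : forall n, modulus (z n) < 1.
Hypothesis z_inj : injective z.
Local Notation p := ((q * 2)%:R : R).
Local Notation e := (fun n => q * d n)%N.
Local Notation m := (origin_mult z e).
Local Notation mu := (finite_zero_set z d).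
Local Notation c0 := (disc_mass R).

Lemma unit_disc0 : unit_disc (0 : C).
Proof. by apply/unit_discE; rewrite modulus0. Qed.

Lemma positive_derive f (g0 : nat -> C) : taylor f g0 -> 0 < derive1n (mu 0) f 0 ->
  exists2 s, 0 < s & g0 (mu 0) = ofreal s.
Proof.
move=> fg; rewrite (expansion_derive1n _ (taylor_expansion0 fg)) pmulr_rgt0; last first.
  by rewrite ltr0n fact_gt0.
by move=> /ofreal_gt0P.
Qed.

Lemma Nspace_vanishes f : Nspace p mu f -> forall n, vanishes_to_order f (z n) (d n).
Proof.
by move=> [_ h] n; rewrite -(finite_zero_setE d z_inj); apply: h; apply/unit_discE.
Qed.

Variables (G : C -> C) (b : nat -> C) (s : R).
Hypothesis GD : divisor_data q z d G b s.

Lemma divisor_Nspace : Nspace p mu G.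
Proof.
split; first split; first exact: data_analytic GD.
  exact: bergman_norm_lty (data_taylor GD) (data_norm GD).
move=> w w1; have [[n <-]|no] := pselect (exists n, z n = w).
  rewrite (finite_zero_setE d z_inj); exact: (data_vanishes GD).
by rewrite finite_zero_set_out // => n zn; apply: no; exists n.
Qed.

Lemma divisor_norm1 : bergman_norm p G = 1%E.
Proof. by apply/(bergman_norm_eq1 q0 (data_taylor GD) (data_norm GD)). Qed.

Lemma divisor_positive : 0 < derive1n (mu 0) G 0.
Proof.
rewrite (data_derive GD) mulr_gt0 ?ltr0n ?fact_gt0 //.
by rewrite ofreal_gt0 (data_pos GD).
Qed.

(** [f] and [ze * G] differ by a constant factor, so [f] is a multiple of [G] by a number
    of modulus 1, which is 1 because both derivatives are positive. *)
Lemma divisor_root_unique f ze : analytic_on_disc f -> 0 < derive1n (mu 0) f 0 ->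
  modulus ze = 1 -> (forall w, modulus w < 1 -> f w ^+ q = ze ^+ q * G w ^+ q) ->
  eq_disc f G.
Proof.
move=> fA fpos zE fG.
have GA := data_analytic GD.
have kA : analytic_on_disc (fun w => ze * G w).
  by move=> w w1; apply: analyticM; [exact: analytic_cst|exact: GA].
have [|ze' z'q fE] := pow_eq_proportional q0 fA kA.
  by move=> w w1; rewrite exprMn fG.
have [g0 fg] := analytic_taylor fA; have [ps Gps] := analytic_taylor GA.
have [sf sf0 sfE] := positive_derive fg fpos.
have [s' s'0 s'E] := positive_derive Gps divisor_positive.
have t : taylor f (fun n => ze' * (ze * ps n)).
  by apply: eq_taylor (taylorZ (k := ze') (taylorZ (k := ze) Gps)) => w w1; rewrite fE.
have E := taylor_unique fg t.
have : ofreal sf = (ze' * ze) * ofreal s' by rewrite -s'E -sfE E mulrA.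
move=> E'; have z'1 : modulus ze' = 1.
  apply/eqP; rewrite -(@pexpr_eq1 _ _ q) ?modulus_ge0 //.
  by rewrite -modulusX z'q modulus1.
have ss : sf = s'.
  have := congr1 (@modulus R) E'; rewrite !modulusM z'1 zE !mul1r.
  by rewrite !modulus_ofreal ?ltW.
have z1' : ze' * ze = 1.
  have n0 : ofreal s' != 0 :> C.
    by rewrite ofreal_eq0 gt_eqF.
  by apply: (mulIf n0); rewrite -E' ss mul1r.
by move=> w /unit_discE w1; rewrite fE // mulrA z1' mul1r.
Qed.

(** The weighted squared norm of [f^q - G^q] is [2 / c0 * (1 - t)], where [t] is the quotient of
    the leading coefficients of [f^q] and [G^q]. *)
Lemma divisor_extremal f : Nspace p mu f -> bergman_norm p f = 1%E ->
  0 < derive1n (mu 0) f 0 ->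
  derive1n (mu 0) f 0 <= derive1n (mu 0) G 0 /\
  (derive1n (mu 0) f 0 = derive1n (mu 0) G 0 -> eq_disc f G).
Proof.
move=> fN f1 fpos; have fA := fN.1.1.
have [a [fa [A aA]]] := bergman_space_sq q0 fN.1.
have AE := (bergman_norm_eq1 q0 fa aA).1 f1; rewrite AE in aA.
have za := power_zero_space z1 fA (Nspace_vanishes fN) fa.
have [g0 fg] := analytic_taylor fA.
have [sf sf0 sfE] := positive_derive fg fpos.
have low j : (j < mu 0)%N -> g0 j = 0.
  apply: ((expansion_vanishes _ (taylor_expansion0 fg)).1 _ j); apply: fN.2; exact: unit_disc0.
have am : a m = ofreal (sf ^+ q).
  have [b' [fb' _]] := expansionX_low q (taylor_expansion0 fg) low.
  by rewrite (expansion_unique fb' (taylor_expansion0 fa)) -origin_mult_mu // => ->;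
    rewrite sfE rmorphXn.
have zb := power_zero_space z1 (data_analytic GD) (data_vanishes GD) (data_taylor GD).
have [ga gaE hg] := kernel_norm (data_kernel GD) zb (data_norm GD).
have s0 := data_pos GD; have c00 := disc_mass_gt0 R.
have sq0 : 0 < s ^+ q by exact: exprn_gt0.
have cE : ga * a m = ofreal (c0^-1 * (sf ^+ q / s ^+ q)).
  have n0 : ofreal (s ^+ q) != 0 :> C.
    by rewrite ofreal_eq0 gt_eqF.
  have -> : ga = ofreal c0^-1 / ofreal (s ^+ q) by rewrite gaE (data_lead GD) mulfK.
  by rewrite am !rmorphM (fmorphV (@ofreal R) (s ^+ q)) -mulrA [X in _ * X]mulrC.
have := hg _ _ za; rewrite cE => cI.
have := sq_sub (t := 1) aA (data_norm GD) cI.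
rewrite conjC1 mul1r re_ofreal modulus1 expr1n mul1r => cD.
have D0 := sq_ge0 cD.
have dE : derive1n (mu 0) f 0 = (mu 0)`!%:R * ofreal sf.
  by rewrite (expansion_derive1n _ (taylor_expansion0 fg)) sfE.
have ci0 : 0 < c0^-1 by rewrite invr_gt0.
split.
  rewrite dE (data_derive GD) ler_pM2l ?ltr0n ?fact_gt0 // ofreal_le.
  rewrite -(ler_pXn2r q0) ?nnegrE ?(ltW sf0) ?(ltW s0) // -[s ^+ q]mul1r -ler_pdivrMr //.
  by rewrite -(ler_pM2l ci0) mulr1; lra.
rewrite dE (data_derive GD) => /mulfI E.
have {}E : sf = s by apply: (@ofreal_inj R); apply: E; rewrite pnatr_eq0 -lt0n fact_gt0.
apply: (divisor_root_unique (ze := 1)) => //; first exact: modulus1.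
move=> w w1; rewrite expr1n mul1r.
have z0 : sq (fun n => a n - 1 * b n) @ \oo --> (0 : R).
  by move: cD; rewrite E mulfV ?gt_eqF // mulr1 (_ : _ - _ + _ = 0) //; ring.
have ab : a = b.
  by apply/funext => n; apply/eqP; rewrite -subr_eq0 -[b n]mul1r (sq_eq0 n z0).
by apply: (psum_unique (fa w w1)); rewrite ab; exact: (data_taylor GD w1).
Qed.

(** [H^q] and [G^q] are both kernels with the given zeros, hence proportional by
    [kernel_nonzero], with a factor of modulus 1 since their norms agree. *)
Lemma principal_unique H : bergman_space p H -> bergman_norm p H = 1%E ->
  0 < derive1n (mu 0) H 0 ->
  (forall n, vanishes_to_order (fun w => H w ^+ q) (z n) (e n)) ->
  principal_form z e (fun w => H w ^+ q) -> eq_disc H G.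
Proof.
move=> HB H1 Hpos Hv Hf; have HA := HB.1.
have [a [Ha [A aA]]] := bergman_space_sq q0 HB.
have AE := (bergman_norm_eq1 q0 Ha aA).1 H1; rewrite AE in aA.
have [a' ka'] := principal_form_kernel z1 z_inj Hf.
have aa' := taylor_unique ka'.1 Ha; rewrite aa' in ka'.
have za : zero_space z e (fun w => H w ^+ q) a by apply/(zero_spaceP e z1 Ha).
have zb := power_zero_space z1 (data_analytic GD) (data_vanishes GD) (data_taylor GD).
have s0 := data_pos GD.
have bm : b m != 0.
  rewrite (data_lead GD) ofreal_eq0.
  by rewrite expf_neq0 // gt_eqF.
pose r := a m / b m.
have zK := zero_spaceD z1 za (zero_spaceZ z1 (- r) zb).
have kK := kernelD ka' (kernelZ (- r) (data_kernel GD)).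
have K0 : a m + - r * b m = 0 by rewrite mulNr /r divfK // subrr.
have HG w : modulus w < 1 -> H w ^+ q = r * G w ^+ q.
  move=> w1; apply/eqP; rewrite -subr_eq0 -mulNr.
  by rewrite (kernel_nonzero kK zK K0 w1).
have r1 : modulus r = 1.
  have t : taylor (fun w => H w ^+ q) (fun n => r * b n).
    by apply: eq_taylor (taylorZ (k := r) (data_taylor GD)) => w w1; rewrite HG.
  have aE := taylor_unique Ha t.
  have c1 := sqZ (k := r) (data_norm GD); rewrite -aE in c1.
  have ci0 : 0 < c0^-1 by rewrite invr_gt0 disc_mass_gt0.
  have /eqP : modulus r ^+ 2 * c0^-1 = 1 * c0^-1.
    by rewrite mul1r; exact: (cvg_unique _ c1 aA).
  rewrite (inj_eq (mulIf (lt0r_neq0 ci0))) => /eqP h.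
  by apply/eqP; rewrite -(@pexpr_eq1 _ _ 2) ?modulus_ge0 // h.
apply: (divisor_root_unique (ze := q.-root r)) => //.
  apply/eqP; rewrite -(@pexpr_eq1 _ _ q) ?modulus_ge0 //.
  by rewrite -modulusX rootCK // r1.
by move=> w w1; rewrite rootCK // HG.
Qed.

End Extremality.

(** * The two partial fraction forms *)

Section Forms.
Variable R : realType.
Local Notation C := (cplx R).
Variables (q : nat) (N : nat) (z : 'I_N -> C) (d : 'I_N -> nat).
Hypothesis z_inj : injective z.
Local Notation e := (fun n => q * d n)%N.
Implicit Types F : C -> C.

Lemma off_originE (F' : 'I_N -> C) :
  \sum_(n <- off_origin z) F' n = \sum_(n < N | z n != 0) F' n :> C.
Proof. by rewrite /off_origin big_filter big_enum_cond. Qed.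

Lemma form_off_originP F : (forall n, z n <> 0) ->
  form_off_origin q z d F <-> principal_form z e F.
Proof.
move=> z0; have z0' n : z n != 0 by apply/eqP.
have m0 : origin_mult z e = 0%N by rewrite /origin_mult big1 // => n; rewrite (negPf (z0' n)).
have E (c : 'I_N -> nat -> C) w :
  \sum_(n <- off_origin z) \sum_(0 <= j < e n) c n j / (1 - (z n)^* * w) ^+ j.+2 =
  \sum_(n < N) \sum_(0 <= j < e n) c n j / (1 - (z n)^* * w) ^+ j.+2.
  by rewrite off_originE; apply: eq_bigl => n; rewrite z0'.
split=> [[c0 [c h]]|[p0 [c [sp h]]]].
  exists c0%:P, c; split; first by rewrite size_polyC; case: (c0 != 0).
  by move=> w w1; rewrite h ?hornerC ?E //; apply/unit_discE.
exists p0.[0], c => w /unit_discE w1; rewrite h // E; congr (_ + _).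
by rewrite m0 in sp; rewrite (size1_polyC sp) !hornerC.
Qed.

Lemma form_at_originP F k : z k = 0 ->
  form_at_origin q z d k F <-> principal_form z e F.
Proof.
move=> zk; have mE : origin_mult z e = e k := origin_multE e z_inj zk.
have E (c : 'I_N -> nat -> C) w :
  \sum_(n <- off_origin z) \sum_(0 <= j < e n) c n j / (1 - (z n)^* * w) ^+ j.+2 =
  \sum_(n < N | n != k) \sum_(0 <= j < e n) c n j / (1 - (z n)^* * w) ^+ j.+2.
  by rewrite off_originE; apply: eq_bigl => n; rewrite -zk (inj_eq z_inj).
have P (c : nat -> C) c0 w : (\poly_(i < (e k).+1) (if i == e k then c0 else c i)).[w] =
    c0 * w ^+ e k + \sum_(0 <= j < e k) c j * w ^+ j.
  rewrite horner_poly -(big_mkord predT (fun i => (if i == e k then c0 else c i) * w ^+ i)).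
  rewrite big_nat_recr //= eqxx addrC; congr (_ + _).
  by apply: eq_big_nat => j /andP[_ jk]; rewrite ltn_eqF.
split=> [[c0 [c h]]|[p0 [c [sp h]]]].
  exists (\poly_(i < (e k).+1) (if i == e k then c0 else c k i)), c.
  rewrite mE; split; first exact: size_poly.
  by move=> w w1; rewrite P E h //; apply/unit_discE.
exists p0`_(e k), (fun n j => if n == k then p0`_j else c n j) => w /unit_discE w1.
rewrite h // E eqxx; congr (_ + _); last first.
  by apply: eq_bigr => n /negPf ->.
rewrite -P; congr (_.[w]); apply/polyP => i; rewrite coef_poly -mE.
case: ltnP => [im|mi]; last by rewrite nth_default // (leq_trans sp).
by case: eqP => // ->.
Qed.

End Forms.

Theorem theorem5p2 (R : realType) (p : nat) (p_gt0 : (0 < p)%N)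
    (p_even : ~~ odd p) (N : nat) (N_gt0 : (0 < N)%N)
    (z : 'I_N -> cplx R) (z_disc : forall n, unit_disc (z n))
    (z_inj : injective z)
    (d : 'I_N -> nat) (d_gt0 : forall n, (0 < d n)%N) :
  exists G : cplx R -> cplx R,
    [/\ canonical_divisor (p%:R)%R (finite_zero_set z d) G,
        bergman_space (p%:R)%R G /\ bergman_norm (p%:R)%R G = 1%E,
        divisor_conditions p z d G &
        forall H : cplx R -> cplx R,
          bergman_space (p%:R)%R H -> bergman_norm (p%:R)%R H = 1%E ->
          divisor_conditions p z d H -> eq_disc H G].
Proof.
have z1 n : modulus (z n) < 1 by apply/unit_discE.
pose q := p./2; have pE : p = (q * 2)%N by rewrite muln2 halfK (negPf p_even) subn0.
have q0 : (0 < q)%N by move: p_gt0; rewrite pE muln_gt0 => /andP[].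
have pd n : ((p * d n)./2 = q * d n)%N by rewrite pE mulnAC muln2 doubleK.
have [G [b [s GD]]] := divisor_exists d q0 z1 z_inj.
have GN := divisor_Nspace z_inj GD.
have G1 := divisor_norm1 q0 GD.
have Gpos := divisor_positive GD.
exists G; rewrite /divisor_conditions -/q; rewrite [X in X%:R]pE; split.
- split.
    by split=> // f fN f1 fpos; case: (divisor_extremal q0 z1 z_inj GD fN f1 fpos).
  move=> H [HN H1 Hpos Hmax].
  have [h1 h2] := divisor_extremal q0 z1 z_inj GD HN H1 Hpos.
  by apply: h2; apply/eqP; rewrite eq_le h1 Hmax.
- by split; [exact: GN.1|].
- split.
  + exact: Gpos.
  + by move=> n; rewrite pd; exact: (data_order GD).
  + by move=> z0; apply/form_off_originP => //; exact: (data_form GD).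
  + by move=> k zk; apply/(form_at_originP _ _ z_inj _ zk); exact: (data_form GD).
- move=> H HB H1 [Hpos Hord Hoff Hat].
  apply: (principal_unique q0 z1 z_inj GD HB H1 Hpos).
    by move=> n; have [] := Hord n; rewrite pd.
  have [[k zk]|no] := pselect (exists k, z k = 0).
    by apply/(form_at_originP _ _ z_inj _ zk); exact: Hat.
  have z0 n : z n <> 0 by move=> zn; apply: no; exists n.
  by apply/(form_off_originP _ _ _ z0); exact: Hoff.
Qed.
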